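(* Let the initial positions $(X^i_0)_{i\ge 1}$ be i.i.d. according to $m$ (and independent of the Brownian motions $(W^i)_{i\ge1}$), and let $(X^i_t)_{t\ge 0}$ denote the solution of the McKean nonlinear SDE $$X^i_t=X^i_0+\sigma W^i_t+\int_0^t\lambda(F(s,X^i_s))\,ds,\qquad F(s,x)=\mathbb P(X^i_s\le x).$$ If $\lambda$ is Lipschitz continuous, then for all $\rho>0$ and $T>0$ there exists $C<\infty$ such that for all $N\in\mathbb N^*$, $$\max_{1\le i\le N}\mathbb E\left[\sup_{t\in[0,T]}\left|X^i_t-X^{i,N}_t\right|^\rho+\sup_{t\in[0,T]}\left|X^i_t-\breve X^{i,N}_t\right|^\rho\right]\le C N^{-\rho/2}.$$
   Context: Let $\sigma>0$, let $\Lambda:[0,1]\to\mathbb R$ be $C^1$ with derivative $\lambda$, and let $m$ be a probability measure on $\mathbb R$ (no moment or regularity assumption). $(W^i)_{i\ge 1}$ are independent one-dimensional standard Brownian motions. The nonlinear SDE in the claim has a unique strong solution, and $F(s,\cdot)$ (the cumulative distribution function of $X^i_s$) does not depend on $i$. For $N\in\mathbb N^*=\{1,2,\dots\}$ and $1\le i\le N$ set $\lambda^N(i)=N\left(\Lambda(i/N)-\Lambda((i-1)/N)\right)$. The two interacting particle systems, each having a unique strong solution, are, for $1\le i\le N$, $$X^{i,N}_t=X^i_0+\sigma W^i_t+\int_0^t\lambda^N\Big(\sum_{j=1}^N\mathbf 1_{\{X^{j,N}_s\le X^{i,N}_s\}}\Big)ds,$$ $$\breve X^{i,N}_t=X^i_0+\sigma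 W^i_t+\int_0^t\lambda\Big(\frac1N\sum_{j=1}^N\mathbf 1_{\{\breve X^{j,N}_s\le \breve X^{i,N}_s\}}\Big)ds.$$ *)

(* Defs.v *)
From HB Require Import structures.
From mathcomp Require Import all_boot all_order all_algebra.
From mathcomp Require Import all_classical all_reals all_analysis.
Import Order.TTheory GRing.Theory Num.Theory.
Import numFieldNormedType.Exports.

Set Implicit Arguments.
Unset Strict Implicit.
Unset Printing Implicit Defensive.

Local Open Scope classical_set_scope.
Local Open Scope ring_scope.

(* Particles and driving noises are numbered from 0 instead of 1. Processes are
   indexed by R; only their values at times t >= 0 are ever constrained or
   used. *)

(* At the end points 0 and 1 the derivative is one-sided, since y is confined
   to [0, 1]. *)
Definition C1_unit_interval (R : realType) (Lam lam : R -> R) : Prop :=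
  (forall x, x \in `[0, 1]%R ->
     (Lam y - Lam x) / (y - x) @[y --> within `[0, 1] x^'] --> lam x) /\
  {within `[0, 1], continuous lam}.

Section stochastic_objects.
Context (d : measure_display) (Omega : measurableType d) (R : realType).
Variable P : probability Omega R.
Implicit Types (G H : set (set Omega)) (A B : set Omega).

Definition sigma_rv (I : Type) (D : set I) (Y : I -> Omega -> R) :
    set (set Omega) :=
  <<s \bigcup_(k in D) preimage_set_system setT (Y k) measurable >>.

Definition indep G H : Prop :=
  forall A B, G A -> H B -> P (A `&` B) = (P A * P B)%E.

Definition mutual_indep (I : eqType) (G : I -> set (set Omega)) : Prop :=
  forall (s : seq I) (A : I -> set Omega), uniq s ->
    (forall i, i \in s -> G i (A i)) ->
    P (\big[setI/setT]_(i <- s) A i) = (\prod_(i <- s) P (A i))%E.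

(* For a sigma-algebra G this is the sigma-algebra generated by G and the
   P-null sets. *)
Definition completion G : set (set Omega) :=
  [set A | exists2 B, G B & P.-negligible (A `+` B)].

Definition continuous_paths (Y : R -> Omega -> R) : Prop :=
  forall w, {within `[0, +oo[, continuous (fun t => Y t w)}.

Record brownian_motion (W : R -> {RV P >-> R}) : Prop := {
  bm_continuous : continuous_paths W ;
  bm_start : {ae P, forall w, W 0 w = 0} ;
  bm_increment_indep : forall s t, 0 <= s -> s <= t ->
    indep (sigma_rv `[0, s] W)
          (sigma_rv setT (fun (_ : unit) w => W t w - W s w)) ;
  bm_increment_law : forall s t, 0 <= s -> s < t ->
    forall A : set R, measurable A ->
      P ((fun w => W t w - W s w) @^-1` A) =
      normal_prob 0 (Num.sqrt (t - s)) A
}.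

(* sigma-algebra of (X0 j, W j u), j in J, 0 <= u <= t *)
Definition input_filtration (X0 : nat -> {RV P >-> R})
    (W : nat -> R -> {RV P >-> R}) (J : set nat) (t : R) : set (set Omega) :=
  <<s sigma_rv J X0 `|`
      sigma_rv (J `*` `[0, t]) (fun ju : nat * R => W ju.1 ju.2) >>.

Definition adapted (F : R -> set (set Omega)) (Y : R -> Omega -> R) : Prop :=
  forall t, 0 <= t -> forall A : set R, measurable A ->
    completion (F t) (Y t @^-1` A).

Record initial_and_noise (m : probability R R)
    (X0 : nat -> {RV P >-> R}) (W : nat -> R -> {RV P >-> R}) : Prop := {
  init_law : forall i (A : set R), measurable A ->
    distribution P (X0 i) A = m A ;
  init_indep : mutual_indep (fun i => sigma_rv [set i] X0) ;
  noise_bm : forall i, brownian_motion (W i) ;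
  noise_indep : mutual_indep (fun i => sigma_rv `[0, +oo[ (W i)) ;
  init_noise_indep :
    indep (sigma_rv setT X0)
      (sigma_rv (setT `*` `[0, +oo[) (fun iu : nat * R => W iu.1 iu.2))
}.

(* The drift integrals below are Lebesgue integrals, and lam is only evaluated
   on [0, 1]: the integrands are bounded and measurable in time. *)
Record mckean_strong_solution (sigma : R) (lam : R -> R)
    (X0 : nat -> {RV P >-> R}) (W : nat -> R -> {RV P >-> R}) (i : nat)
    (X : R -> {RV P >-> R}) : Prop := {
  mckean_continuous : continuous_paths X ;
  mckean_adapted : adapted (input_filtration X0 W [set i]) X ;
  mckean_equation : {ae P, forall w, forall t, 0 <= t ->
    X t w = X0 i w + sigma * W i t w +
      \int[lebesgue_measure]_(s in `[0, t]) lam (fine (cdf (X s) (X s w)))}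
}.

Definition rank_at (N : nat) (X : 'I_N -> R -> {RV P >-> R}) (s : R)
    (w : Omega) (i : 'I_N) : nat :=
  (\sum_(j < N) (X j s w <= X i s w)%R)%N.

(* N-particle system whose i-th particle has drift b k when its rank is k *)
Record particle_strong_solution (sigma : R) (N : nat) (b : nat -> R)
    (X0 : nat -> {RV P >-> R}) (W : nat -> R -> {RV P >-> R})
    (X : 'I_N -> R -> {RV P >-> R}) : Prop := {
  particle_continuous : forall i, continuous_paths (X i) ;
  particle_adapted : forall i, adapted (input_filtration X0 W `I_N) (X i) ;
  particle_equation : forall i, {ae P, forall w, forall t, 0 <= t ->
    X i t w = X0 i w + sigma * W i t w +
      \int[lebesgue_measure]_(s in `[0, t]) b (rank_at X s w i)}
}.

Definition sup_dist (rho T : R) (Y Z : R -> Omega -> R) (w : Omega) : \bar R :=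
  ereal_sup [set (`|Y t w - Z t w| `^ rho)%:E | t in `[0, T]].

End stochastic_objects.

Definition lambdaN (R : realType) (Lam : R -> R) (N k : nat) : R :=
  N%:R * (Lam (k%:R / N%:R) - Lam ((k%:R - 1) / N%:R)).

(* Main.v *)
(* Let F_s be the distribution function of X^i_s. Comparing X on short time
   windows with its Gaussian part gives P(|X_t - x| <= h) <= c h / sqrt t, so
   F_s is (c / sqrt s)-Lipschitz. An Euler scheme, whose law does not depend on
   the driving noise, then shows that F_s does not depend on i. Hence the
   F_s(X^j_s) are independent and uniform, and dyadic chaining bounds the moments
   of Z_s, the uniform distance between F_s and the empirical distribution
   function, by those of order N^(-1/2).
   If |X^j_s - X^{j,N}_s| <= delta for all j <= N, then the normalized rank of
   X^{i,N}_s differs from F_s(X^i_s) by at most Z_s + 2 c delta / sqrt s. As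
   s^(-1/2) is integrable, the weight exp(- k sqrt t) turns this into a
   contraction, and the distance is at most a constant times
   int_0^T Z_s ds + 1/N. *)
Require Import Defs.
From HB Require Import structures.
From mathcomp Require Import all_boot all_order all_algebra.
From mathcomp Require Import all_classical all_reals all_analysis.
From mathcomp Require Import measurable_realfun ring lra.
Import Order.TTheory GRing.Theory Num.Theory.
Import numFieldNormedType.Exports.

Set Implicit Arguments.
Unset Strict Implicit.
Unset Printing Implicit Defensive.

Local Open Scope classical_set_scope.
Local Open Scope ring_scope.

(** * Independence and filtrations *)

(** As [m] may have atoms, [F_s] need not be Lipschitz uniformly near time 0, and everything rests
    on the integrability of [c / sqrt s]. The weight [exp (k sqrt s)] is made for this singularity:
    up to the factor [2 / k] it is the primitive of [exp (k sqrt s) / sqrt s], so a large [k] makes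
    the feedback at most one half. This serves both for the equality of the laws and for the
    particles. Each [X i] is given with its own distribution function. Since [X i] and [X j] have
    different inputs, they cannot be compared pathwise; each is compared with an Euler scheme fed by
    its own noise, and these two schemes have the same law. Ranks are discontinuous in the
    positions: an error [delta] on the particles is turned into a shift of the threshold by
    [2 delta], which is harmless once the empirical distribution function is replaced by [F_s]. Only
    the time integral of [Z_s] enters, so moments at fixed times and Tonelli suffice, with no
    supremum over time of [Z_s]. *)

Lemma g_sigma_measurable_sub d (T : measurableType d) (G : set (set T)) :
  G `<=` measurable -> <<s G >> `<=` measurable.
Proof.
by move=> Gm; apply: smallest_sub => //; exact: sigma_algebra_measurable.
Qed.

Lemma g_sigma_sub T (G H : set (set T)) : G `<=` <<s H >> -> <<s G >> `<=` <<s H >>.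
Proof. by move=> GH; apply: smallest_sub => //; exact: smallest_sigma_algebra. Qed.

Lemma g_sigma_setI T (G : set (set T)) A B :
  <<s G >> A -> <<s G >> B -> <<s G >> (A `&` B).
Proof.
move=> sA sB; rewrite -[A `&` B]setCK setCI.
have [_ GD GU] := @smallest_sigma_algebra _ setT G.
have GC C : <<s G >> C -> <<s G >> (~` C) by move=> ?; rewrite -setTD; exact: GD.
apply: (GC); rewrite -bigcup2E; apply: GU => -[|[|n]] /=; [exact: GC|exact: GC|].
by have [] := @smallest_sigma_algebra _ setT G.
Qed.

Lemma g_sigma_setT T (G : set (set T)) : <<s G >> setT.
Proof.
have [G0 GD _] := @smallest_sigma_algebra _ setT G.
by have := GD _ G0; rewrite setD0.
Qed.

(* [g_sigma_algebraType] turns measurability with respect to <<s G >> into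
   library measurability, so that [measurable_funD] and the like apply. *)
Lemma g_sigma_measurable_funP d' (T : pointedType) (T' : measurableType d')
    (G : set (set T)) (f : T -> T') :
  measurable_fun (setT : set (g_sigma_algebraType G)) f <->
  forall A, measurable A -> <<s G >> (f @^-1` A).
Proof.
split=> [mf A mA|mf _ A mA]; last by rewrite setTI; exact: mf.
by have := mf measurableT A mA; rewrite setTI.
Qed.

Section independence.
Context d (T : measurableType d) (R : realType) (P : probability T R).
Implicit Types (G H : set (set T)) (A B C : set T).

Lemma probability_fin_num A : measurable A -> P A \is a fin_num.
Proof. by move=> mA; exact: fin_num_measure. Qed.

(** For fixed [B] in [H], restricting [P] to [B] and scaling [P] by [P B] give two finite measures;
    they agree on a pi-system, hence on what it generates. *)
Lemma indep_g_sigma G H : setI_closed G -> G `<=` measurable ->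
  H `<=` measurable -> indep P G H -> indep P <<s G >> H.
Proof.
move=> GI Gm Hm GH A B sA HB; have mB := Hm _ HB.
pose r : {nonneg R} := NngNum (fine_ge0 (measure_ge0 P B)).
(* [setT] is adjoined so that the constant sequence [setT] is an exhaustion by members of the
   generator. *)
pose G' := [set C | G C \/ C = setT].
have rB : r%:num%:E = P B by rewrite /= fineK// probability_fin_num.
rewrite -[LHS]/(mrestr P mB A) muleC -rB -[RHS]/(mscale r P A).
apply: (g_sigma_algebra_measure_unique G' _ (fun _ => setT)).
- by move=> C [/Gm//|->].
- by move=> _; right.
- by apply/seteqP; split => // x _; exists 0%N.
- move=> C D [GC [GD|->]|-> [GD|->]]; rewrite ?setIT ?setTI; [|left..|right] => //.
  by left; exact: GI.
- move=> C [GC|->]; rewrite /= /mrestr /mscale rB; first by rewrite GH// muleC.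
  by rewrite setTI -[LHS]mule1; congr (_ * _)%E; exact/esym/probability_setT.
- move=> _; change (P (setT `&` B) < +oo)%E.
  by rewrite setTI ltey_eq probability_fin_num.
- apply: g_sigma_sub sA => C GC.
  by apply: sub_gen_smallest; left.
Qed.

Lemma indep_sub G H G' H' : G `<=` G' -> H `<=` H' ->
  indep P G' H' -> indep P G H.
Proof. by move=> GG HH GH A B GA HB; apply: GH; [exact: GG|exact: HH]. Qed.

Lemma measure_eq_negligible A B : measurable A -> measurable B ->
  P.-negligible (A `+` B) -> P A = P B.
Proof.
move=> mA mB; rewrite /setY => nAB.
have nA : P (A `\` B) = 0%E.
  apply: measure_negligible; first exact: measurableD.
  by apply: negligibleS nAB; exact: subsetUl.
have nB : P (B `\` A) = 0%E.
  apply: measure_negligible; first exact: measurableD.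
  by apply: negligibleS nAB; exact: subsetUr.
apply: etrans (measureDI P mA mB) _; apply/esym.
apply: etrans (measureDI P mB mA) _; rewrite setIC.
by congr (_ + _)%E; exact: etrans nB (esym nA).
Qed.

(** A set of the completion may fail to be measurable, and then its [P]-value carries no
    information; hence the intersection with [measurable]. *)
Lemma indep_completion G H : G `<=` measurable -> H `<=` measurable ->
  indep P G H -> indep P (completion P G `&` measurable) H.
Proof.
move=> Gm Hm GH A B [[C GC AC] mA] HB.
have mC := Gm _ GC; have mB := Hm _ HB.
rewrite (measure_eq_negligible mA mC AC) -GH//.
apply: measure_eq_negligible; [exact: measurableI..|].
by apply: negligibleS AC => x [|] /= [[? ?]] /not_andP[]//; [left|right].
Qed.

Section mutual.
Variable I : eqType.
Implicit Types (F : I -> set (set T)) (s : seq I).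

Lemma measurable_bigsetI (A : I -> set T) s :
  (forall i, i \in s -> measurable (A i)) ->
  measurable (\big[setI/setT]_(i <- s) A i).
Proof.
by move=> mA; rewrite big_seq; elim/big_ind: _ => //; exact: measurableI.
Qed.

Lemma mutual_indep_sub F F' : (forall i, F i `<=` F' i) ->
  mutual_indep P F' -> mutual_indep P F.
Proof. by move=> FF' PF s A us As; apply: PF => // i /As/FF'. Qed.

Lemma mutual_indep_completion F : (forall i, F i `<=` measurable) ->
  mutual_indep P F ->
  mutual_indep P (fun i => completion P (F i) `&` measurable).
Proof.
move=> Fm PF s A us As.
have /choice[B BP] i : exists B, i \in s ->
    [/\ F i B, measurable (A i) & P.-negligible (A i `+` B)].
  by case: (boolP (i \in s)) => [/As[[B ? ?] ?]|_]; [exists B|exists set0].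
have nAB r : {subset r <= s} -> P.-negligible
    ((\big[setI/setT]_(i <- r) A i) `+` \big[setI/setT]_(i <- r) B i).
  elim: r => [_|i r IH rs].
    by rewrite !big_nil setYK; exact: negligible_set0.
  have [|_ _ nABi] := BP i; first by apply: rs; rewrite mem_head.
  have nABr : P.-negligible
      ((\big[setI/setT]_(i <- r) A i) `+` \big[setI/setT]_(i <- r) B i).
    by apply: IH => j jr; apply: rs; rewrite inE jr orbT.
  apply: negligibleS (negligibleU nABi nABr); rewrite !big_cons.
  by move=> x [|] /= [[? ?]] /not_andP[]; tauto.
rewrite (measure_eq_negligible _ _ (nAB s _))//.
- rewrite PF//; last by move=> i /BP[].
  rewrite !big_seq; apply: eq_bigr => i /BP[FB mA nABi]; apply/esym.
  by apply: measure_eq_negligible => //; exact: Fm FB.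
- by apply: measurable_bigsetI => i /BP[].
- by apply: measurable_bigsetI => i /BP[/Fm].
Qed.

(** The pi-systems are enlarged one index at a time, each enlargement being a case of
    [indep_g_sigma] against the intersection of all other events. *)
Lemma mutual_indep_g_sigma F : (forall i, setI_closed (F i)) ->
  (forall i, F i `<=` measurable) ->
  mutual_indep P F -> mutual_indep P (fun i => <<s F i >>).
Proof.
move=> FI Fm PF s A us As.
(* Induction on [s1]: its indices already carry events of the generated sigma-algebras, those of
   [s2] still events of the pi-systems. *)
suff H s1 s2 (A' : I -> set T) : uniq (s1 ++ s2) -> (forall i, i \in s1 -> <<s F i >> (A' i)) ->
    (forall i, i \in s2 -> F i (A' i)) ->
    P (\big[setI/setT]_(i <- s1 ++ s2) A' i) = (\prod_(i <- s1 ++ s2) P (A' i))%E.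
  by rewrite -[s]cats0; apply: H => //; rewrite cats0.
elim: s1 s2 A' => [|i s1 IH] s2 A' /=; first by move=> u2 _; exact: PF.
move=> /andP[i12 u12] sA' FA'.
pose C := \big[setI/setT]_(j <- s1 ++ s2) A' j.
have mA' j : j \in s1 ++ s2 -> measurable (A' j).
  rewrite mem_cat => /orP[js|/FA'/Fm//].
  by apply: (g_sigma_measurable_sub (@Fm j)); apply: sA'; rewrite inE js orbT.
have mC : measurable C by exact: measurable_bigsetI.
have PC : P C = (\prod_(j <- s1 ++ s2) P (A' j))%E.
  by apply: IH => // j js; apply: sA'; rewrite inE js orbT.
have FC : indep P (F i) [set C].
  move=> B _ FB ->.
  (* With a pi-system event [B] in place of [A' i], the index [i] can be moved to the second list,
     where the induction hypothesis applies. *)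
  pose A1 j := if j == i then B else A' j.
  have A1E j : j \in s1 ++ s2 -> A1 j = A' j.
    by rewrite /A1; case: eqP => // ->; rewrite (negbTE i12).
  have CE : C = \big[setI/setT]_(j <- s1 ++ s2) A1 j.
    by rewrite /C !big_seq; apply: eq_bigr => j /A1E.
  have A1i : A1 i = B by rewrite /A1 eqxx.
  have := IH (i :: s2) A1; rewrite -cat_rcons -cats1 -!catA /=.
  have pp : perm_eq (s1 ++ i :: s2) (i :: s1 ++ s2).
    by rewrite -cat1s perm_catCA.
  rewrite !(perm_big _ pp) !big_cons A1i -CE => ->.
  - congr (_ * _)%E; rewrite PC !big_seq; apply: eq_bigr => j /A1E -> //.
  - by rewrite (perm_uniq pp) /= i12.
  - by move=> j js; rewrite A1E ?mem_cat ?js//; apply: sA'; rewrite inE js orbT.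
  - move=> j; rewrite inE => /predU1P[->|js]; first by rewrite A1i.
    by rewrite A1E ?mem_cat ?js ?orbT//; exact: FA'.
rewrite !big_cons -/C -PC.
apply: (indep_g_sigma (FI i) (@Fm i) _ FC) => //; first by move=> _ ->.
by apply: sA'; rewrite mem_head.
Qed.

End mutual.
End independence.

Section sigma_rv_theory.
Context d (Omega : measurableType d) (R : realType) (P : probability Omega R).

Lemma sigma_rv_mem (I : Type) (D : set I) (Y : I -> Omega -> R) k A :
  D k -> measurable A -> sigma_rv D Y (Y k @^-1` A).
Proof.
move=> Dk mA; apply: sub_gen_smallest; exists k => //.
by exists A => //; rewrite setTI.
Qed.

Lemma sigma_rv_sub (I : Type) (D : set I) (Y : I -> Omega -> R) G :
  (forall k A, D k -> measurable A -> <<s G >> (Y k @^-1` A)) ->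
  sigma_rv D Y `<=` <<s G >>.
Proof.
by move=> YG; apply: g_sigma_sub => _ [k Dk [A mA <-]]; rewrite setTI; exact: YG.
Qed.

Lemma sigma_rv_measurable (I : Type) (D : set I) (Y : I -> Omega -> R) :
  (forall k, measurable_fun setT (Y k)) -> sigma_rv D Y `<=` measurable.
Proof.
by move=> mY; apply: g_sigma_measurable_sub => _ [k Dk [A mA <-]]; exact: mY.
Qed.

Variables (m : probability R R) (X0 : nat -> {RV P >-> R}).
Variables (W : nat -> R -> {RV P >-> R}).
Hypothesis inputs : initial_and_noise m X0 W.

Let noise := sigma_rv (setT `*` `[0, +oo[) (fun iu : nat * R => W iu.1 iu.2).

Lemma sigma_rv_noise i (D : set R) : (forall u, D u -> 0 <= u) ->
  sigma_rv D (W i) `<=` noise.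
Proof.
move=> D0; apply: sigma_rv_sub => u A Du mA.
apply: (@sigma_rv_mem _ _ (fun iu : nat * R => W iu.1 iu.2 : _ -> _) (i, u)) => //.
by split => //=; rewrite in_itv/= andbT D0.
Qed.

Lemma sigma_rv_increment i s t : 0 <= s -> 0 <= t ->
  sigma_rv setT (fun (_ : unit) w => W i t w - W i s w) `<=` noise.
Proof.
move=> s0 t0; apply: sigma_rv_sub => _ A _ mA.
apply: (@g_sigma_measurable_funP _ Omega _ _ (fun w => W i t w - W i s w)).1 => //.
by apply: measurable_funB; apply/g_sigma_measurable_funP => B mB;
  apply: (@sigma_rv_noise i [set u | 0 <= u]) => //; exact: sigma_rv_mem.
Qed.

Lemma noise_measurable : noise `<=` measurable.
Proof. by apply: sigma_rv_measurable => -[i u]. Qed.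

Lemma initial_measurable (D : set nat) : sigma_rv D X0 `<=` measurable.
Proof. by apply: sigma_rv_measurable => i. Qed.

(** A pi-system for the joint past of an initial position and a noise; on it, probabilities factor
    by [init_noise_indep]. *)
Let rectangles (G H : set (set Omega)) : set (set Omega) :=
  [set A `&` B | A in G & B in H].

Lemma rectangles_setI (G H : set (set Omega)) :
  setI_closed G -> setI_closed H -> setI_closed (rectangles G H).
Proof.
move=> GI HI _ _ [A GA [B HB <-]] [A' GA' [B' HB' <-]].
by exists (A `&` A'); [exact: GI|exists (B `&` B'); [exact: HI|rewrite setIACA]].
Qed.

Lemma input_filtration_sub i t : input_filtration X0 W [set i] t `<=`
  <<s rectangles (sigma_rv [set i] X0) (sigma_rv `[0, t] (W i)) >>.
Proof.
apply: g_sigma_sub => A [sA|sA]; apply: sub_gen_smallest.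
  by exists A => //; exists setT; [exact: g_sigma_setT|rewrite setIT].
exists setT; first exact: g_sigma_setT.
exists A; last by rewrite setTI.
apply: sigma_rv_sub sA => -[j u] B [/= -> ut] mB.
exact: sigma_rv_mem.
Qed.

Lemma filtration_rv_measurable i t :
  input_filtration X0 W [set i] t `<=` measurable.
Proof.
apply: g_sigma_measurable_sub => A [sA|]; first exact: initial_measurable sA.
by apply: sigma_rv_measurable => -[].
Qed.

(** On a rectangle, the initial event splits off from past and increment together, and the Brownian
    property then separates the past from the increment. *)
Lemma input_filtration_indep_increment i s t : 0 <= s -> s <= t ->
  indep P (input_filtration X0 W [set i] s)
          (sigma_rv setT (fun (_ : unit) w => W i t w - W i s w)).
Proof.
move=> s0 st; apply: indep_sub (@input_filtration_sub i s) (fun _ => id) _.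
have t0 : 0 <= t by exact: le_trans st.
have Wnn (u : R) : [set` `[0, s]] u -> 0 <= u by rewrite /= in_itv/= => /andP[].
have inc := @sigma_rv_increment i s t s0 t0.
have rectm : rectangles (sigma_rv [set i] X0) (sigma_rv `[0, s] (W i)) `<=` measurable.
  move=> _ [A sA [B sB <-]]; apply: measurableI.
    exact: initial_measurable sA.
  exact: noise_measurable (sigma_rv_noise Wnn sB).
apply: indep_g_sigma => //.
- by apply: rectangles_setI; exact: g_sigma_setI.
- by apply: subset_trans inc _; exact: noise_measurable.
- move=> _ C [A sA [B sB <-]] sC.
  have sA' : sigma_rv setT X0 A.
    by apply: sigma_rv_sub sA => k E _ mE; exact: sigma_rv_mem.
  have sB' := sigma_rv_noise Wnn sB; have sC' := inc _ sC.
  rewrite -setIA (init_noise_indep inputs sA' (g_sigma_setI sB' sC')).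
  rewrite (init_noise_indep inputs sA' sB').
  by rewrite (bm_increment_indep (noise_bm inputs i) s0 st sB sC) muleA.
Qed.

Lemma input_filtration_mutual_indep t :
  mutual_indep P (fun i => input_filtration X0 W [set i] t).
Proof.
pose F i := rectangles (sigma_rv [set i] X0) (sigma_rv `[0, t] (W i)).
apply: (@mutual_indep_sub _ _ _ _ _ _ (fun i => <<s F i >>)).
  by move=> i; exact: input_filtration_sub.
have Wnn (u : R) : [set` `[0, t]] u -> 0 <= u by rewrite /= in_itv/= => /andP[].
apply: mutual_indep_g_sigma.
- by move=> i; apply: rectangles_setI; exact: g_sigma_setI.
- move=> i _ [A sA [B sB <-]]; apply: measurableI.
    exact: initial_measurable sA.
  exact: noise_measurable (sigma_rv_noise Wnn sB).
move=> s A us As.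
have /choice[B BP] i : exists B : set Omega * set Omega, i \in s ->
    [/\ sigma_rv [set i] X0 B.1, sigma_rv `[0, t] (W i) B.2 & A i = B.1 `&` B.2].
  case: (boolP (i \in s)) => [/As[B1 ? [B2 ? <-]]|_]; last by exists (set0, set0).
  by exists (B1, B2).
have initB i : i \in s -> sigma_rv setT X0 (B i).1.
  by move=> /BP[+ _ _]; apply: sigma_rv_sub => k E _ mE; exact: sigma_rv_mem.
have noiseB i : i \in s -> noise (B i).2.
  by move=> /BP[_ + _]; exact: sigma_rv_noise.
have -> : \big[setI/setT]_(i <- s) A i =
    (\big[setI/setT]_(i <- s) (B i).1) `&` \big[setI/setT]_(i <- s) (B i).2.
  by rewrite -big_split/= !big_seq; apply: eq_bigr => i /BP[].
rewrite (init_noise_indep inputs); first last.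
- rewrite big_seq; elim/big_ind: _ => //; first exact: g_sigma_setT.
  by move=> ? ?; exact: g_sigma_setI.
- rewrite big_seq; elim/big_ind: _ => //; first exact: g_sigma_setT.
  by move=> ? ?; exact: g_sigma_setI.
rewrite (init_indep inputs)//; last by move=> i /BP[].
rewrite (noise_indep inputs)//; last first.
  move=> i /BP[_ + _]; apply: sigma_rv_sub => k E /Wnn k0 mE.
  by apply: sigma_rv_mem => //=; rewrite in_itv/= andbT.
rewrite -big_split/= !big_seq; apply: eq_bigr => i si.
have [_ _ ->] := BP _ si.
by rewrite (init_noise_indep inputs)//; [exact: initB|exact: noiseB].
Qed.

End sigma_rv_theory.

(** * Gaussian regularization and the density bound *)

Section joint_law.
Context d (T : measurableType d) (R : realType) (P : probability T R).
Local Open Scope ereal_scope.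

(** Independence makes the joint law a product measure; Tonelli then integrates out [xi] with [Y]
    frozen. *)
Lemma ge0_integral_indep_pair (Y xi : {RV P >-> R}) (f : R * R -> \bar R) :
  (forall A B, measurable A -> measurable B ->
    P (Y @^-1` A `&` xi @^-1` B) = P (Y @^-1` A) * P (xi @^-1` B)) ->
  measurable_fun setT f -> (forall z, 0 <= f z) ->
  \int[P]_w f (Y w, xi w) =
  \int[P]_w \int[distribution P xi]_z f (Y w, z).
Proof.
move=> ind mf f0.
pose h w := (Y w, xi w).
have mh : measurable_fun setT h by apply/measurable_fun_pairP; split.
pose hm : {mfun T >-> (R * R)%type} := HB.pack h (isMeasurableFun.Build _ _ _ _ _ mh).
rewrite -[LHS](@ge0_integral_distribution _ _ _ _ _ P hm)//.
have -> : \int[distribution P hm]_z f z =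
    \int[distribution P Y \x distribution P xi]_z f z.
  apply: eq_measure_integral => A mA _; apply/esym.
  by apply: product_measure_unique => // A1 A2 mA1 mA2; exact: ind.
rewrite fubini_tonelli1//= ge0_integral_distribution//=.
- exact: measurable_fun_fubini_tonelli_F.
- by move=> y; exact: integral_ge0.
Qed.

End joint_law.

Section gaussian.
Context {R : realType}.
Implicit Types a b v y z e s h : R.
Notation mu := (@lebesgue_measure R).

Lemma integral_normal_prob m s (f : R -> R) : measurable_fun setT f ->
  (exists M, forall x, `|f x| <= M) ->
  (\int[normal_prob m s]_x (f x)%:E =
   \int[mu]_x (f x * normal_pdf m s x)%:E)%E.
Proof.
move=> mf [M fM].
have dom := @normal_prob_dominates R m s.
have intf : (normal_prob m s).-integrable setT (EFin \o f).
  apply: measurable_bounded_integrable => //.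
    by rewrite [ltLHS]probability_setT ltry.
  by exists M; split; [exact: num_real|move=> N MN x _; exact: le_trans (ltW MN)].
rewrite -(Radon_Nikodym_change_of_variables dom)//=.
under [RHS]eq_integral do rewrite EFinM.
apply: ae_eq_integral => //.
- apply: emeasurable_funM; first exact/measurable_EFinP.
  apply: (measurable_int mu); exact: Radon_Nikodym_integrable.
- apply: emeasurable_funM; apply/measurable_EFinP => //.
  exact: measurable_normal_pdf.
(* It remains to see that the Radon-Nikodym derivative is [normal_pdf] almost everywhere: both
   integrate to [normal_prob] over measurable sets. *)
- apply: ae_eqe_mul2l => /=.
  rewrite Radon_NikodymE/=.
  case: cid => /= h [h1 h2 h3].
  apply: integral_ae_eq => //=.
  + by apply/measurable_EFinP; exact: measurable_normal_pdf.
  + by move=> E E01 mE; rewrite -h3.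
Qed.

(** Parametrized by the variance, which is what adds up under convolution, whereas [normal_pdf]
    takes the standard deviation. *)
Definition gauss_pdf v z := normal_pdf 0 (Num.sqrt v) z.

Lemma gauss_pdfE v z : 0 < v ->
  gauss_pdf v z = (Num.sqrt (v * pi *+ 2))^-1 * expR (- z ^+ 2 / (v *+ 2)).
Proof.
move=> v0; rewrite /gauss_pdf normal_pdfE ?sqrtr_eq0 -?ltNge//.
by rewrite /normal_peak /normal_fun sqr_sqrtr ?ltW// subr0.
Qed.

Lemma gauss_pdf_ge0 v z : 0 <= gauss_pdf v z.
Proof. exact: normal_pdf_ge0. Qed.

Lemma measurable_gauss_pdf v : measurable_fun setT (gauss_pdf v).
Proof. exact: measurable_normal_pdf. Qed.

Lemma gauss_pdf_ub v z : 0 < v -> gauss_pdf v z <= (Num.sqrt v)^-1.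
Proof.
move=> v0; rewrite gauss_pdfE//.
have sv : 0 < Num.sqrt v by rewrite sqrtr_gt0.
apply: (@le_trans _ _ ((Num.sqrt v)^-1 * 1)); last by rewrite mulr1.
apply: ler_pM; rewrite ?expR_ge0 ?invr_ge0//.
  rewrite lef_pV2 ?posrE ?sqrtr_gt0 ?pmulrn_lgt0 ?mulr_gt0 ?pi_gt0//.
  apply: ler_wsqrtr; rewrite -mulrnAr ler_peMr ?ltW//.
  by have := @pi_ge2 R; lra.
rewrite -[leRHS]expR0 ler_expR mulNr oppr_le0 divr_ge0 ?sqr_ge0//.
by rewrite mulrn_wge0 ?ltW.
Qed.

(** Makes a multiple of the density dominate the indicator of the interval of radius [h]. The
    exponent is at least -1/2 there; [expR (- 1)] is a convenient smaller value. *)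
Lemma gauss_pdf_lb h z : 0 < h -> `|z| <= h ->
  (expR (- 1) / Num.sqrt (pi *+ 2)) / h <= gauss_pdf (h ^+ 2) z.
Proof.
move=> h0 zh; rewrite gauss_pdfE ?exprn_gt0// -mulrnAr sqrtrM ?sqr_ge0//.
rewrite sqrtr_sqr gtr0_norm// invfM.
have -> : expR (- 1) / Num.sqrt (pi *+ 2) / h =
  h^-1 / Num.sqrt (pi *+ 2) * expR (- 1) :> R by ring.
rewrite ler_pM2l; last by rewrite divr_gt0 ?invr_gt0// sqrtr_gt0 pmulrn_lgt0 ?pi_gt0.
rewrite ler_expR mulNr lerN2 ler_pdivrMr ?pmulrn_lgt0 ?exprn_gt0// mul1r.
move: zh; rewrite ler_norml => /andP[z1 z2].
have : 0 <= (h - z) * (h + z) by rewrite mulr_ge0//; lra.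
by have := sqr_ge0 h; lra.
Qed.

Lemma expR_sub1_le y : 0 <= y -> expR y - 1 <= y * expR y.
Proof.
move=> y0; have := expR_ge1Dx (- y); rewrite expRN => h.
have e0 := expR_gt0 y.
have : (1 - y) * expR y <= 1.
  by rewrite -ler_pdivlMr// mul1r.
by lra.
Qed.

(** A first-order bound in [e]. The derivative of the density brings out a factor that grows with
    [|z|]; doubling the variance absorbs it, so that the error is again a Gaussian density and the
    estimate can be iterated. *)
Lemma gauss_pdf_shift v z e : 0 < v -> `|e| <= Num.sqrt v ->
  gauss_pdf v (z + e) <=
  gauss_pdf v z + `|e| / Num.sqrt v * (2 * expR 4) * gauss_pdf (v *+ 2) z.
Proof.
move=> v0 ev.
set s := Num.sqrt v; have s0 : 0 < s by rewrite sqrtr_gt0.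
have vs : v = s ^+ 2 by rewrite sqr_sqrtr// ltW.
rewrite !gauss_pdfE ?pmulrn_lgt0//.
set pk := (Num.sqrt (v * pi *+ 2))^-1.
have pk0 : 0 <= pk by rewrite invr_ge0 sqrtr_ge0.
have -> : (Num.sqrt (v *+ 2 * pi *+ 2))^-1 = pk * (Num.sqrt 2)^-1.
  rewrite -invfM -sqrtrM; last by rewrite mulrn_wge0// mulr_ge0 ?pi_ge0 ?ltW.
  by congr (Num.sqrt _)^-1; ring.
pose y := z / s; pose c := e / s.
have zE : z = y * s by rewrite /y divfK// gt_eqF.
have eE : e = c * s by rewrite /c divfK// gt_eqF.
have c1 : `|c| <= 1.
  by rewrite /c normrM normfV (gtr0_norm s0) ler_pdivrMr// mul1r.
have -> : `|e| / s = `|c| by rewrite /c normrM normfV (gtr0_norm s0).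
have -> : - (z + e) ^+ 2 / (v *+ 2) = - (y ^+ 2) / 2 - y * c - c ^+ 2 / 2.
  by rewrite vs zE eE; field; rewrite gt_eqF.
have -> : - z ^+ 2 / (v *+ 2) = - (y ^+ 2) / 2.
  by rewrite vs zE; field; rewrite gt_eqF.
have -> : - z ^+ 2 / (v *+ 2 *+ 2) = - (y ^+ 2) / 4.
  by rewrite vs zE; field; rewrite gt_eqF.
suff H : expR (- (y ^+ 2) / 2 - y * c - c ^+ 2 / 2) <=
    expR (- (y ^+ 2) / 2) + `|c| * (expR 4 * expR (- (y ^+ 2) / 4)).
  apply: (le_trans (ler_wpM2l pk0 H)); rewrite mulrDr lerD2l.
  rewrite [leLHS]mulrA [leLHS]mulrA mulrA; apply: ler_wpM2r; first exact: expR_ge0.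
  (* The factor 2 in the statement pays for the ratio [sqrt 2] of the peaks of the two densities. *)
  have s2 : 1 <= 2 * (Num.sqrt 2)^-1 :> R.
    rewrite ler_pdivlMr ?sqrtr_gt0// mul1r.
    rewrite -[leRHS]ger0_norm// -sqrtr_sqr ler_wsqrtr//; lra.
  have : 0 <= pk * `|c| * expR 4 by rewrite !mulr_ge0 ?expR_ge0.
  have -> : `|c| * (2 * expR 4) * (pk * (Num.sqrt 2)^-1) =
    pk * `|c| * expR 4 * (2 * (Num.sqrt 2)^-1) by ring.
  by move=> h; rewrite ler_peMr.
have h1 : expR (- (y ^+ 2) / 2 - y * c - c ^+ 2 / 2) <=
    expR (- (y ^+ 2) / 2) * expR (`|y| * `|c|).
  rewrite -expRD ler_expR -addrA lerD2l -normrM.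
  have := ler_norm (- (y * c)); rewrite normrN.
  by have := sqr_ge0 c; lra.
apply: (le_trans h1).
have yc0 : 0 <= `|y| * `|c| by rewrite mulr_ge0.
have h2 := expR_sub1_le yc0.
have h3 : `|y| * `|c| * expR (`|y| * `|c|) <= `|c| * expR (2 * `|y|).
  rewrite [`|y| * `|c| in leLHS]mulrC -mulrA ler_wpM2l//.
  have -> : 2 * `|y| = `|y| + `|y| by ring.
  rewrite expRD; apply: ler_pM; rewrite ?expR_ge0//.
    by have := expR_ge1Dx `|y|; lra.
  by rewrite ler_expR ler_piMl.
have e0 := expR_ge0 (- (y ^+ 2) / 2).
(* After taking exponents this is [(|y| - 4) ^+ 2 >= 0], hence the constant [expR 4]. *)
have h4 : expR (- (y ^+ 2) / 2) * expR (2 * `|y|) <= expR 4 * expR (- (y ^+ 2) / 4).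
  rewrite -!expRD ler_expR -(real_normK (num_real y)).
  by have := sqr_ge0 (`|y| - 4); lra.
have h5 := ler_wpM2l e0 (le_trans h2 h3).
have h6 := ler_wpM2l (normr_ge0 c) h4.
lra.
Qed.

Lemma gauss_pdf_convolution a b s y : 0 < a -> 0 < b ->
  (\int[normal_prob 0 (Num.sqrt b)]_z (gauss_pdf a (y + s * z))%:E =
   (gauss_pdf (a + s ^+ 2 * b) y)%:E)%E.
Proof.
move=> a0 b0.
have c0 : 0 < a + s ^+ 2 * b by rewrite ltr_wpDr// mulr_ge0 ?sqr_ge0// ltW.
set c := a + s ^+ 2 * b in c0 *.
have ab0 : 0 < a * b / c by rewrite divr_gt0// mulr_gt0.
rewrite integral_normal_prob; last 2 first.
- apply: (measurableT_comp (measurable_gauss_pdf a)).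
  by apply: measurable_funD => //; exact: measurable_funM.
- exists (Num.sqrt a)^-1 => x.
  by rewrite ger0_norm ?gauss_pdf_ge0// gauss_pdf_ub.
under eq_integral => z _.
  rewrite -/(gauss_pdf b z).
  (* Completing the square in [z]: the product is the convolution at [y] times a normal density in
     [z], whose integral is 1. *)
  have -> : gauss_pdf a (y + s * z) * gauss_pdf b z =
    gauss_pdf c y * normal_pdf (- (y * s * b / c)) (Num.sqrt (a * b / c)) z.
    rewrite normal_pdfE ?gt_eqF ?sqrtr_gt0//.
    rewrite /normal_peak /normal_fun sqr_sqrtr ?(ltW ab0)// !gauss_pdfE//.
    rewrite mulrACA -expRD [RHS]mulrACA -expRD -!invfM -!sqrtrM; last 2 first.
    - by rewrite mulrn_wge0// mulr_ge0 ?pi_ge0 ?ltW.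
    - by rewrite mulrn_wge0// mulr_ge0 ?pi_ge0 ?ltW.
    congr ((Num.sqrt _)^-1 * expR _).
      by field; rewrite gt_eqF.
    rewrite /c; field; rewrite -/c !gt_eqF//.
  rewrite EFinM.
  over.
rewrite ge0_integralZl//.
- by rewrite integral_normal_pdf mule1.
- by apply/measurable_EFinP; exact: measurable_normal_pdf.
- by move=> z _; rewrite lee_fin normal_pdf_ge0.
- by rewrite lee_fin gauss_pdf_ge0.
Qed.

End gaussian.

(* [distribution] lives on [R] and [normal_prob] on [measurableTypeR R]: the
   sigma-algebras agree, but the types of measures differ. *)
Lemma ge0_integral_law d (T : measurableType d) (R : realType)
    (P : probability T R) (xi : {RV P >-> R})
    (nu : {measure set (measurableTypeR R) -> \bar R}) (f : R -> \bar R) :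
  (forall A : set R, measurable A -> P (xi @^-1` A) = nu A) ->
  measurable_fun setT f -> (forall z, (0 <= f z)%E) ->
  (\int[distribution P xi]_z f z = \int[nu]_z f z)%E.
Proof.
move=> law mf f0.
have mid : measurable_fun setT (fun z : measurableTypeR R => (z : R)) by [].
pose idR : {mfun measurableTypeR R >-> R} :=
  HB.pack (fun z : measurableTypeR R => (z : R))
          (isMeasurableFun.Build _ _ _ _ _ mid).
rewrite (@eq_measure_integral _ _ _ setT (pushforward nu idR)).
  by rewrite ge0_integral_pushforward.
by move=> A mA _; exact: law.
Qed.

(* Plays the role of Gronwall's lemma: [M0] is only there to make the supremum of
   [f] finite. *)
Lemma halving_bound (R : realType) (I : Type) (f : I -> R) (a M0 : R) : 0 <= a ->
  (forall i, f i <= M0) ->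
  (forall M, 0 <= M -> (forall i, f i <= M) -> forall i, f i <= a + M / 2) ->
  forall i, f i <= 2 * a.
Proof.
move=> a0 fM0 fM i0.
have hs : has_sup (range f).
  by split; [exists (f i0); exists i0|exists M0 => _ [i _ <-]].
pose M := Num.max 0 (sup (range f)).
have fM' i : f i <= M.
  by rewrite le_max; apply/orP; right; apply: sup_upper_bound => //; exists i.
have M0' : 0 <= M by rewrite le_max lexx.
have fa := fM M M0' fM'.
have Ma : M <= a + M / 2.
  rewrite ge_max; apply/andP; split; first by rewrite addr_ge0// divr_ge0.
  by apply: ge_sup; [exists (f i0); exists i0|move=> _ [i _ <-]; exact: fa].
by have := fM' i0; lra.
Qed.

(** The density at [x] of the sum of [Y] and an independent centred Gaussian of variance [v]. Bounds
    that do not degenerate as [v] tends to 0 control the law of [Y] without presupposing that it has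
    a density. *)
HB.lock Definition mean_gauss d (Omega : measurableType d) (R : realType)
    (P : probability Omega R) (Y : Omega -> R) (v x : R) : R :=
  \int[P]_w gauss_pdf v (Y w - x).
Canonical locked_mean_gauss := Unlockable mean_gauss.unlock.

Section density.
Context d (Omega : measurableType d) (R : realType) (P : probability Omega R).

Local Notation mean_gauss := (mean_gauss P).

Section mean_gauss.
Variable Y : {RV P >-> R}.
Implicit Types v x : R.

Lemma measurable_gauss_pdf_rv v (Z : Omega -> R) : measurable_fun setT Z ->
  measurable_fun setT (fun w => (gauss_pdf v (Z w))%:E).
Proof.
move=> mZ; apply/measurable_EFinP.
exact: (measurableT_comp (measurable_gauss_pdf v)).
Qed.

Lemma EFin_mean_gauss v x : 0 < v ->
  (mean_gauss Y v x)%:E = (\int[P]_w (gauss_pdf v (Y w - x))%:E)%E.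
Proof.
move=> v0; rewrite unlock /Rintegral fineK//.
rewrite ge0_fin_numE; last first.
  by apply: integral_ge0 => w _; rewrite lee_fin gauss_pdf_ge0.
apply: (@le_lt_trans _ _ (\int[P]_w (cst ((Num.sqrt v)^-1)%:E w))%E).
  apply: ge0_le_integral => //.
  - by move=> w _; rewrite lee_fin gauss_pdf_ge0.
  - by apply: measurable_gauss_pdf_rv; exact: measurable_funB.
  - by move=> w _; rewrite lee_fin gauss_pdf_ub.
by rewrite integral_cst// [X in (_ * X)%E]probability_setT mule1 ltry.
Qed.

Lemma mean_gauss_ub v x : 0 < v -> mean_gauss Y v x <= (Num.sqrt v)^-1.
Proof.
move=> v0; rewrite -lee_fin EFin_mean_gauss//.
apply: (@le_trans _ _ (\int[P]_w (cst ((Num.sqrt v)^-1)%:E w))%E).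
  apply: ge0_le_integral => //.
  - by move=> w _; rewrite lee_fin gauss_pdf_ge0.
  - by apply: measurable_gauss_pdf_rv; exact: measurable_funB.
  - by move=> w _; rewrite lee_fin gauss_pdf_ub.
by rewrite integral_cst// [X in (_ * X)%E]probability_setT mule1.
Qed.

Lemma mean_gauss_ge0 v x : 0 <= mean_gauss Y v x.
Proof. by rewrite unlock; apply: Rintegral_ge0 => w _; exact: gauss_pdf_ge0. Qed.

Lemma probability_mean_gauss (x h : R) : 0 < h ->
  (P [set w | (`|Y w - x| <= h)%R] <=
   (h / (expR (- 1) / Num.sqrt (pi *+ 2)) * mean_gauss Y (h ^+ 2) x)%:E)%E.
Proof.
move=> h0; set c := expR (- 1) / Num.sqrt (pi *+ 2).
have c0 : 0 < c by rewrite divr_gt0 ?expR_gt0// sqrtr_gt0 pmulrn_lgt0 ?pi_gt0.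
have mA : measurable [set w | `|Y w - x| <= h].
  rewrite -[X in measurable X]setTI.
  apply: measurable_fun_ler => //; apply: measurableT_comp => //.
  exact: measurable_funB.
rewrite EFinM EFin_mean_gauss ?exprn_gt0//.
rewrite -ge0_integralZl//; first last.
- by rewrite lee_fin divr_ge0 ?ltW.
- by move=> w _; rewrite lee_fin gauss_pdf_ge0.
- by apply: measurable_gauss_pdf_rv; exact: measurable_funB.
rewrite -(setIT [set w | _]) -integral_indic//.
apply: ge0_le_integral => //.
- by apply/measurable_EFinP; exact: measurable_indic.
- apply: emeasurable_funM => //.
  by apply: measurable_gauss_pdf_rv; exact: measurable_funB.
move=> w _; rewrite -EFinM lee_fin indicE.
have [|_] := boolP (w \in _); last first.
  by rewrite mulr_ge0 ?gauss_pdf_ge0// divr_ge0 ?ltW.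
rewrite inE /= => Yx; have hc : 0 < h / c by rewrite divr_gt0.
rewrite -[leLHS](@divff _ (h / c)) ?gt_eqF// ler_pM2l// invfM invrK mulrC.
exact: gauss_pdf_lb.
Qed.

End mean_gauss.

Variables (sigma B : R).
Hypotheses (sigma0 : 0 < sigma) (B0 : 0 < B).

(** No equation appears: the density bound sees the drift only through its size, so its constant
    depends on neither the particle nor the law. *)
Record noisy_process (Y W : R -> {RV P >-> R}) : Prop := {
  noisy_drift : forall s t, 0 <= s -> s <= t -> {ae P, forall w,
    `|Y t w - Y s w - sigma * (W t w - W s w)| <= B * (t - s)} ;
  noisy_indep : forall s t, 0 <= s -> s <= t -> forall A C : set R,
    measurable A -> measurable C ->
    P (Y s @^-1` A `&` (fun w => W t w - W s w) @^-1` C) =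
    (P (Y s @^-1` A) * P ((fun w => W t w - W s w)%R @^-1` C))%E ;
  noisy_law : forall s t, 0 <= s -> s < t -> forall A : set R, measurable A ->
    P ((fun w => W t w - W s w) @^-1` A) = normal_prob 0 (Num.sqrt (t - s)) A
}.

Variables Y W : R -> {RV P >-> R}.
Hypothesis YW : noisy_process Y W.

(** Convolution of Gaussians: the noise accumulated over [[s, t]], being independent of [Y s], acts
    as additional mollification. *)
Lemma mean_gauss_noise (s t v x : R) : 0 <= s -> s < t -> 0 < v ->
  (\int[P]_w (gauss_pdf v (Y s w - x + sigma * (W t w - W s w)))%:E =
   (mean_gauss (Y s) (v + sigma ^+ 2 * (t - s)) x)%:E)%E.
Proof.
move=> s0 st v0; have ts0 : 0 < t - s by rewrite subr_gt0.
have v0' : 0 < v + sigma ^+ 2 * (t - s).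
  by rewrite ltr_wpDr// mulr_ge0 ?sqr_ge0// ltW.
pose dW : {RV P >-> R} := W t - W s.
pose f (z : R * R) := (gauss_pdf v (z.1 - x + sigma * z.2))%:E.
have mf : measurable_fun setT f.
  apply/measurable_EFinP; apply: (measurableT_comp (measurable_gauss_pdf v)).
  apply: measurable_funD; first by apply: measurable_funB.
  exact: measurable_funM.
rewrite (@ge0_integral_indep_pair _ _ _ _ (Y s) dW f)//; first last.
- by move=> z; rewrite lee_fin gauss_pdf_ge0.
- by move=> A C mA mC; apply: (noisy_indep YW) => //; exact: ltW.
rewrite EFin_mean_gauss//; apply: eq_integral => w _.
rewrite -(@gauss_pdf_convolution _ v (t - s))//.
apply: (@ge0_integral_law _ _ _ _ dW _ (fun z => f (Y s w, z))).
- by move=> A mA; exact: (noisy_law YW).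
- exact: measurable_fun_pair2.
- by move=> z; rewrite lee_fin gauss_pdf_ge0.
Qed.

(* The noise increment turns into extra variance of the Gaussian, while
   [gauss_pdf_shift] pays for the drift. *)
Lemma mean_gauss_step (s t v x : R) : 0 <= s -> s < t -> 0 < v ->
  B * (t - s) <= Num.sqrt v ->
  mean_gauss (Y t) v x <= mean_gauss (Y s) (v + sigma ^+ 2 * (t - s)) x +
    B * (t - s) / Num.sqrt v * (2 * expR 4) *
    mean_gauss (Y s) (v *+ 2 + sigma ^+ 2 * (t - s)) x.
Proof.
move=> s0 st v0 Bv; have ts0 : 0 < t - s by rewrite subr_gt0.
have v20 : 0 < v *+ 2 by rewrite pmulrn_lgt0.
have sv0 : 0 < Num.sqrt v by rewrite sqrtr_gt0.
set k := B * (t - s) / Num.sqrt v * (2 * expR 4).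
have k0 : 0 <= k by rewrite !mulr_ge0 ?expR_ge0 ?invr_ge0// ltW.
have EFinDM (a b c : R) : (a + c * b)%:E = (a%:E + c%:E * b%:E)%E by [].
rewrite -lee_fin [leRHS]EFinDM (EFin_mean_gauss (Y t) x v0).
rewrite -(mean_gauss_noise x s0 st v0) -(mean_gauss_noise x s0 st v20).
have mU : measurable_fun setT (fun w => Y s w - x + sigma * (W t w - W s w)).
  apply: measurable_funD; first exact: measurable_funB.
  by apply: measurable_funM => //; exact: measurable_funB.
rewrite -ge0_integralZl//; first last.
- by move=> w _; rewrite lee_fin gauss_pdf_ge0.
- exact: measurable_gauss_pdf_rv.
rewrite -ge0_integralD//; first last.
- by apply: emeasurable_funM => //; exact: measurable_gauss_pdf_rv.
- by move=> w _; rewrite -EFinM lee_fin mulr_ge0 ?gauss_pdf_ge0.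
- exact: measurable_gauss_pdf_rv.
- by move=> w _; rewrite lee_fin gauss_pdf_ge0.
apply: ae_ge0_le_integral => //.
- by move=> w _; rewrite lee_fin gauss_pdf_ge0.
- by apply: measurable_gauss_pdf_rv; exact: measurable_funB.
- move=> w _; rewrite -EFinM -EFinD lee_fin addr_ge0 ?gauss_pdf_ge0//.
  by rewrite mulr_ge0 ?gauss_pdf_ge0.
- apply: emeasurable_funD; first exact: measurable_gauss_pdf_rv.
  by apply: emeasurable_funM => //; exact: measurable_gauss_pdf_rv.
apply: filterS (noisy_drift YW s0 (ltW st)) => w Yw _.
rewrite -EFinM -EFinD lee_fin.
set u := Y s w - x + sigma * (W t w - W s w).
pose e := Y t w - Y s w - sigma * (W t w - W s w).
have -> : Y t w - x = u + e by rewrite /u /e; ring.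
apply: (le_trans (gauss_pdf_shift _ v0 (le_trans Yw Bv))).
rewrite lerD2l ler_wpM2r ?gauss_pdf_ge0// ler_wpM2r ?mulr_ge0 ?expR_ge0//.
by rewrite ler_wpM2r// invr_ge0 ltW.
Qed.

(** Used to telescope the sum of [eta / sqrt (j eta)]. It holds because [b - a] factors as a
    difference times a sum of square roots, and this sum is at most [2 sqrt b]. *)
Lemma sqrt_increment (a b : R) : 0 <= a -> a < b ->
  (b - a) / Num.sqrt b <= 2 * (Num.sqrt b - Num.sqrt a).
Proof.
move=> a0 ab; have b0 : 0 < b by exact: le_lt_trans ab.
rewrite ler_pdivrMr ?sqrtr_gt0//.
have sab : Num.sqrt a <= Num.sqrt b by rewrite ler_wsqrtr// ltW.
rewrite -[in leLHS](sqr_sqrtr (ltW b0)) -[in X in _ - X](sqr_sqrtr a0).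
have := sqrtr_ge0 a; have := sqr_ge0 (Num.sqrt b - Num.sqrt a).
nra.
Qed.

(** Going back in time by steps of length [eta], the noise raises the variance linearly, so the
    [j]-th drift error is of order [B eta / (sigma sqrt (j eta))] and their sum of order
    [B sqrt (j eta) / sigma]. [K] bounds the mollified density of doubled variance that each error
    multiplies. *)
Lemma mean_gauss_window (delta eta s0 t0 K : R) : 0 <= s0 -> 0 < delta ->
  0 < eta -> B * eta <= Num.sqrt delta -> sigma ^+ 2 * eta <= delta -> 0 <= K ->
  (forall u v x, s0 <= u -> u <= t0 -> delta <= v -> mean_gauss (Y u) v x <= K) ->
  forall j s v x, s0 <= s -> s + j%:R * eta <= t0 -> delta <= v ->
  mean_gauss (Y (s + j%:R * eta)) v x <=
    mean_gauss (Y s) (v + sigma ^+ 2 * (j%:R * eta)) x +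
    4 * expR 4 * B / sigma * K * Num.sqrt (j%:R * eta).
Proof.
move=> s00 delta0 eta0 Beta seta K0 YK; elim=> [|j IH] s v x s0s st v0.
  by rewrite mul0r mulr0 !addr0 sqrtr0 mulr0 addr0.
have v00 : 0 < v by exact: lt_le_trans v0.
have s0' : 0 <= s by exact: le_trans s0s.
have je0 : 0 <= j%:R * eta by rewrite mulr_ge0// ltW.
have js : s + j.+1%:R * eta = s + eta + j%:R * eta by rewrite -natr1; ring.
rewrite js; apply: le_trans (IH _ _ _ _ _ _) _ => //.
- by rewrite (le_trans s0s)// lerDl ltW.
- by rewrite -js.
set v' := v + sigma ^+ 2 * (j%:R * eta).
(* The condition [sigma ^+ 2 * eta <= delta] yields [j.+1] instead of [j], so that the denominator
   is the right end point, as in [sqrt_increment]. *)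
have sje : sigma ^+ 2 * (j.+1%:R * eta) <= v'.
  rewrite /v' -natr1; have := le_trans seta v0.
  by rewrite (mulrDl j%:R) mulrDr mul1r; lra.
have vv' : v <= v' by rewrite lerDl mulr_ge0 ?sqr_ge0.
have v'0 : 0 < v' by exact: lt_le_trans vv'.
have ss : s < s + eta by rewrite ltrDl.
have es : s + eta - s = eta by ring.
have Bv : B * (s + eta - s) <= Num.sqrt v'.
  by rewrite es (le_trans Beta)// ler_wsqrtr// (le_trans v0).
apply: le_trans (lerD (mean_gauss_step x s0' ss v'0 Bv) (lexx _)) _.
rewrite es.
have -> : v' + sigma ^+ 2 * eta = v + sigma ^+ 2 * (j.+1%:R * eta).
  by rewrite /v' -natr1; ring.
rewrite -addrA lerD2l.
have Ks : mean_gauss (Y s) (v' *+ 2 + sigma ^+ 2 * eta) x <= K.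
  apply: YK => //.
    by apply: le_trans st; rewrite lerDl mulr_ge0 ?ltW.
  have : 0 <= sigma ^+ 2 * eta by rewrite mulr_ge0 ?sqr_ge0 ?ltW.
  by move: v'0 vv' v0; rewrite mulr2n; lra.
have sq : sigma * Num.sqrt (j.+1%:R * eta) <= Num.sqrt v'.
  rewrite -[X in X * _](gtr0_norm sigma0) -sqrtr_sqr -sqrtrM ?sqr_ge0//.
  exact: ler_wsqrtr.
have je1 : j%:R * eta < j.+1%:R * eta by rewrite ltr_pM2r// ltr_nat.
have inc := sqrt_increment je0 je1.
have je1eta : j.+1%:R * eta - j%:R * eta = eta by rewrite -natr1; ring.
rewrite je1eta in inc.
have sj0 : 0 < Num.sqrt (j.+1%:R * eta) by rewrite sqrtr_gt0 (le_lt_trans je0).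
have h1 : eta / Num.sqrt v' <= 2 / sigma * (Num.sqrt (j.+1%:R * eta) - Num.sqrt (j%:R * eta)).
  apply: (@le_trans _ _ (sigma^-1 * (eta / Num.sqrt (j.+1%:R * eta)))); last first.
    have -> : 2 / sigma * (Num.sqrt (j.+1%:R * eta) - Num.sqrt (j%:R * eta)) =
      sigma^-1 * (2 * (Num.sqrt (j.+1%:R * eta) - Num.sqrt (j%:R * eta))) by ring.
    by rewrite ler_pM2l// invr_gt0.
  rewrite mulrCA -invfM ler_pM2l// lef_pV2 ?posrE ?sqrtr_gt0//.
  by rewrite mulr_gt0.
have h2 : B * eta / Num.sqrt v' * (2 * expR 4) <=
    4 * expR 4 * B / sigma * (Num.sqrt (j.+1%:R * eta) - Num.sqrt (j%:R * eta)).
  have -> : B * eta / Num.sqrt v' * (2 * expR 4) =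
      2 * expR 4 * B * (eta / Num.sqrt v') by ring.
  have k0 : 0 <= 2 * expR 4 * B by rewrite !mulr_ge0 ?expR_ge0 ?ltW.
  by apply: le_trans (ler_wpM2l k0 h1) _; lra.
have h3 : B * eta / Num.sqrt v' * (2 * expR 4) *
    mean_gauss (Y s) (v' *+ 2 + sigma ^+ 2 * eta) x <=
    4 * expR 4 * B / sigma * (Num.sqrt (j.+1%:R * eta) - Num.sqrt (j%:R * eta)) * K.
  apply: ler_pM => //; last exact: mean_gauss_ge0.
  by rewrite !mulr_ge0 ?expR_ge0 ?invr_ge0 ?sqrtr_ge0 ?ltW.
by lra.
Qed.

(** For windows up to this length [tau], the accumulated factor [4 * expR 4 * B / sigma * sqrt tau]
    of [mean_gauss_window] is at most 1/2. *)
Definition density_horizon : R := (sigma / (8 * expR 4 * B)) ^+ 2.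

Lemma density_horizon_gt0 : 0 < density_horizon.
Proof. by rewrite exprn_gt0// divr_gt0// !mulr_gt0 ?expR_gt0. Qed.

(** [halving_bound] is applied to [sqrt (min u T0)] times the mollified density, over all times [u]
    and all variances at least [v], by looking back over half of [min u T0]. The a priori bound
    depends on [v], the resulting one does not. *)
Lemma mean_gauss_bound (t v x : R) : 0 < t -> 0 < v ->
  mean_gauss (Y t) v x <=
  2 * (Num.sqrt 2 / sigma) / Num.sqrt (Num.min t density_horizon).
Proof.
move=> t0 v0; set T0 := density_horizon; have T00 := density_horizon_gt0.
pose I := {tvx : R * R * R | 0 < tvx.1.1 /\ v <= tvx.1.2}.
pose f (i : I) := Num.sqrt (Num.min (sval i).1.1 T0) *
  mean_gauss (Y (sval i).1.1) (sval i).1.2 (sval i).2.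
have tau0 u : 0 < u -> 0 < Num.min u T0 by move=> u0; rewrite lt_min u0.
suff H i : f i <= 2 * (Num.sqrt 2 / sigma).
  have i0 : 0 < (t, v, x).1.1 /\ v <= (t, v, x).1.2 by [].
  have := H (exist _ (t, v, x) i0); rewrite /f/= => h.
  by rewrite ler_pdivlMr ?sqrtr_gt0 ?tau0// mulrC.
apply: (@halving_bound _ _ f _ (Num.sqrt T0 / Num.sqrt v)).
- by rewrite divr_ge0 ?sqrtr_ge0 ?ltW.
- move=> [[[u r] y] [/= u0 vr]]; rewrite /f/=; apply: ler_pM.
  + exact: sqrtr_ge0.
  + exact: mean_gauss_ge0.
  + by rewrite ler_wsqrtr// ge_min lexx orbT.
  + apply: (le_trans (mean_gauss_ub _ _ (lt_le_trans v0 vr))).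
    by rewrite lef_pV2 ?posrE ?sqrtr_gt0 ?(lt_le_trans v0 vr)// ler_wsqrtr.
move=> M M0 fM [[[u r] y] [/= u0 vr]]; rewrite /f/=.
set tau := Num.min u T0; have tau_gt0 : 0 < tau by exact: tau0.
have tauu : tau <= u by rewrite ge_min lexx.
have tauT : tau <= T0 by rewrite ge_min lexx orbT.
(* The number of steps, large enough for the two smallness conditions of [mean_gauss_window] at
   [delta := v]. *)
pose n := (Num.truncn (Num.max (B * tau / Num.sqrt v) (sigma ^+ 2 * tau / v))).+1.
have n0 : 0 < n%:R :> R by rewrite ltr0n.
pose eta := tau / 2 / n%:R.
have eta0 : 0 < eta by rewrite !divr_gt0.
have neta : n%:R * eta = tau / 2 by rewrite /eta mulrC divfK// gt_eqF.
have /andP[nB ns] : (B * tau / Num.sqrt v <= n%:R) && (sigma ^+ 2 * tau / v <= n%:R).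
  by rewrite -ge_max ltW// truncnS_gt.
have sv0 : 0 < Num.sqrt v by rewrite sqrtr_gt0.
have Beta : B * eta <= Num.sqrt v.
  rewrite /eta !mulrA ler_pdivrMr// mulrC.
  move: nB; rewrite ler_pdivrMr// => nB.
  have : 0 <= B * tau by rewrite mulr_ge0 ?ltW.
  by lra.
have seta : sigma ^+ 2 * eta <= v.
  rewrite /eta !mulrA ler_pdivrMr// mulrC.
  move: ns; rewrite ler_pdivrMr// => ns.
  have : 0 <= sigma ^+ 2 * tau by rewrite mulr_ge0 ?sqr_ge0 ?ltW.
  by lra.
have st0 : 0 < Num.sqrt (tau / 2) by rewrite sqrtr_gt0 divr_gt0.
pose K := M / Num.sqrt (tau / 2).
have K0 : 0 <= K by rewrite divr_ge0// ltW.
(* Looking back by only [tau / 2] stays at times at least [tau / 2], where [M] gives the bound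
   [K]. *)
have YK u' v' x' : u - tau / 2 <= u' -> u' <= u -> v <= v' ->
    mean_gauss (Y u') v' x' <= K.
  move=> uu' u'u vv'.
  have u'tau : tau / 2 <= u' by lra.
  have u'0 : 0 < u' by lra.
  have i0 : 0 < (u', v', x').1.1 /\ v <= (u', v', x').1.2 by [].
  have := fM (exist _ (u', v', x') i0); rewrite /f/= => h.
  rewrite /K ler_pdivlMr// mulrC; apply: le_trans h.
  rewrite ler_wpM2r ?mean_gauss_ge0// ler_wsqrtr// le_min u'tau/=.
  by move: tauT tau_gt0; lra.
have u20 : 0 <= u - tau / 2 by lra.
have := mean_gauss_window u20 v0 eta0 Beta seta K0 YK.
move=> /(_ n (u - tau / 2) r y (lexx _)).
rewrite neta subrK => /(_ (lexx _) vr) h.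
have r0 : 0 < r by exact: lt_le_trans vr.
have r0' : 0 < r + sigma ^+ 2 * (tau / 2).
  by rewrite ltr_wpDr// mulr_ge0 ?sqr_ge0// divr_ge0 ?ltW.
(* At the far end of the window, the accumulated variance [sigma ^+ 2 * (tau / 2)] alone bounds the
   mollified density. *)
have h1 : mean_gauss (Y (u - tau / 2)) (r + sigma ^+ 2 * (tau / 2)) y <=
    (sigma * Num.sqrt (tau / 2))^-1.
  apply: (le_trans (mean_gauss_ub _ _ r0')).
  rewrite lef_pV2 ?posrE ?sqrtr_gt0 ?mulr_gt0//.
  rewrite -[X in X * _](gtr0_norm sigma0) -sqrtr_sqr -sqrtrM ?sqr_ge0//.
  by rewrite ler_wsqrtr// lerDr ltW.
have K1 : K * Num.sqrt (tau / 2) = M by rewrite /K divfK// gt_eqF.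
have tau2 : Num.sqrt tau = Num.sqrt 2 * Num.sqrt (tau / 2).
  by rewrite -sqrtrM//; congr Num.sqrt; lra.
have stau0 : 0 <= Num.sqrt tau by exact: sqrtr_ge0.
apply: (le_trans (ler_wpM2l stau0 h)); rewrite mulrDr; apply: lerD.
  apply: (le_trans (ler_wpM2l stau0 h1)).
  by rewrite tau2 invfM mulrACA divff ?mulr1// gt_eqF.
rewrite -(mulrA _ K) K1.
have sT : Num.sqrt tau <= sigma / (8 * expR 4 * B).
  apply: (le_trans (ler_wsqrtr tauT)); rewrite sqrtr_sqr ger0_norm//.
  by rewrite divr_ge0 ?ltW// !mulr_gt0 ?expR_gt0.
have k0 : 0 <= 4 * expR 4 * B / sigma * M.
  by rewrite mulr_ge0// divr_ge0 ?(ltW sigma0)// ltW// !mulr_gt0 ?expR_gt0.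
apply: (le_trans (ler_wpM2r k0 sT)).
by rewrite le_eqVlt; apply/orP; left; apply/eqP; field; rewrite !gt_eqF ?expR_gt0.
Qed.

End density.

Section distribution_functions.
Context d (Omega : measurableType d) (R : realType) (P : probability Omega R).

Lemma density_bound (sigma B T : R) : 0 < sigma -> 0 < B -> 0 < T ->
  exists2 c : R, 0 < c & forall (Y W : R -> {RV P >-> R}),
    noisy_process sigma B Y W -> forall t x h : R, 0 < t -> t <= T -> 0 < h ->
    (P [set w | (`|Y t w - x| <= h)%R] <= (c / Num.sqrt t * h)%:E)%E.
Proof.
move=> sigma0 B0 T0; have H0 := density_horizon_gt0 sigma0 B0.
set H := density_horizon _ _ in H0.
(* For [t <= T] one has [min t H >= min 1 (H / T) * t], which turns the saturated bound into a pure
   [1 / sqrt t]. *)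
pose k := Num.sqrt (Num.min 1 (H / T)).
have k0 : 0 < k by rewrite sqrtr_gt0 lt_min ltr01 divr_gt0.
pose g := expR (- 1) / Num.sqrt (pi *+ 2) : R.
have g0 : 0 < g by rewrite divr_gt0 ?expR_gt0// sqrtr_gt0 pmulrn_lgt0 ?pi_gt0.
have s2 : 0 < Num.sqrt 2 :> R by rewrite sqrtr_gt0.
exists (2 * (Num.sqrt 2 / sigma) / (g * k)).
  by apply: divr_gt0; apply: mulr_gt0 => //; exact: divr_gt0.
move=> Y W YW t x h t0 tT h0.
apply: (le_trans (probability_mean_gauss _ _ h0)); rewrite lee_fin -/g.
have hh : 0 < h ^+ 2 by rewrite exprn_gt0.
have kt : k * Num.sqrt t <= Num.sqrt (Num.min t H).
  rewrite -sqrtrM; last by rewrite le_min ler01 divr_ge0// ltW.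
  rewrite ler_wsqrtr// le_min; apply/andP; split.
    by rewrite -[leRHS]mul1r ler_wpM2r ?(ltW t0)// ge_min lexx.
  apply: (@le_trans _ _ (H / T * t)).
    by rewrite ler_wpM2r ?(ltW t0)// ge_min lexx orbT.
  by rewrite mulrAC ler_pdivrMr// ler_wpM2l// ltW.
have hg : 0 <= h / g by rewrite divr_ge0// ltW.
apply: (le_trans (ler_wpM2l hg (mean_gauss_bound sigma0 B0 YW x t0 hh))).
have -> : 2 * (Num.sqrt 2 / sigma) / (g * k) / Num.sqrt t * h =
  h / g * (2 * (Num.sqrt 2 / sigma) / (k * Num.sqrt t)).
  by rewrite !invfM; ring.
have m0 : 0 < Num.min t H by rewrite lt_min t0.
have kt0 : 0 < k * Num.sqrt t by rewrite mulr_gt0// sqrtr_gt0.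
have c0 : 0 < 2 * (Num.sqrt 2 / sigma) by rewrite mulr_gt0// divr_gt0.
by rewrite ler_wpM2l// ler_pM2l// lef_pV2// posrE sqrtr_gt0.
Qed.

Definition cdfr (Y : {RV P >-> R}) (x : R) : R := fine (cdf Y x).

Lemma EFin_cdfr (Y : {RV P >-> R}) (x : R) :
  (cdfr Y x)%:E = P [set w | Y w <= x].
Proof.
rewrite /cdfr fineK; last by rewrite fin_num_measure.
by congr (P _); apply/seteqP; split => w /=; rewrite in_itv.
Qed.

Lemma measurable_rv_le (Y : {RV P >-> R}) (x : R) : measurable [set w | Y w <= x].
Proof. by rewrite -[X in measurable X]setTI; exact: measurable_fun_ler. Qed.

Lemma cdfr_ge0 (Y : {RV P >-> R}) x : 0 <= cdfr Y x.
Proof. by rewrite fine_ge0// cdf_ge0. Qed.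

Lemma cdfr_le1 (Y : {RV P >-> R}) x : cdfr Y x <= 1.
Proof.
by rewrite -lee_fin EFin_cdfr probability_le1//; exact: measurable_rv_le.
Qed.

Lemma cdfr_in01 (Y : {RV P >-> R}) x : cdfr Y x \in `[0, 1]%R.
Proof. by rewrite in_itv/= cdfr_ge0 cdfr_le1. Qed.

Lemma cdfr_nd (Y : {RV P >-> R}) x y : x <= y -> cdfr Y x <= cdfr Y y.
Proof.
move=> xy; rewrite -lee_fin !EFin_cdfr le_measure ?inE//; try exact: measurable_rv_le.
by move=> w /= /le_trans; apply.
Qed.

Lemma cdfr_lipschitz (Y : {RV P >-> R}) (k : R) : 0 <= k ->
  (forall x h : R, 0 < h ->
    (P [set w | (`|Y w - x| <= h)%R] <= (k * h)%:E)%E) ->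
  forall x y, `|cdfr Y x - cdfr Y y| <= k * `|x - y|.
Proof.
move=> k0 Yk; have H x y : x < y -> cdfr Y y <= cdfr Y x + k * (y - x).
  move=> xy; have h0 : 0 < (y - x) / 2 by rewrite divr_gt0// subr_gt0.
  rewrite -lee_fin EFinD !EFin_cdfr.
  have mD (z h : R) : measurable [set w | `|Y w - z| <= h].
    rewrite -[X in measurable X]setTI; apply: measurable_fun_ler => //.
    by apply: measurableT_comp => //; exact: measurable_funB.
  apply: (@le_trans _ _ (P ([set w | Y w <= x] `|`
      [set w | `|Y w - (x + y) / 2| <= (y - x) / 2]))).
    rewrite le_measure ?inE//; first exact: measurable_rv_le.
      by apply: measurableU => //; exact: measurable_rv_le.
    move=> w /= Yy; have [Yx|Yx] := leP (Y w) x; [by left|right].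
    by rewrite /= ler_norml; lra.
  have := measureU2 P (measurable_rv_le Y x) (mD ((x + y) / 2) ((y - x) / 2)).
  move=> /le_trans; apply; rewrite leeD2l//.
  apply: (le_trans (Yk _ _ h0)); rewrite lee_fin ler_wpM2l//.
  by move: h0; lra.
move=> x y; have [xy|xy|->] := ltgtP x y; last by rewrite !subrr !normr0 mulr0.
- rewrite ler0_norm ?subr_le0 ?(cdfr_nd _ (ltW xy))//.
  by rewrite ltr0_norm ?subr_lt0//; have := H _ _ xy; lra.
- rewrite ger0_norm ?subr_ge0 ?(cdfr_nd _ (ltW xy))//.
  by rewrite gtr0_norm ?subr_gt0//; have := H _ _ xy; lra.
Qed.

End distribution_functions.

(** * Measurability in time and time integrals *)

Section joint_measurability.
Context d (Omega : measurableType d) (R : realType) (P : probability Omega R).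
Local Notation RT := (measurableTypeR R).

Lemma continuous_ray_cvg (f : R -> R) (u : nat -> R) (p : R) :
  {within `[0, +oo[, continuous f} -> 0 <= p -> (forall n, 0 <= u n) ->
  u n @[n --> \oo] --> p -> f (u n) @[n --> \oo] --> f p.
Proof.
move=> /subspace_continuousP cf p0 u0 up.
have /cf : [set` `[0, +oo[] p by rewrite /= in_itv/= p0.
move=> cfp; apply: (cvg_comp u f _ cfp) => B /=.
move=> Bp.
have : \forall n \near \oo, [set` `[0, +oo[] (u n) -> B (u n) := up _ Bp.
apply: filterS => n; apply.
by rewrite /= in_itv/= u0.
Qed.

Lemma measurable_truncn_preimage (c : R) k : 0 < c ->
  measurable [set s : RT | Num.truncn (s * c) = k].
Proof.
move=> c0.
have mt : measurable_fun (setT : set R) (fun s : R => (Num.truncn (s * c))%:R : R).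
  apply: nondecreasing_measurable => // x y xy; rewrite ler_nat.
  by rewrite le_truncn// ler_pM2r.
have -> : [set s : RT | Num.truncn (s * c) = k] =
    (fun s : R => (Num.truncn (s * c))%:R : R) @^-1` [set k%:R].
  apply/seteqP; split => s /= [sk]; first by rewrite sk.
  by apply/eqP; rewrite -(eqr_nat R) sk.
by rewrite -[X in measurable X]setTI; exact: mt.
Qed.

Lemma truncn_grid_cvg (s : R) :
  (Num.truncn (s * n.+1%:R))%:R / n.+1%:R @[n --> \oo] --> Num.max 0 s.
Proof.
apply/cvgrPdist_lt => e e0; near=> n.
have n0 : 0 < n.+1%:R :> R by rewrite ltr0n.
have ne : n.+1%:R^-1 < e by near: n; exact: (near_infty_natSinv_lt (PosNum e0)).
have [s0|s0] := leP s 0.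
  have -> : Num.truncn (s * n.+1%:R) = 0%N.
    apply/eqP; rewrite -leqn0 truncn_le_nat.
    by rewrite (@le_lt_trans _ _ 0)// mulr_le0_ge0// ltW.
  by rewrite mul0r subr0 normr0.
have sn0 : 0 <= s * n.+1%:R by rewrite mulr_ge0// ltW.
have /andP[t1 t2] := truncn_itv sn0.
apply: le_lt_trans ne; rewrite ler_norml; apply/andP; split.
  rewrite lerBrDl lerBlDr ler_pdivrMr//; apply: (le_trans t1).
  by rewrite ler_wpM2r ?(ltW n0)// lerDl invr_ge0 ltW.
by rewrite lerBlDl -[X in _ + X]mul1r -mulrDl natr1 ler_pdivlMr// ltW.
Unshelve. all: by end_near. Qed.

(** Nothing is known of [X] at negative times, so time is cut off at 0. By continuity [X] is the
    limit of its values at grid times, which depend on time through countably many cells only. *)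
Lemma measurable_process (X : R -> {RV P >-> R}) : continuous_paths X ->
  measurable_fun setT (fun z : RT * Omega => X (Num.max 0 z.1) z.2).
Proof.
move=> cX.
pose h n (z : RT * Omega) :=
  X ((Num.truncn (z.1 * n.+1%:R))%:R / n.+1%:R) z.2.
apply: (@measurable_fun_cvg _ _ _ _ h) => [n|[s w] _ /=].
- move=> _ A mA; rewrite setTI.
  have -> : h n @^-1` A = \bigcup_k
      ([set s : RT | Num.truncn (s * n.+1%:R) = k] `*` (X (k%:R / n.+1%:R) @^-1` A)).
    apply/seteqP; split => [[s w] /= Xsw|[s w] [k _ [/= sk]]].
      by exists (Num.truncn (s * n.+1%:R)).
    by rewrite /h/= sk.
  apply: bigcupT_measurable => k; apply: measurableX.
    exact: measurable_truncn_preimage.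
  by rewrite -[X in measurable X]setTI; exact: measurable_funP.
- rewrite /h/=; apply: (@continuous_ray_cvg (fun t => X t w)) => //.
  + by rewrite le_max lexx.
  + exact: truncn_grid_cvg.
Qed.

Definition path_cdf (X : R -> {RV P >-> R}) (s x : R) := cdfr (X (Num.max 0 s)) x.

(** The distribution function is the [P]-integral of a jointly measurable indicator, so the
    measurability part of Tonelli applies. *)
Lemma measurable_path_cdf (X : R -> {RV P >-> R}) : continuous_paths X ->
  measurable_fun setT (fun z : RT * RT => path_cdf X z.1 z.2).
Proof.
move=> cX.
pose f (y : (RT * RT) * Omega) : \bar R := 
  (\1_[set y : (RT * RT) * Omega | X (Num.max 0 y.1.1) y.2 <= y.1.2] y)%:E.
have mf : measurable_fun setT f.
  apply/measurable_EFinP; apply: measurable_indic.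
  pose g (y : (RT * RT) * Omega) : RT * Omega := (y.1.1, y.2).
  have mg : measurable_fun setT g.
    apply/measurable_fun_pairP; split; last exact: measurable_snd.
    exact: (measurableT_comp (@measurable_fst _ _ RT RT) measurable_fst).
  rewrite -[X in measurable X]setTI.
  apply: (measurable_fun_ler (measurableT_comp (measurable_process cX) mg)) => //.
  exact: (measurableT_comp (@measurable_snd _ _ RT RT) measurable_fst).
have f0 y : (0 <= f y)%E by rewrite lee_fin indicE.
have := @measurable_fun_fubini_tonelli_F _ _ _ _ _ P f mf f0.
rewrite /fubini_F => mF; apply/measurable_EFinP.
apply: eq_measurable_fun mF => -[s x] _ /=.
rewrite /path_cdf EFin_cdfr -(setIT [set w | _]) -integral_indic//.
exact: measurable_rv_le.
Qed.

Lemma measurable_path_cdf_comp (X Y : R -> {RV P >-> R}) :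
  continuous_paths X -> continuous_paths Y ->
  measurable_fun setT (fun z : RT * Omega =>
    path_cdf X z.1 (Y (Num.max 0 z.1) z.2)).
Proof.
move=> cX cY.
pose g (z : RT * Omega) : RT * RT := (z.1, Y (Num.max 0 z.1) z.2).
have mg : measurable_fun setT g.
  apply/measurable_fun_pairP; split; first exact: measurable_fst.
  exact: measurable_process.
exact: (measurableT_comp (measurable_path_cdf cX) mg).
Qed.

End joint_measurability.

Section time_integrals.
Context {R : realType}.
Notation mu := (@lebesgue_measure R).
Implicit Types (g : R -> R) (s t M : R).

Lemma bounded_integrable_itv b0 b1 s t g M : measurable_fun setT g ->
  (forall x, `|g x| <= M) ->
  mu.-integrable [set` Interval (BSide b0 s) (BSide b1 t)] (EFin \o g).
Proof.
move=> mg gM; apply: measurable_bounded_integrable => //.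
- by rewrite /= lebesgue_measure_itv/=; case: ifP => _; rewrite ?ltry// -EFinB ltry.
- exact: measurable_funTS.
- exists M; split; first exact: num_real.
  by move=> N MN x _; exact: le_trans (ltW MN).
Qed.

Lemma Rintegral_sub s t g M : 0 <= s -> s <= t -> measurable_fun setT g ->
  (forall x, `|g x| <= M) ->
  \int[mu]_(x in `[0, t]) g x - \int[mu]_(x in `[0, s]) g x =
  \int[mu]_(x in `]s, t]) g x.
Proof.
move=> s0 st mg gM; apply: Rintegral_itvB; rewrite ?bnd_simp//.
exact: bounded_integrable_itv mg gM.
Qed.

Lemma Rintegral_ocitv0 t g M : measurable_fun setT g -> (forall x, `|g x| <= M) ->
  \int[mu]_(x in `[0, t]) g x = \int[mu]_(x in `]0, t]) g x.
Proof.
move=> mg gM; apply/esym; apply: Rintegral_itv_obnd_cbnd.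
exact: bounded_integrable_itv mg gM.
Qed.

Lemma le_norm_Rintegral s t g M (h : R -> \bar R) : measurable_fun setT g ->
  (forall x, `|g x| <= M) -> measurable_fun setT h ->
  (forall x, s < x -> x <= t -> (`|g x|%:E <= h x)%E) ->
  (`|\int[mu]_(x in `]s, t]) g x|%:E <= \int[mu]_(x in `]s, t]) h x)%E.
Proof.
move=> mg gM mh gh; have ig := bounded_integrable_itv false false s t mg gM.
rewrite EFin_normr_Rintegral//.
apply: (le_trans (le_abse_integral _ _ _)) => //.
  exact: measurable_int ig.
apply: ge0_le_integral => //=.
- by apply/measurable_EFinP; apply: measurableT_comp => //; exact: measurable_funTS.
- exact: measurable_funTS.
- by move=> x; rewrite in_itv/= => /andP[sx xt]; exact: gh.
Qed.

Lemma integral_ocitv_cst s t k : s <= t ->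
  (\int[mu]_(x in `]s, t]) (cst k%:E) x = (k * (t - s))%:E)%E.
Proof.
move=> st; rewrite integral_cst//= lebesgue_measure_itv/= lte_fin.
move: st; rewrite le_eqVlt => /predU1P[->|->]; last by rewrite -EFinB -EFinM.
by rewrite ltxx subrr mulr0 mule0.
Qed.

Lemma le_norm_Rintegral_cst s t g M : s <= t -> measurable_fun setT g ->
  (forall x, `|g x| <= M) -> `|\int[mu]_(x in `]s, t]) g x| <= M * (t - s).
Proof.
move=> st mg gM; rewrite -lee_fin -integral_ocitv_cst//.
apply: (le_norm_Rintegral mg gM); first exact: measurable_cst.
by move=> x _ _; rewrite lee_fin.
Qed.

(* vanishes for [x <= 0], because of the conventions on [Num.sqrt] and on [/ 0] *)
Definition sqrt_kernel (k x : R) : R := expR (k * Num.sqrt x) / Num.sqrt x.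

Lemma sqrt_kernel_ge0 (k x : R) : 0 <= sqrt_kernel k x.
Proof. by rewrite divr_ge0 ?expR_ge0 ?sqrtr_ge0. Qed.

Lemma measurable_sqrt_kernel (k : R) : measurable_fun setT (sqrt_kernel k).
Proof.
have ms : measurable_fun (setT : set R) (@Num.sqrt R).
  by apply: continuous_measurable_fun; exact: sqrt_continuous.
apply: measurable_funM.
  by apply: measurableT_comp => //; exact: measurable_funM.
rewrite (_ : (fun x => _) = (fun x : R => Num.sqrt x `^ (-1))); last first.
  by apply/funext => x; rewrite powR_inv1// sqrtr_ge0.
exact: (measurableT_comp (@measurable_powR R (-1)) ms).
Qed.

Lemma is_derive_sqrt_kernel (k x : R) : 0 < k -> 0 < x ->
  is_derive x 1 (fun y : R => 2 / k * expR (k * Num.sqrt y)) (sqrt_kernel k x).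
Proof.
move=> k0 x0; have ds := is_derive1_sqrt x0.
have d1 : is_derive x 1 (fun y : R => k * Num.sqrt y) (k * (2 * Num.sqrt x)^-1).
  exact: (is_deriveZ k ds).
have d2 := @is_derive1_comp _ expR (fun y => k * Num.sqrt y) x _ _
  (is_derive_expR (k * Num.sqrt x)) d1.
have d3 : is_derive x 1 (fun y : R => 2 / k * expR (k * Num.sqrt y))
    (2 / k * (expR (k * Num.sqrt x) * (k * (2 * Num.sqrt x)^-1))).
  exact: (is_deriveZ (2 / k) d2).
apply: (is_derive_eq d3); rewrite /sqrt_kernel.
by field; rewrite !gt_eqF// sqrtr_gt0.
Qed.

(** The kernel is singular at 0, so the fundamental theorem of calculus is applied on
    [[s + 1 / (i + 1), t]] and the domain is then exhausted from inside. *)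
Lemma integral_sqrt_kernel (k s t : R) : 0 < k -> 0 <= s -> s <= t ->
  (\int[mu]_(x in `]s, t]) (sqrt_kernel k x)%:E <=
   (2 / k * (expR (k * Num.sqrt t) - expR (k * Num.sqrt s)))%:E)%E.
Proof.
move=> k0 s0 st.
pose F y : R := 2 / k * expR (k * Num.sqrt y).
have Fnd x y : x <= y -> F x <= F y.
  by move=> xy; rewrite ler_pM2l ?divr_gt0// ler_expR ler_pM2l// ler_wsqrtr.
have H e : s < e -> e <= t ->
    (\int[mu]_(x in `[e, t]) (sqrt_kernel k x)%:E <= (F t - F s)%:E)%E.
  move=> se; rewrite le_eqVlt => /predU1P[->|et].
    by rewrite set_itv1 integral_set1 lee_fin subr_ge0 Fnd.
  have x0 x : e <= x -> 0 < x by move=> ex; exact: le_lt_trans s0 (lt_le_trans se ex).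
  have cF x : 0 < x -> {for x, continuous F}.
    move=> /(is_derive_sqrt_kernel k0)[dF _].
    exact/differentiable_continuous/derivable1_diffP.
  have csk x : 0 < x -> {for x, continuous (sqrt_kernel k)}.
    move=> xx; apply: cvgM.
      apply: (cvg_comp (fun y => k * Num.sqrt y) expR); last exact: continuous_expR.
      by apply: cvgM; [exact: cvg_cst|exact: sqrt_continuous].
    by apply: cvgV; [rewrite gt_eqF// sqrtr_gt0|exact: sqrt_continuous].
  rewrite (@continuous_FTC2 _ (sqrt_kernel k) F e t et).
  - by rewrite -EFinB lee_fin lerD2l lerN2 Fnd// ltW.
  - apply: continuous_in_subspaceT => x; rewrite inE/= in_itv/= => /andP[ex _].
    exact/csk/x0.
  - split.
    + by move=> x; rewrite in_itv/= => /andP[/ltW/x0/(is_derive_sqrt_kernel k0)[]].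
    + by apply: cvg_at_right_filter; exact/cF/x0.
    + by apply: cvg_at_left_filter; exact/cF/x0/ltW.
  - move=> x; rewrite in_itv/= => /andP[/ltW/x0/(is_derive_sqrt_kernel k0)[? ?] _].
    by rewrite derive1E.
rewrite mulrBr -/(F t) -/(F s).
pose G i := [set` `[s + i.+1%:R^-1, t]] : set R.
have -> : `]s, t]%classic = \bigcup_i G i.
  apply/seteqP; split => x /=.
    rewrite in_itv/= => /andP[sx xt].
    have xs : 0 < x - s by rewrite subr_gt0.
    exists (Num.truncn (x - s)^-1) => //; rewrite /G/= in_itv/= xt andbT.
    rewrite -lerBrDl invf_ple ?posrE// ltW//; exact: truncnS_gt.
  move=> [i _]; rewrite /G/= !in_itv/= => /andP[sx ->]; rewrite andbT.
  by apply: lt_le_trans sx; rewrite ltrDl invr_gt0.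
have mG i : measurable_fun (G i) (fun x => (sqrt_kernel k x)%:E).
  by apply/measurable_EFinP; apply: measurable_funTS; exact: measurable_sqrt_kernel.
have cvgG : (\int[mu]_(x in G i) (sqrt_kernel k x)%:E @[i --> \oo] -->
    \int[mu]_(x in \bigcup_i G i) (sqrt_kernel k x)%:E)%E.
  apply: ge0_nondecreasing_set_cvg_integral => //.
  - move=> i j ij; rewrite subsetEset => x; rewrite /G/= !in_itv/= => /andP[sx ->].
    rewrite andbT; apply: le_trans sx; rewrite lerD2l lef_pV2 ?posrE//.
    by rewrite ler_nat.
  - by move=> i; exact: measurable_itv.
  - by move=> i x _; rewrite lee_fin sqrt_kernel_ge0.
move/cvg_lim : (cvgG) => <- //; apply: lime_le; first by apply/cvg_ex; eexists; exact: cvgG.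
apply: nearW => i; have [it|ti] := leP (s + i.+1%:R^-1) t.
  by apply: H => //; rewrite ltrDl invr_gt0.
by rewrite /G set_itv_ge ?bnd_simp -?ltNge// integral_set0 lee_fin subr_ge0 Fnd.
Qed.

End time_integrals.

(** * The nonlinear process *)

Section mckean.
Context d (Omega : measurableType d) (R : realType) (P : probability Omega R).
Notation mu := (@lebesgue_measure R).
Local Notation RT := (measurableTypeR R).
Variables (m : probability R R) (X0 : nat -> {RV P >-> R}).
Variables (W : nat -> R -> {RV P >-> R}).
Hypothesis inputs : initial_and_noise m X0 W.
Variables (sigma L B : R) (lam : R -> R).
Hypotheses (sigma0 : 0 < sigma) (L0 : 0 < L) (B0 : 0 < B).
Hypothesis lam_lip : forall x y, `|lam x - lam y| <= L * `|x - y|.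
Hypothesis lam_bnd : forall x, `|lam x| <= B.

Lemma adapted_indep_increment i (s t : R) (Z : {RV P >-> R}) :
  0 <= s -> s <= t ->
  (forall A, measurable A ->
    completion P (input_filtration X0 W [set i] s) (Z @^-1` A)) ->
  forall A C : set R, measurable A -> measurable C ->
  P (Z @^-1` A `&` (fun w => W i t w - W i s w) @^-1` C) =
  (P (Z @^-1` A) * P ((fun w => (W i t w - W i s w)%R) @^-1` C))%E.
Proof.
move=> s0 st aZ A C mA mC.
have := indep_completion (@filtration_rv_measurable _ _ _ _ X0 W i s) _
  (input_filtration_indep_increment inputs s0 st).
apply.
- by apply: sigma_rv_measurable => _; exact: measurable_funB.
- split; first exact: aZ.
  by rewrite -[X in measurable X]setTI; exact: measurable_funP.
- exact: (@sigma_rv_mem _ _ _ _ _ (fun (_ : unit) w => W i t w - W i s w) tt).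
Qed.

Lemma measurable_lam : measurable_fun setT lam.
Proof.
apply: continuous_measurable_fun => x; apply/cvgrPdist_lt => e e0.
apply/nbhs_ballP; exists (e / L) => /= [|y xy]; first exact: divr_gt0.
apply: le_lt_trans (lam_lip _ _) _.
by rewrite mulrC -ltr_pdivlMr.
Qed.

Definition mckean_drift (X Y : R -> {RV P >-> R}) (s : R) (w : Omega) : R :=
  lam (path_cdf X s (Y (Num.max 0 s) w)).

Lemma measurable_mckean_drift (X Y : R -> {RV P >-> R}) w :
  continuous_paths X -> continuous_paths Y ->
  measurable_fun setT (fun s : R => mckean_drift X Y s w).
Proof.
move=> cX cY; apply: (measurableT_comp measurable_lam).
exact: (measurable_fun_pair1 w (measurable_path_cdf_comp cX cY)).
Qed.

(** A form of [mckean_strong_solution] whose drift, cut off at time 0, is measurable on the whole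
    time axis once [lam] is globally Lipschitz. *)
Record mckean_process (i : nat) (X : R -> {RV P >-> R}) : Prop := {
  mckean_cont : continuous_paths X ;
  mckean_adapt : adapted P (input_filtration X0 W [set i]) X ;
  mckean_eq : {ae P, forall w, forall t, 0 <= t ->
    X t w = X0 i w + sigma * W i t w + \int[mu]_(s in `[0, t]) mckean_drift X X s w}
}.

Lemma mckean_increment i X : mckean_process i X ->
  {ae P, forall w, forall s t, 0 <= s -> s <= t ->
    X t w - X s w - sigma * (W i t w - W i s w) =
    \int[mu]_(u in `]s, t]) mckean_drift X X u w}.
Proof.
move=> mX; apply: filterS (mckean_eq mX) => w Xw s t s0 st.
have t0 : 0 <= t by exact: le_trans st.
have cX := mckean_cont mX.
rewrite -(Rintegral_sub s0 st (measurable_mckean_drift w cX cX)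
  (fun u => lam_bnd _)).
by rewrite !Xw//; ring.
Qed.

Lemma mckean_noisy i X : mckean_process i X -> noisy_process sigma B X (W i).
Proof.
move=> mX; have cX := mckean_cont mX; split.
- move=> s t s0 st; apply: filterS (mckean_increment mX) => w /(_ _ _ s0 st) ->.
  apply: (le_norm_Rintegral_cst st (measurable_mckean_drift w cX cX)).
  by move=> u; exact: lam_bnd.
- move=> s t s0 st; apply: (adapted_indep_increment s0 st) => A mA.
  exact: (mckean_adapt mX).
- move=> s t s0 st A mA; exact: (bm_increment_law (noise_bm inputs i)).
Qed.

(** Each [X i] is adapted to the completed filtration of its own inputs alone, and these filtrations
    are mutually independent. *)
Lemma mckean_mutual_indep (X : nat -> R -> {RV P >-> R}) t (A : nat -> set R) s :
  (forall i, mckean_process i (X i)) -> 0 <= t -> (forall i, measurable (A i)) ->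
  uniq s ->
  P (\big[setI/setT]_(i <- s) (X i t @^-1` A i)) =
  (\prod_(i <- s) P (X i t @^-1` A i))%E.
Proof.
move=> mX t0 mA us.
have := mutual_indep_completion (fun i => @filtration_rv_measurable _ _ _ _ X0 W i t)
  (@input_filtration_mutual_indep _ _ _ _ _ _ _ inputs t).
apply => // i _; split; first exact: (mckean_adapt (mX i)).
by rewrite -[X in measurable X]setTI; exact: measurable_funP.
Qed.

Lemma mckean_cdf_lipschitz T : 0 < T -> exists2 c : R, 0 < c &
  forall i X, mckean_process i X -> forall t x y, 0 < t -> t <= T ->
  `|path_cdf X t x - path_cdf X t y| <= c / Num.sqrt t * `|x - y|.
Proof.
move=> T0; have [c c0 H] := density_bound P sigma0 B0 T0.
exists c => // i X /mckean_noisy nX t x y t0 tT.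
rewrite /path_cdf (max_r (ltW t0)); apply: cdfr_lipschitz.
  by rewrite divr_ge0 ?(ltW c0)// sqrtr_ge0.
by move=> z h h0; exact: (H _ _ nX).
Qed.

End mckean.

(** * The Euler scheme and uniqueness of the marginal laws *)

Lemma uniform_continuity_segment (R : realType) (f : R -> R) (t e : R) :
  {within `[0, +oo[, continuous f} -> 0 < e ->
  exists2 n0, (0 < n0)%N & forall n, (n0 <= n)%N -> forall x y, 0 <= x -> x <= t ->
    0 <= y -> `|x - y| <= n%:R^-1 -> `|f x - f y| <= e.
Proof.
move=> /subspace_continuousP cf e0.
pose Q (n : nat) (x : R) := 0 <= x -> forall y, 0 <= y -> `|x - y| <= n%:R^-1 ->
  `|f x - f y| <= e.
have /compact_near_coveringP cpt := @segment_compact R 0 t.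
have [|n0 _ H] := cpt _ \oo Q _ _.
  move=> x; rewrite /= in_itv/= => /andP[x0 xt].
  have : [set` `[0, +oo[] x by rewrite /= in_itv/= x0.
  move=> /cf /cvgrPdist_lt /(_ (e / 2)); rewrite divr_gt0// => /(_ isT).
  move=> /nbhs_ballP[r /= r0 rf].
  have r20 : 0 < r / 2 by rewrite divr_gt0.
  exists (ball x (r / 2), [set n | (Num.truncn (r / 2)^-1 < n)%N]).
    split => /=; first exact: nbhsx_ballx.
    by exists (Num.truncn (r / 2)^-1).+1.
  move=> [x' n] /= [xx' nr] x'0 y y0 x'y.
  have nr' : n%:R^-1 < r / 2.
    rewrite invf_plt ?posrE ?ltr0n ?(leq_trans _ nr)//.
    by apply: lt_le_trans (truncnS_gt _) _; rewrite ler_nat.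
  have fx' : `|f x - f x'| < e / 2.
    apply: rf; last by rewrite /= in_itv/= x'0.
    by apply: le_ball xx'; lra.
  have fy : `|f x - f y| < e / 2.
    apply: rf; last by rewrite /= in_itv/= y0.
    rewrite /ball/=; have := ler_normD (x - x') (x' - y).
    rewrite addrA subrK; move: xx'; rewrite /ball/= => xx'.
    by lra.
  have := ler_normB (f x - f y) (f x - f x').
  have -> : f x - f y - (f x - f x') = f x' - f y by ring.
  by lra.
exists n0.+1 => // n n0n x y x0 xt y0 xy.
by apply: (H n (ltnW n0n) x) => //=; rewrite in_itv/= x0.
Qed.

Section euler.
Context d (Omega : measurableType d) (R : realType) (P : probability Omega R).
Notation mu := (@lebesgue_measure R).
Local Notation RT := (measurableTypeR R).

(** Only the position is frozen during a step: the drift is merely measurable in time, so its time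
    dependence is integrated exactly. *)
Definition euler_drift (b : R -> R -> R) (eta : R) k (x : R) : R :=
  \int[mu]_(s in `](k%:R * eta), (k.+1%:R * eta)]) b s x.

Fixpoint euler (b : R -> R -> R) (sigma eta : R) (x0 : {RV P >-> R})
    (w : R -> {RV P >-> R}) (k : nat) (o : Omega) : R :=
  if k is j.+1 then
    let z := euler b sigma eta x0 w j o in
    z + sigma * (w (j.+1%:R * eta) o - w (j%:R * eta) o) + euler_drift b eta j z
  else x0 o.

Variables (b : R -> R -> R) (B : R).
Hypothesis mb : measurable_fun setT (fun z : RT * RT => b z.1 z.2).
Hypothesis bB : forall s x, `|b s x| <= B.

Lemma measurable_euler_drift eta k : measurable_fun setT (euler_drift b eta k).
Proof.
set D := [set` `](k%:R * eta), (k.+1%:R * eta)]] : set R.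
have mD : measurable D by exact: measurable_itv.
have mbx x : measurable_fun setT (b^~ x).
  exact: (measurable_fun_pair1 x mb).
(* Adding [B] makes the integrand nonnegative, as Tonelli requires; the constant is subtracted again
   at the end. *)
pose f (z : RT * RT) : \bar R := ((b z.2 z.1 + B) * \1_D z.2)%:E.
have mf : measurable_fun setT f.
  apply/measurable_EFinP; apply: measurable_funM.
    apply: measurable_funD; last exact: measurable_cst.
    have ms : measurable_fun setT (fun z : RT * RT => (z.2, z.1)).
      apply/measurable_fun_pairP; split; first exact: measurable_snd.
      exact: measurable_fst.
    exact: (measurableT_comp mb ms).
  exact: (measurableT_comp (measurable_indic mD) measurable_snd).
have f0 z : (0 <= f z)%E.
  rewrite lee_fin mulr_ge0//.
  by have := bB z.2 z.1; rewrite ler_norml => /andP[]; lra.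
have mF := @measurable_fun_fubini_tonelli_F _ _ _ _ _
  (lebesgue_measure : {sigma_finite_measure set RT -> \bar R}) f mf f0.
have mF' : measurable_fun (setT : set RT)
    (fun x => fine (\int[mu]_(s in D) (b s x + B)%:E)%E).
  apply: (measurableT_comp (fine_measurable measurableT)) => //.
  apply: eq_measurable_fun mF => x _; rewrite /fubini_F [RHS]integral_mkcond.
  apply: eq_integral => s _; rewrite /f/= patchE indicE.
  by case: (s \in D); rewrite ?mulr1 ?mulr0.
have mD' : measurable_fun (setT : set RT)
    (fun x => fine (\int[mu]_(s in D) (b s x + B)%:E)%E -
              \int[mu]_(s in D) (fun=> B) s).
  by apply: measurable_funB => //; exact: mF'.
apply: eq_measurable_fun mD' => x _; rewrite /euler_drift -/D.
rewrite -[fine _]/(\int[mu]_(s in D) (b s x + B)).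
rewrite RintegralD//; first by rewrite addrK.
  exact: (bounded_integrable_itv _ _ _ _ (mbx x) (bB^~ x)).
apply: (@bounded_integrable_itv _ _ _ _ _ _ `|B|) => //.
Qed.

Variables (sigma eta : R).
Hypothesis eta0 : 0 < eta.

Lemma measurable_euler_sub (G : set (set Omega)) (x0 : {RV P >-> R})
    (w : R -> {RV P >-> R}) k :
  (forall A, measurable A -> <<s G >> (x0 @^-1` A)) ->
  (forall j A, (j <= k)%N -> measurable A -> <<s G >> (w (j%:R * eta) @^-1` A)) ->
  forall A, measurable A -> <<s G >> (euler b sigma eta x0 w k @^-1` A).
Proof.
move=> Gx0; elim: k => [//|k IH] Gw /= A mA.
have mw j : (j <= k.+1)%N ->
    measurable_fun (setT : set (g_sigma_algebraType G)) (w (j%:R * eta) : Omega -> R).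
  by move=> jk; apply/g_sigma_measurable_funP => C mC; exact: Gw.
have mz : measurable_fun (setT : set (g_sigma_algebraType G))
    (euler b sigma eta x0 w k).
  by apply/g_sigma_measurable_funP; apply: IH => j C jk; apply: Gw; exact: leqW.
apply: (g_sigma_measurable_funP G _).1 A mA.
apply: measurable_funD; last exact: (measurableT_comp (measurable_euler_drift _ _)).
apply: measurable_funD => //; apply: measurable_funM => //.
by apply: measurable_funB; exact: mw.
Qed.

End euler.

Section path_modulus.
Context d (Omega : measurableType d) (R : realType) (P : probability Omega R).

(** Uniform continuity gives a mesh that depends on the path; outside an event of probability at
    most [p], one mesh serves all paths. *)
Lemma path_modulus (X : R -> {RV P >-> R}) (t e p : R) : continuous_paths X ->
  0 < t -> 0 < e -> 0 < p -> exists n0, forall n, (n0 <= n)%N ->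
  exists G : set Omega, [/\ measurable G, (P (~` G) <= p%:E)%E &
    forall w, G w -> forall j, (j < n)%N -> forall s,
    j%:R * (t / n%:R) <= s -> s <= j.+1%:R * (t / n%:R) ->
    `|X s w - X (j%:R * (t / n%:R)) w| <= e].
Proof.
move=> cX t0 e0 p0.
(* Countably many offsets keep the event measurable; path continuity extends the bound to all times
   of the cell. *)
pose small n j k l := [set w | (j < n)%N -> k%:R / l.+1%:R <= t / n%:R ->
  `|X (j%:R * (t / n%:R) + k%:R / l.+1%:R) w - X (j%:R * (t / n%:R)) w| <= e].
pose good n := \bigcap_j \bigcap_k \bigcap_l small n j k l.
have mgood n : measurable (good n).
  apply: bigcapT_measurable => j; apply: bigcapT_measurable => k.
  apply: bigcapT_measurable => l.
  have [jn|nj] := boolP (j < n)%N; last first.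
    by rewrite (_ : small _ _ _ _ = setT)//; apply/seteqP; split => // w _ jn; rewrite jn in nj.
  have [kl|kl] := boolP (k%:R / l.+1%:R <= t / n%:R); last first.
    by rewrite (_ : small _ _ _ _ = setT)//; apply/seteqP; split => // w _ _ kl'; rewrite kl' in kl.
  rewrite (_ : small _ _ _ _ = [set w | `|X (j%:R * (t / n%:R) + k%:R / l.+1%:R) w -
      X (j%:R * (t / n%:R)) w| <= e]); last first.
    rewrite /small; apply/seteqP; split => w /=; first exact.
    by move=> h _ _.
  rewrite -[X in measurable X]setTI; apply: measurable_fun_ler => //.
  by apply: measurableT_comp => //; exact: measurable_funB.
have goodP n w : good n w -> forall j, (j < n)%N -> forall s,
    j%:R * (t / n%:R) <= s -> s <= j.+1%:R * (t / n%:R) ->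
    `|X s w - X (j%:R * (t / n%:R)) w| <= e.
  move=> gw j jn s; set tj := j%:R * (t / n%:R) => tjs stj.
  have n0 : 0 < n%:R :> R by rewrite ltr0n (leq_ltn_trans _ jn).
  have tj0 : 0 <= tj by rewrite mulr_ge0// divr_ge0 ?(ltW t0)// ltW.
  have s0 : 0 <= s - tj by rewrite subr_ge0.
  pose u l := tj + (Num.truncn ((s - tj) * l.+1%:R))%:R / l.+1%:R.
  have us : u l @[l --> \oo] --> s.
    have -> : s = tj + Num.max 0 (s - tj) by rewrite max_r// addrC subrK.
    by apply: cvgD; [exact: cvg_cst|exact: truncn_grid_cvg].
  have ul0 l : 0 <= u l by rewrite addr_ge0// divr_ge0.
  have := continuous_ray_cvg (cX w) (le_trans tj0 tjs) ul0 us => Xu.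
  have XuB : X (u l) w - X tj w @[l --> \oo] --> X s w - X tj w.
    by apply: cvgB => //; exact: cvg_cst.
  have nXu : `|X (u l) w - X tj w| @[l --> \oo] --> `|X s w - X tj w|.
    exact: cvg_norm.
  move/cvg_lim : (nXu) => <- //.
  apply: limr_le; first by apply/cvg_ex; eexists; exact: nXu.
  apply: nearW => l; apply: (gw j I (Num.truncn ((s - tj) * l.+1%:R)) I l I) => //.
  rewrite ler_pdivrMr ?ltr0n//.
  have /truncn_itv/andP[h _] : 0 <= (s - tj) * l.+1%:R by rewrite mulr_ge0.
  apply: (le_trans h); rewrite ler_wpM2r//.
  by rewrite lerBlDl (le_trans stj)// /tj -natr1 mulrDl mul1r.
have goodE w : exists n0, forall n, (n0 <= n)%N -> good n w.
  have [n1 n10 H] := uniform_continuity_segment t (cX w) e0.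
  exists (Num.truncn (t * n1%:R)).+1 => n nn j _ k _ l _ /= jn kl.
  have n0 : 0 < n%:R :> R by rewrite ltr0n (leq_ltn_trans _ jn).
  have nt : t * n1%:R <= n%:R.
    by apply: ltW; apply: lt_le_trans (truncnS_gt _) _; rewrite ler_nat.
  have tj0 : 0 <= j%:R * (t / n%:R) by rewrite mulr_ge0// divr_ge0 ?(ltW t0)// ltW.
  apply: (H n1 (leqnn _)) => //.
  - by rewrite addr_ge0// divr_ge0.
  - apply: (@le_trans _ _ (j.+1%:R * (t / n%:R))).
      by rewrite -[j.+1%:R]natr1 mulrDl mul1r lerD2l.
    rewrite mulrCA ler_piMr ?(ltW t0)// ler_pdivrMr// mul1r ler_nat//.
  - rewrite [X in X - _]addrC addrK ger0_norm ?divr_ge0//; apply: (le_trans kl).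
    by rewrite ler_pdivrMr// mulrC ler_pdivlMr ?ltr0n.
(* [good n] need not increase with [n], but its tail intersections do. *)
pose H n := \bigcap_q good (n + q)%N.
have mH n : measurable (H n) by apply: bigcapT_measurable => q.
have HT : \bigcup_n H n = setT.
  apply/seteqP; split => // w _; have [n0 Hn] := goodE w.
  by exists n0 => // q _; apply: Hn; rewrite leq_addr.
have cvgH : P (H n) @[n --> \oo] --> P (\bigcup_n H n).
  apply: nondecreasing_cvg_mu => //; first exact: bigcupT_measurable.
  move=> n n' nn'; rewrite subsetEset => w Hw q _.
  have -> : (n' + q = n + (n' - n + q))%N by rewrite addnA subnKC.
  exact: Hw.
rewrite HT (@probability_setT _ _ _ P) in cvgH.
have cvgC : P (~` H n) @[n --> \oo] --> (0 : \bar R).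
  have -> : (fun n => P (~` H n)) = (fun n => 1 - P (H n))%E.
    by apply/funext => n; rewrite probability_setC.
  rewrite -[X in _ --> X](@subee _ (1 : \bar R)%E)//.
  by apply: cvgeB => //; exact: cvg_cst.
have /fine_cvgP[_ /cvgrPdist_lt /(_ _ p0)[n0 _ Hn0]] := cvgC.
exists n0 => n nn; exists (good n); split => //.
- apply: (@le_trans _ _ (P (~` H n))).
    rewrite le_measure ?inE//; try exact: measurableC.
    by apply: subsetC => w Hw; have := Hw 0%N I; rewrite addn0.
  have := Hn0 n nn; rewrite /= sub0r normrN => hn.
  rewrite -[leLHS]fineK ?fin_num_measure//; last exact: measurableC.
  by rewrite lee_fin ltW// (le_lt_trans (ler_norm _) hn).
- exact: goodP.
Qed.

End path_modulus.

Section uniqueness_in_law.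
Context d (Omega : measurableType d) (R : realType) (P : probability Omega R).
Notation mu := (@lebesgue_measure R).
Local Notation RT := (measurableTypeR R).
Variables (m : probability R R) (X0 : nat -> {RV P >-> R}).
Variables (W : nat -> R -> {RV P >-> R}).
Hypothesis inputs : initial_and_noise m X0 W.
Variables (sigma L B : R) (lam : R -> R).
Hypotheses (sigma0 : 0 < sigma) (L0 : 0 < L) (B0 : 0 < B).
Hypothesis lam_lip : forall x y, `|lam x - lam y| <= L * `|x - y|.
Hypothesis lam_bnd : forall x, `|lam x| <= B.

Section euler_law.
Variables (b : R -> R -> R) (eta : R).
Hypothesis mb : measurable_fun setT (fun z : RT * RT => b z.1 z.2).
Hypothesis bB : forall s x, `|b s x| <= B.
Hypothesis eta0 : 0 < eta.

Local Notation Z i := (euler b sigma eta (X0 i) (W i)).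

Lemma euler_adapted i k A : measurable A ->
  input_filtration X0 W [set i] (k%:R * eta) (Z i k @^-1` A).
Proof.
apply: (measurable_euler_sub mb bB) => [C mC|j C jk mC].
  by apply: sub_gen_smallest; left; exact: sigma_rv_mem.
apply: sub_gen_smallest; right.
apply: (@sigma_rv_mem _ _ _ _ _ (fun iu : nat * R => W iu.1 iu.2 : _ -> _) (i, j%:R * eta)) => //.
by split => //=; rewrite in_itv/= mulr_ge0 ?(ltW eta0)//= ler_wpM2r ?(ltW eta0)// ler_nat.
Qed.

Lemma measurable_euler i k : measurable_fun setT (Z i k).
Proof.
move=> _ A mA; rewrite setTI.
exact: filtration_rv_measurable (euler_adapted mA).
Qed.

(** A step of the scheme is a transition kernel [phi] built from [b] and the normal law only, so
    induction on [k] carries the equality of the initial laws along. *)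
Lemma euler_same_law i j k A : measurable A ->
  P (Z i k @^-1` A) = P (Z j k @^-1` A).
Proof.
elim: k A => [|k IH] A mA.
  have h n : P (Z n 0%N @^-1` A) = m A by exact: (init_law inputs).
  by rewrite !h.
have k0 : 0 <= k%:R * eta by rewrite mulr_ge0// ltW.
have kk : k%:R * eta < k.+1%:R * eta by rewrite ltr_pM2r// ltr_nat.
pose f (z : R * R) : \bar R :=
  (\1_A (z.1 + sigma * z.2 + euler_drift b eta k z.1))%:E.
have mf : measurable_fun setT f.
  apply/measurable_EFinP; apply: (measurableT_comp (measurable_indic mA)).
  apply: measurable_funD.
    by apply: measurable_funD => //; exact: measurable_funM.
  exact: (measurableT_comp (measurable_euler_drift mb bB eta k)).
have f0 z : (0 <= f z)%E by rewrite lee_fin indicE.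
pose N := normal_prob (0 : R) (Num.sqrt (k.+1%:R * eta - k%:R * eta)).
pose phi z := (\int[N]_x f (z, x))%E.
pose Zk n : {RV P >-> R} :=
  HB.pack (Z n k) (isMeasurableFun.Build _ _ _ _ _ (measurable_euler n k)).
have step n : P (Z n k.+1 @^-1` A) = (\int[distribution P (Zk n)]_z phi z)%E.
  pose xi : {RV P >-> R} := W n (k.+1%:R * eta) - W n (k%:R * eta).
  have phiE z : (\int[distribution P xi]_x f (z, x))%E = phi z.
    apply: ge0_integral_law => [C mC| |//].
      exact: (bm_increment_law (noise_bm inputs n)).
    exact: measurable_fun_pair2.
  have mphi : measurable_fun (setT : set R) phi.
    have := @measurable_fun_fubini_tonelli_F _ _ _ _ _ (distribution P xi) f mf f0.
    by apply: eq_measurable_fun => z _; exact: phiE.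
  rewrite ge0_integral_distribution//; last first.
    by move=> z; apply: integral_ge0.
  rewrite -(setIT (_ @^-1` _)) -integral_indic//; last first.
    by rewrite -[X in measurable X]setTI; exact: measurable_euler.
  transitivity (\int[P]_w f (Zk n w, xi w))%E; first by [].
  rewrite (@ge0_integral_indep_pair _ _ _ _ (Zk n) xi f)//.
    by apply: eq_integral => w _; exact: phiE.
  apply: (adapted_indep_increment inputs k0 (ltW kk)) => C mC.
  exists (Z n k @^-1` C); first exact: euler_adapted.
  by rewrite setYK; exact: negligible_set0.
rewrite !step; apply: eq_measure_integral => C mC _; exact: IH.
Qed.

End euler_law.

Section comparison.
Variables (c k t : R).
Hypotheses (c0 : 0 < c) (k0 : 0 < k) (t0 : 0 < t) (ck : 4 * (L * c) <= k).
Local Notation process := (mckean_process X0 W sigma lam).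

Section euler_error.
Variables (n : nat) (X1 X2 : R -> {RV P >-> R}) (i : nat) (M e E : R).
Hypotheses (cX1 : continuous_paths X1) (cX2 : continuous_paths X2).
Hypotheses (n0 : (0 < n)%N) (M0 : 0 <= M) (e0 : 0 <= e).
Let eta := t / n%:R.
Let b s x := lam (path_cdf X2 s x).
Hypothesis lip2 : forall s x y, 0 < s -> s <= t ->
  `|path_cdf X2 s x - path_cdf X2 s y| <= c / Num.sqrt s * `|x - y|.
Hypothesis close : forall s x, 0 < s -> s <= t ->
  `|path_cdf X1 s x - path_cdf X2 s x| <= M * sqrt_kernel k s.

Lemma measurable_cdf_drift : measurable_fun setT (fun z : RT * RT => b z.1 z.2).
Proof.
exact: (measurableT_comp (measurable_lam L0 lam_lip) (measurable_path_cdf cX2)).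
Qed.

(** The solution [E] of [E = 2 * L * M / k + (e + E) / 2], the recursion for the weighted Euler
    error when [4 * (L * c) <= k]. *)
Definition euler_bound : R := 4 * L * M / k + e.

(** The scheme follows the noise of [X1] but the law of [X2]. Three errors feed the drift: the
    distance [M] of the laws, the modulus [e] of the path within a step, and the error inherited at
    the start of the step. Integrated against [sqrt_kernel], they reproduce the claimed bound. *)
Lemma euler_error w :
  X1 0 w = X0 i w ->
  (forall s u, 0 <= s -> s <= u -> X1 u w - X1 s w - sigma * (W i u w - W i s w) =
    \int[mu]_(r in `]s, u]) mckean_drift lam X1 X1 r w) ->
  (forall j, (j < n)%N -> forall s, j%:R * eta <= s -> s <= j.+1%:R * eta ->
    `|X1 s w - X1 (j%:R * eta) w| <= e) ->
  forall j, (j <= n)%N ->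
  `|X1 (j%:R * eta) w - euler b sigma eta (X0 i) (W i) j w| <=
  euler_bound * (expR (k * Num.sqrt (j%:R * eta)) - 1).
Proof.
move=> X10 X1w X1e; have n0' : 0 < n%:R :> R by rewrite ltr0n.
have eta0 : 0 < eta by rewrite divr_gt0.
have EB0 : 0 <= euler_bound.
  by rewrite addr_ge0// divr_ge0 ?(ltW k0)// !mulr_ge0 ?(ltW L0).
elim=> [_|j IH jn].
  by rewrite mul0r X10 subrr normr0 sqrtr0 mulr0 expR0 subrr mulr0.
set tj := j%:R * eta in IH X1e *; set tj1 := j.+1%:R * eta.
have tj0 : 0 <= tj by rewrite mulr_ge0// ltW.
have tjj : tj < tj1 by rewrite ltr_pM2r// ltr_nat.
have tj1t : tj1 <= t.
  by rewrite /tj1 /eta mulrCA ler_piMr ?(ltW t0)// ler_pdivrMr// mul1r ler_nat.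
set z := euler b sigma eta (X0 i) (W i) j w in IH *.
have IHj := IH (ltnW jn).
have mg : measurable_fun setT (fun r : R => mckean_drift lam X1 X1 r w).
  exact: (measurable_mckean_drift L0 lam_lip).
have mbz : measurable_fun setT (b^~ z).
  exact: (measurable_fun_pair1 z measurable_cdf_drift).
have -> : X1 tj1 w - euler b sigma eta (X0 i) (W i) j.+1 w =
    (X1 tj w - z) + \int[mu]_(r in `]tj, tj1]) (mckean_drift lam X1 X1 r w - b r z).
  rewrite RintegralB//; first last.
  - exact: (bounded_integrable_itv _ _ _ _ mbz (fun _ => lam_bnd _)).
  - exact: (bounded_integrable_itv _ _ _ _ mg (fun _ => lam_bnd _)).
  rewrite -X1w ?(ltW tjj)//= -/z -/tj -/tj1 /euler_drift -/tj -/tj1; ring.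
set K := L * M + L * c * (e + euler_bound).
have eEB : 0 <= e + euler_bound by rewrite addr_ge0.
have K0 : 0 <= K by rewrite addr_ge0// !mulr_ge0 ?(ltW L0) ?(ltW c0).
have bound r : tj < r -> r <= tj1 ->
    `|mckean_drift lam X1 X1 r w - b r z| <= K * sqrt_kernel k r.
  move=> tjr rtj; have r0 : 0 < r by exact: le_lt_trans tjr.
  have rt : r <= t by exact: le_trans tj1t.
  have sr0 : 0 < Num.sqrt r by rewrite sqrtr_gt0.
  rewrite /mckean_drift (max_r (ltW r0)); apply: (le_trans (lam_lip _ _)).
  have dist : `|X1 r w - z| <= (e + euler_bound) * expR (k * Num.sqrt r).
    have -> : X1 r w - z = (X1 r w - X1 tj w) + (X1 tj w - z) by ring.
    apply: (le_trans (ler_normD _ _)); rewrite mulrDl lerD//.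
      apply: (le_trans (X1e _ jn _ (ltW tjr) rtj)); rewrite ler_peMr//.
      by rewrite -[leLHS]expR0 ler_expR mulr_ge0 ?sqrtr_ge0// ltW.
    apply: (le_trans IHj); rewrite ler_wpM2l//.
    rewrite lerBlDr (@le_trans _ _ (expR (k * Num.sqrt r)))//; last by rewrite lerDl.
    by rewrite ler_expR ler_pM2l// ler_wsqrtr// ltW.
  have -> : K * sqrt_kernel k r = L * (M * sqrt_kernel k r +
     c / Num.sqrt r * ((e + euler_bound) * expR (k * Num.sqrt r))).
    by rewrite /K /sqrt_kernel; ring.
  rewrite ler_pM2l//.
  have -> : path_cdf X1 r (X1 r w) - path_cdf X2 r z =
     (path_cdf X1 r (X1 r w) - path_cdf X2 r (X1 r w)) +
     (path_cdf X2 r (X1 r w) - path_cdf X2 r z) by ring.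
  apply: (le_trans (ler_normD _ _)); apply: lerD; first exact: close.
  apply: (le_trans (lip2 _ _ r0 rt)); rewrite ler_wpM2l//.
  by rewrite divr_ge0// ltW.
have intb : `|\int[mu]_(r in `]tj, tj1]) (mckean_drift lam X1 X1 r w - b r z)| <=
    K * (2 / k * (expR (k * Num.sqrt tj1) - expR (k * Num.sqrt tj))).
  rewrite -lee_fin; apply: (@le_trans _ _
      (\int[mu]_(r in `]tj, tj1]) (K%:E * (sqrt_kernel k r)%:E))%E).
    apply: (@le_norm_Rintegral _ _ _ _ (B + B)).
    - exact: measurable_funB.
    - by move=> r; apply: (le_trans (ler_normB _ _)); rewrite lerD// lam_bnd.
    - apply: emeasurable_funM => //; apply/measurable_EFinP.
      exact: measurable_sqrt_kernel.
    - by move=> r r1 r2; rewrite -EFinM lee_fin; exact: bound.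
  rewrite ge0_integralZl//.
  - rewrite EFinM lee_wpmul2l ?lee_fin//; apply: integral_sqrt_kernel => //.
    exact: ltW.
  - apply/measurable_EFinP; apply: measurable_funTS; exact: measurable_sqrt_kernel.
  - by move=> r _; rewrite lee_fin sqrt_kernel_ge0.
have Kk : K * (2 / k) <= euler_bound.
  have -> : K * (2 / k) = (2 * L * M + 2 * (L * c) * (e + euler_bound)) / k.
    by rewrite /K; ring.
  rewrite ler_pdivrMr//.
  have h1 : 2 * (L * c) * (e + euler_bound) <= k / 2 * (e + euler_bound).
    by apply: ler_wpM2r => //; move: ck; set Lc := L * c; lra.
  have h2 : euler_bound * k = 4 * L * M + e * k.
    by rewrite /euler_bound mulrDl divfK// gt_eqF.
  by lra.
apply: (le_trans (ler_normD _ _)); apply: (le_trans (lerD IHj intb)).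
have dE : 0 <= expR (k * Num.sqrt tj1) - expR (k * Num.sqrt tj).
  by rewrite subr_ge0 ler_expR ler_pM2l// ler_wsqrtr// ltW.
rewrite mulrA; apply: (le_trans (lerD (lexx _) (ler_wpM2r dE Kk))).
by rewrite -mulrDr le_eqVlt; apply/orP; left; apply/eqP; ring.
Qed.

End euler_error.

Lemma mckean_start i X : process i X -> {ae P, forall w, X 0 w = X0 i w}.
Proof.
move=> mX; have := bm_start (noise_bm inputs i).
apply: filterS2 (mckean_eq mX) => w Xw W0.
by rewrite Xw// W0 mulr0 addr0 set_itv1 Rintegral_set1 addr0.
Qed.

Section one_sided.
Variables (X1 X2 : R -> {RV P >-> R}) (i j : nat) (M : R).
Hypotheses (mX1 : process i X1) (mX2 : process j X2) (M0 : 0 <= M).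
Hypothesis lip2 : forall s x y, 0 < s -> s <= t ->
  `|path_cdf X2 s x - path_cdf X2 s y| <= c / Num.sqrt s * `|x - y|.
Hypothesis close : forall s x, 0 < s -> s <= t ->
  `|path_cdf X1 s x - path_cdf X2 s x| <= M * sqrt_kernel k s.

(** [X1] is close to the scheme run on the inputs [i], which has the law of the scheme run on the
    inputs [j], which is close to [X2]. The displacement of the threshold is then paid by the
    Lipschitz bound on the distribution function of [X2]. *)
Lemma path_cdf_comparison_le x :
  path_cdf X1 t x <= path_cdf X2 t x + 4 * (L * c) * M / k * sqrt_kernel k t.
Proof.
have cX1 := mckean_cont mX1; have cX2 := mckean_cont mX2.
have ker0 := sqrt_kernel_ge0 k t.
apply/ler_addgt0Pr => r r0.
have d0 : 0 < 2 * (c * sqrt_kernel k t) + 2.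
  by rewrite ltr_wpDl// mulr_ge0// mulr_ge0// ltW.
(* [e] bounds both the path moduli and the two exceptional probabilities; all terms in [e] add up to
   exactly [r]. *)
pose e := r / (2 * (c * sqrt_kernel k t) + 2).
have e0 : 0 < e by rewrite divr_gt0.
have [n1 H1] := path_modulus cX1 t0 e0 e0.
have [n2 H2] := path_modulus cX2 t0 e0 e0.
pose n := (maxn n1 n2).+1.
have [G1 [mG1 PG1 G1P]] := H1 n (leqW (leq_maxl _ _)).
have [G2 [mG2 PG2 G2P]] := H2 n (leqW (leq_maxr _ _)).
pose b s x := lam (path_cdf X2 s x).
pose eta := t / n%:R.
have n0 : 0 < n%:R :> R by rewrite ltr0n.
have neta : n%:R * eta = t by rewrite /eta mulrC divfK// gt_eqF.
have eta0 : 0 < eta by rewrite divr_gt0.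
have mb := measurable_cdf_drift cX2.
pose Z l : Omega -> R := euler b sigma eta (X0 l) (W l) n.
have mZ l y : measurable [set w | Z l w <= y].
  rewrite -[X in measurable X]setTI; apply: measurable_fun_ler => //.
  exact: (measurable_euler mb (fun _ _ => lam_bnd _) eta0).
have Zlaw y : P [set w | Z i w <= y] = P [set w | Z j w <= y].
  have h l : [set w | Z l w <= y] = Z l @^-1` `]-oo, y]%classic.
    by apply/seteqP; split => w /=; rewrite in_itv.
  by rewrite !h; apply: (euler_same_law mb (fun _ _ => lam_bnd _) eta0).
have ae_le (A C D : set Omega) : measurable A -> measurable C -> measurable D ->
    {ae P, forall w, A w -> C w \/ D w} -> (P A <= P C + P D)%E.
  move=> mA mC mD [N [mN N0 sub]].
  apply: (@le_trans _ _ (P ((C `|` D) `|` N))).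
    rewrite le_measure ?inE//; first by do 2?apply: measurableU.
    move=> w Aw; have [|nNw] := pselect (N w); first by right.
    by left; apply: contrapT => h; apply/nNw/sub => /= /(_ Aw).
  have mCD : measurable (C `|` D) by exact: measurableU.
  apply: (le_trans (measureU2 P mCD mN)).
  rewrite [X in (_ + X)%E](_ : _ = 0%E)// adde0.
  exact: measureU2.
pose u := expR (k * Num.sqrt t).
have u0 : 0 < u by exact: expR_gt0.
have EB1 : 0 <= euler_bound M e.
  by rewrite addr_ge0 ?(ltW e0)// divr_ge0 ?(ltW k0)// !mulr_ge0 ?(ltW L0).
pose y1 := x + euler_bound M e * u.
pose y2 := y1 + e * u.
have step1 : (P [set w | (X1 t w <= x)%R] <= P [set w | (Z i w <= y1)%R] + P (~` G1))%E.
  apply: ae_le => //; [exact: measurable_rv_le|exact: measurableC|].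
  apply: filterS2 (mckean_start mX1) (mckean_increment L0 lam_lip lam_bnd mX1).
  move=> w X10 X1w X1x; have [G1w|] := pselect (G1 w); [left|by right].
  have := @euler_error n X1 X2 i M e cX1 cX2 isT M0 (ltW e0) lip2 close w
    X10 X1w (G1P w G1w) n (leqnn _).
  rewrite -/eta neta -/b -/(Z i w) -/u => err.
  have : euler_bound M e * (u - 1) <= euler_bound M e * u.
    by rewrite ler_wpM2l// gerBl.
  move: err; rewrite ler_norml => /andP[err _] /= h; rewrite /y1.
  by move: X1x => /= X1x; lra.
have step2 : (P [set w | (Z j w <= y1)%R] <= P [set w | (X2 t w <= y2)%R] + P (~` G2))%E.
  apply: ae_le => //; [exact: measurable_rv_le|exact: measurableC|].
  apply: filterS2 (mckean_start mX2) (mckean_increment L0 lam_lip lam_bnd mX2).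
  move=> w X20 X2w Zy; have [G2w|] := pselect (G2 w); [left|by right].
  (* [X2] is compared with the scheme for its own law: the distance of the laws is 0 and only [e]
     remains. *)
  have close0 s z : 0 < s -> s <= t ->
      `|path_cdf X2 s z - path_cdf X2 s z| <= 0 * sqrt_kernel k s.
    by rewrite subrr normr0 mul0r.
  have := @euler_error n X2 X2 j 0 e cX2 cX2 isT (lexx _) (ltW e0) lip2 close0 w
    X20 X2w (G2P w G2w) n (leqnn _).
  rewrite -/eta neta -/b -/(Z j w) -/u => err.
  have EB2 : euler_bound 0 e = e by rewrite /euler_bound mulr0 mul0r add0r.
  have : e * (u - 1) <= e * u by rewrite ler_wpM2l ?gerBl// ltW.
  move: err; rewrite EB2 ler_norml => /andP[_ err] /= h; rewrite /y2.
  by move: Zy => /= Zy; lra.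
have main : path_cdf X1 t x <= path_cdf X2 t y2 + 2 * e.
  rewrite -lee_fin EFinD /path_cdf (max_r (ltW t0)) !EFin_cdfr.
  apply: (le_trans step1); rewrite Zlaw.
  apply: (@le_trans _ _ (P [set w | (X2 t w <= y2)%R] + P (~` G2) + P (~` G1))%E).
    by rewrite leeD2r.
  rewrite -addeA leeD2l// (_ : 2 * e = e + e); last by ring.
  by rewrite EFinD leeD.
have lipy : path_cdf X2 t y2 <= path_cdf X2 t x + c / Num.sqrt t * (y2 - x).
  have := lip2 y2 x t0 (lexx _).
  have y2x : 0 <= y2 - x.
    have -> : y2 - x = euler_bound M e * u + e * u by rewrite /y2 /y1; ring.
    by rewrite addr_ge0// mulr_ge0// ltW.
  rewrite (ger0_norm y2x) => h.
  by rewrite -lerBlDl (le_trans (ler_norm _) h).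
apply: (le_trans main); apply: (le_trans (lerD lipy (lexx _))).
have sq0 : Num.sqrt t != 0 by rewrite gt_eqF// sqrtr_gt0.
have er : e * (2 * (c * sqrt_kernel k t) + 2) = r by rewrite /e divfK// gt_eqF.
have -> : c / Num.sqrt t * (y2 - x) =
    4 * (L * c) * M / k * sqrt_kernel k t + e * (2 * (c * sqrt_kernel k t)).
  rewrite /y2 /y1 /euler_bound /sqrt_kernel -/u; field.
  by rewrite sq0 gt_eqF.
by rewrite -er le_eqVlt; apply/orP; left; apply/eqP; ring.
Qed.

End one_sided.
End comparison.

(** With [k = 8 * (L * c)] the factor [4 * (L * c) / k] is 1/2, so the distance of the laws,
    weighted by [sqrt_kernel], is at most half of itself, hence zero. *)
Lemma mckean_cdf_unique i j X1 X2 (s x : R) :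
  mckean_process X0 W sigma lam i X1 -> mckean_process X0 W sigma lam j X2 ->
  0 < s -> path_cdf X1 s x = path_cdf X2 s x.
Proof.
move=> mX1 mX2 s0; set T := s.
have [c c0 lip] := mckean_cdf_lipschitz inputs sigma0 L0 B0 lam_lip lam_bnd s0.
pose k := 8 * (L * c); have k0 : 0 < k by rewrite !mulr_gt0.
have ck : 4 * (L * c) <= k by rewrite /k ler_pM2r ?mulr_gt0//; lra.
pose I := {z : R * R | 0 < z.1 /\ z.1 <= T}.
pose f (z : I) := `|path_cdf X1 (sval z).1 (sval z).2 - path_cdf X2 (sval z).1 (sval z).2| /
  sqrt_kernel k (sval z).1.
have ker_gt0 u : 0 < u -> 0 < sqrt_kernel k u.
  by move=> u0; rewrite divr_gt0 ?expR_gt0// sqrtr_gt0.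
have H : forall z, f z <= 2 * 0.
  apply: (@halving_bound _ _ f 0 (Num.sqrt T)) => //.
    move=> [[u y] /= [u0 uT]]; rewrite /f/= ler_pdivrMr ?ker_gt0//.
    apply: (@le_trans _ _ 1).
      have h1 := cdfr_ge0 (X1 (Num.max 0 u)) y; have h2 := cdfr_le1 (X1 (Num.max 0 u)) y.
      have h3 := cdfr_ge0 (X2 (Num.max 0 u)) y; have h4 := cdfr_le1 (X2 (Num.max 0 u)) y.
      by rewrite ler_norml /path_cdf; lra.
    rewrite /sqrt_kernel mulrCA -[leLHS]mul1r.
    apply: ler_pM => //; last by rewrite ler_pdivlMr ?sqrtr_gt0// mul1r ler_wsqrtr.
    by rewrite -[leLHS]expR0 ler_expR mulr_ge0 ?sqrtr_ge0// ltW.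
  move=> M M0 fM [[u y] /= [u0 uT]]; rewrite /f/= add0r ler_pdivrMr ?ker_gt0//.
  have close r z : 0 < r -> r <= u ->
      `|path_cdf X1 r z - path_cdf X2 r z| <= M * sqrt_kernel k r.
    move=> r0 ru; have rz : 0 < (r, z).1 /\ (r, z).1 <= T.
      by split => //=; exact: le_trans uT.
    by have := fM (exist _ (r, z) rz); rewrite /f/= ler_pdivrMr ?ker_gt0.
  have close' r z : 0 < r -> r <= u ->
      `|path_cdf X2 r z - path_cdf X1 r z| <= M * sqrt_kernel k r.
    by rewrite distrC; exact: close.
  have lip1 r z z' : 0 < r -> r <= u -> `|path_cdf X1 r z - path_cdf X1 r z'| <=
      c / Num.sqrt r * `|z - z'|.
    by move=> r0 ru; apply: (lip _ _ mX1) => //; exact: le_trans uT.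
  have lip2 r z z' : 0 < r -> r <= u -> `|path_cdf X2 r z - path_cdf X2 r z'| <=
      c / Num.sqrt r * `|z - z'|.
    by move=> r0 ru; apply: (lip _ _ mX2) => //; exact: le_trans uT.
  have h1 := path_cdf_comparison_le c0 k0 u0 ck mX1 mX2 M0 lip2 close y.
  have h2 := path_cdf_comparison_le c0 k0 u0 ck mX2 mX1 M0 lip1 close' y.
  have kM : 4 * (L * c) * M / k = M / 2.
    by rewrite /k; field; rewrite !gt_eqF.
  by move: h1 h2; rewrite kM ler_norml; lra.
have Ts : 0 < (s, x).1 /\ (s, x).1 <= T by [].
have := H (exist _ (s, x) Ts); rewrite /f/= mulr0 ler_pdivrMr ?ker_gt0// mul0r.
by rewrite normr_le0 subr_eq0 => /eqP.
Qed.

End uniqueness_in_law.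

(** * Moments of the empirical distribution function *)

Section binomial_moments.
Context d (Omega : measurableType d) (R : realType) (P : probability Omega R).
Variables (A : nat -> set Omega) (p : R).
Hypothesis mA : forall i, measurable (A i).
Hypothesis PA : forall s : seq nat, uniq s ->
  P (\big[setI/setT]_(i <- s) A i) = (p ^+ size s)%:E.

(** For [c = expR x - 1] this is the exponential of [x] times the number of events in [s] that
    occur. *)
Let factor (c : R) s w : R := \prod_(i <- s) (1 + c * \1_(A i) w).

Lemma measurable_factor c s : measurable_fun setT (factor c s).
Proof.
elim: s => [|i s IH]; rewrite /factor.
  by rewrite (_ : (fun w => _) = cst 1)//; apply/funext => w; rewrite big_nil.
rewrite (_ : (fun w => _) = (fun w => (1 + c * \1_(A i) w) * factor c s w)); last first.
  by apply/funext => w; rewrite big_cons.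
apply: measurable_funM => //; apply: measurable_funD => //.
by apply: measurable_funM => //; exact: measurable_indic.
Qed.

Lemma factor_bound c s w : `|factor c s w| <= (1 + `|c|) ^+ size s.
Proof.
elim: s => [|i s IH]; rewrite /factor ?big_nil ?normr1// big_cons exprS normrM.
apply: ler_pM => //; apply: (le_trans (ler_normD _ _)); rewrite normr1 lerD2l.
by rewrite normrM ler_piMr// indicE; case: (_ \in _); rewrite ?normr1 ?normr0.
Qed.

Lemma integrable_factor c s B : measurable B ->
  P.-integrable setT (EFin \o (fun w => factor c s w * \1_B w)).
Proof.
move=> mB; apply: measurable_bounded_integrable => //.
- by rewrite [ltLHS]probability_setT ltry.
- by apply: measurable_funM; [exact: measurable_factor|exact: measurable_indic].
- exists ((1 + `|c|) ^+ size s); split; first exact: num_real.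
  move=> M sM w _; apply: le_trans (ltW sM); rewrite normrM.
  apply: le_trans (factor_bound c s w); rewrite ler_piMr// indicE.
  by case: (_ \in _); rewrite ?normr1 ?normr0.
Qed.

(** Expanding the first factor moves its index from [s] to [r]; the indicator is carried along so
    that the induction closes. *)
Lemma integral_factor_indic c s r : uniq (s ++ r) ->
  \int[P]_w (factor c s w * \1_(\big[setI/setT]_(i <- r) A i) w) =
  (1 + c * p) ^+ size s * p ^+ size r.
Proof.
have mI r' : measurable (\big[setI/setT]_(i <- r') A i) by exact: measurable_bigsetI.
elim: s r => [|i s IH] r /= u.
  under eq_Rintegral do rewrite /factor big_nil mul1r.
  by rewrite /Rintegral integral_indic// setIT [X in fine X](PA u) mul1r.
have /andP[ir usr] := u.
have uir : uniq (s ++ i :: r) by rewrite -cat_rcons -cats1 -catA; rewrite uniq_catCA.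
have stepE w : factor c (i :: s) w * \1_(\big[setI/setT]_(i <- r) A i) w =
    factor c s w * \1_(\big[setI/setT]_(i <- r) A i) w +
    c * (factor c s w * \1_(\big[setI/setT]_(i <- i :: r) A i) w).
  by rewrite /factor !big_cons indicI/=; ring.
under eq_Rintegral do rewrite stepE.
rewrite RintegralD//; first last.
- exact: (integrableZl _ c (integrable_factor c s (mI (i :: r)))).
- exact: integrable_factor.
rewrite RintegralZl//; last exact: integrable_factor.
by rewrite !IH//= !exprS; ring.
Qed.

Lemma expR_le_quadratic (x : R) : `|x| <= 1 / 2 -> expR x <= 1 + x + 2 * x ^+ 2.
Proof.
rewrite ler_norml => /andP[x1 x2].
have := expR_ge1Dx (- x); rewrite expRN => h.
have x0 : 0 < 1 - x by lra.
have e0 := expR_gt0 x.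
have : expR x <= (1 - x)^-1 by rewrite -[leLHS]invrK lef_pV2 ?posrE ?invr_gt0.
move=> /le_trans; apply; rewrite -[leLHS]mul1r ler_pdivrMr//.
have : 0 <= x ^+ 2 * (1 - 2 * x) by rewrite mulr_ge0 ?sqr_ge0//; lra.
lra.
Qed.

Let dev s w : R := \sum_(i <- s) (\1_(A i) w - p).

Lemma measurable_deviation s : measurable_fun setT (dev s).
Proof.
elim: s => [|i s IH]; rewrite /dev.
  by rewrite (_ : (fun w => _) = cst 0)//; apply/funext => w; rewrite big_nil.
rewrite (_ : (fun w => _) = (fun w => (\1_(A i) w - p) + dev s w)); last first.
  by apply/funext => w; rewrite big_cons.
by apply: measurable_funD => //; apply: measurable_funB.
Qed.

(** Independence turns the left side into [(expR (- (x * p)) * (1 + c * p)) ^+ size s] with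
    [c = expR x - 1]; then [1 + c * p <= expR (c * p)] and [c - x <= 2 * x ^+ 2]. *)
Lemma exponential_moment s (x : R) : uniq s -> 0 <= p -> p <= 1 -> `|x| <= 1 / 2 ->
  (\int[P]_w (expR (x * dev s w))%:E <= (expR (2 * (size s)%:R * p * x ^+ 2))%:E)%E.
Proof.
move=> us p0 p1 x2.
pose c := expR x - 1.
have devE w : expR (x * dev s w) = expR (- (x * p)) ^+ size s *
    (factor c s w * \1_(\big[setI/setT]_(i <- [::]) A i) w).
  rewrite big_nil indicT mulr1 /dev /factor.
  elim: s {us} => [|i s IH]; first by rewrite !big_nil mulr0 expR0 mulr1.
  rewrite !big_cons mulrDr expRD IH /= exprS.
  have -> : expR (x * (\1_(A i) w - p)) = expR (- (x * p)) * (1 + c * \1_(A i) w).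
    rewrite indicE; case: (_ \in _) => /=.
      rewrite /c mulr1 [1 + _]addrC subrK -expRD; congr expR; ring.
    by rewrite mulr0 addr0 mulr1 sub0r mulrN.
  by ring.
have e0 := expR_ge0 (- (x * p)).
have intdev : P.-integrable setT
    (EFin \o (fun w => factor c s w * \1_(\big[setI/setT]_(i <- [::]) A i) w)).
  by apply: integrable_factor; rewrite big_nil.
have -> : (\int[P]_w (expR (x * dev s w))%:E)%E =
    (\int[P]_w expR (x * dev s w))%:E.
  rewrite /Rintegral fineK//; apply: integrable_fin_num => //.
  apply: eq_integrable (integrableZl _ (expR (- (x * p)) ^+ size s) intdev) => //.
  by move=> w _; rewrite /= devE EFinM.
under eq_Rintegral do rewrite devE.
rewrite RintegralZl// integral_factor_indic ?cats0//= expr0 mulr1 -exprMn.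
rewrite lee_fin.
have c1 : 0 <= 1 + c * p.
  have -> : 1 + c * p = 1 - p + expR x * p by rewrite /c; ring.
  by rewrite addr_ge0 ?subr_ge0// mulr_ge0// expR_ge0.
have -> : 2 * (size s)%:R * p * x ^+ 2 = (size s)%:R * (2 * p * x ^+ 2) by ring.
rewrite expRM_natl; apply: lerXn2r; rewrite ?nnegrE ?expR_ge0 ?mulr_ge0//.
apply: (@le_trans _ _ (expR (- (x * p)) * expR (c * p))).
  by rewrite ler_wpM2l// expR_ge1Dx.
rewrite -expRD ler_expR.
have : c <= x + 2 * x ^+ 2 by have := expR_le_quadratic x2; rewrite /c; lra.
move=> /(ler_wpM2r p0); rewrite mulrDl; lra.
Qed.

Lemma exprn_le_expR (y : R) n : 0 <= y -> y ^+ n <= n`!%:R * expR y.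
Proof.
move=> y0; case: n => [|n]; first by rewrite mul1r -[leLHS]expR0 ler_expR.
have f0 : 0 < (n.+1)`!%:R :> R by rewrite ltr0n fact_gt0.
rewrite mulrC -ler_pdivrMr//; apply: le_trans (expR_ge1Dxn n y0).
by rewrite lerDr.
Qed.

(** The 4 is [2 + 2], one bound for each sign in the exponential moment; the factorial comes from
    [exprn_le_expR], and [4 ^+ q] from the scale [x] in [even_moment]. *)
Definition moment_constant (q : nat) : R := 4 * (2 * q)`!%:R * 4 ^+ q.

Lemma even_moment s q : uniq s -> 0 <= p -> p <= 1 -> 1 <= (size s)%:R * p ->
  (\int[P]_w (dev s w ^+ (2 * q))%:E <=
   (moment_constant q * ((size s)%:R * p) ^+ q)%:E)%E.
Proof.
move=> us p0 p1 Np; set Np' := (size s)%:R * p in Np *.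
have Np0 : 0 < Np' by exact: lt_le_trans Np.
have sN0 : 0 < Num.sqrt Np' by rewrite sqrtr_gt0.
have sN1 : 1 <= Num.sqrt Np' by rewrite -[leLHS]sqrtr1 ler_wsqrtr.
(* Scaled so that the exponent in [exponential_moment] is 1/2; an expected number of events of at
   least 1 keeps [x <= 1 / 2]. *)
pose x := (2 * Num.sqrt Np')^-1.
have x0 : 0 < x by rewrite invr_gt0 mulr_gt0.
have x2 : `|x| <= 1 / 2.
  by rewrite gtr0_norm// /x invfM mul1r ler_piMr ?invr_ge0// invf_le1.
have xN2 : `|- x| <= 1 / 2 by rewrite normrN.
have xx : 2 * (size s)%:R * p * x ^+ 2 = 1 / 2.
  have -> : x ^+ 2 = (4 * Np')^-1.
    by rewrite /x exprVn exprMn sqr_sqrtr ?(ltW Np0)//; congr (_^-1); ring.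
  have -> : 2 * (size s)%:R * p = 2 * Np' by rewrite /Np'; ring.
  by field; rewrite gt_eqF.
have e2 : expR (1 / 2) <= 2 :> R.
  have h : `|1 / 2| <= 1 / 2 :> R by rewrite ger0_norm.
  by apply: (le_trans (expR_le_quadratic h)); lra.
pose K : R := (2 * q)`!%:R * (4 * Np') ^+ q.
have K0 : 0 <= K by rewrite mulr_ge0// exprn_ge0// mulr_ge0// ltW.
have mdev c : measurable_fun setT (fun w => (expR (c * dev s w))%:E).
  apply/measurable_EFinP; apply: measurableT_comp => //.
  by apply: measurable_funM => //; exact: measurable_deviation.
apply: (@le_trans _ _ (\int[P]_w (K%:E * ((expR (x * dev s w))%:E +
    (expR (- x * dev s w))%:E)))%E).
  apply: ge0_le_integral => //.
  - by move=> w _; rewrite lee_fin exprM exprn_ge0// sqr_ge0.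
  - apply/measurable_EFinP; apply: measurable_funX; exact: measurable_deviation.
  - by apply: emeasurable_funM => //; apply: emeasurable_funD; exact: mdev.
  - move=> w _; rewrite -EFinD -EFinM lee_fin.
    set D := dev s w.
    have -> : D ^+ (2 * q) = `|D| ^+ (2 * q).
      by rewrite !exprM real_normK// num_real.
    have -> : `|D| = (x * `|D|) / x by rewrite mulrC mulKf// gt_eqF.
    have y0 : 0 <= x * `|D| by rewrite mulr_ge0// ltW.
    rewrite exprMn.
    have -> : x^-1 ^+ (2 * q) = (4 * Np') ^+ q.
      rewrite exprM; congr (_ ^+ _).
      by rewrite /x invrK exprMn sqr_sqrtr ?(ltW Np0)//; ring.
    have := exprn_le_expR (2 * q) y0 => h.
    have h4 : 0 <= (4 * Np') ^+ q by rewrite exprn_ge0// mulr_ge0// ltW.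
    apply: (le_trans (ler_wpM2r h4 h)).
    rewrite mulrAC -/K ler_wpM2l// mulNr.
    have a1 := expR_ge0 (x * D); have a2 := expR_ge0 (- (x * D)).
    by have [D0|D0] := ler0P D; rewrite ?mulrN; lra.
rewrite ge0_integralZl//; last first.
- by move=> w _; rewrite -EFinD lee_fin addr_ge0 ?expR_ge0.
- by apply: emeasurable_funD; exact: mdev.
rewrite ge0_integralD//; try by move=> w _; rewrite lee_fin expR_ge0.
have m1 := exponential_moment us p0 p1 x2.
have := exponential_moment us p0 p1 xN2; rewrite sqrrN xx => m2.
rewrite xx in m1.
have -> : moment_constant q * Np' ^+ q = K * (2 + 2).
  rewrite /K /moment_constant (exprMn q 4 Np').
  by move: (_`!%:R) (4 ^+ q) (Np' ^+ q) => F4 F5 F6; ring.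
have -> : (K * (2 + 2))%:E = (K%:E * (2%:E + 2%:E))%E by [].
apply: lee_wpmul2l; rewrite ?lee_fin//; apply: leeD.
  by apply: (le_trans m1); rewrite lee_fin.
by apply: (le_trans m2); rewrite lee_fin.
Qed.

End binomial_moments.

(** * Probability integral transform *)

Section probability_integral_transform.
Context d (Omega : measurableType d) (R : realType) (P : probability Omega R).

Lemma cdfr_surj (Y : {RV P >-> R}) (u : R) : continuous (cdfr Y) ->
  0 < u -> u < 1 -> exists y, cdfr Y y = u.
Proof.
move=> cY u0 u1.
have [a Fa] : exists a, cdfr Y a < u.
  have /fine_cvgP[_ /cvgrPdist_lt /(_ _ u0)] := cvg_cdfNy0 Y.
  move=> [a [_ aP]]; exists (a - 1).
  have := aP (a - 1); rewrite ltrBlDr ltrDl ltr01 => /(_ isT) /=.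
  by rewrite sub0r normrN => /(le_lt_trans (ler_norm _)).
have [b Fb] : exists b, u < cdfr Y b.
  have u1' : 0 < 1 - u by rewrite subr_gt0.
  have /fine_cvgP[_ /cvgrPdist_lt /(_ _ u1')] := cvg_cdfy1 Y.
  move=> [b [_ bP]]; exists (b + 1).
  have := bP (b + 1); rewrite ltrDl ltr01 => /(_ isT) /=.
  move=> /(le_lt_trans (ler_norm _)).
  by rewrite ltrBlDl -ltrBlDr subKr.
have ab : a <= b.
  rewrite leNgt; apply/negP => ba.
  by have := le_lt_trans (cdfr_nd Y (ltW ba)) Fa; rewrite ltNge ltW.
have [||c _ Fc] := @IVT R (cdfr Y) a b u ab.
- by apply: continuous_subspaceT => x; exact: cY.
- by rewrite ge_min le_max (ltW Fa) (ltW Fb) orbT.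
by exists c.
Qed.

Lemma measurable_cdfr_comp (Y : {RV P >-> R}) : continuous (cdfr Y) ->
  measurable_fun setT (cdfr Y \o Y).
Proof.
by move=> cY; apply: measurableT_comp => //; exact: continuous_measurable_fun.
Qed.

Lemma measurable_rv_lt (Y : Omega -> R) (u : R) : measurable_fun setT Y ->
  measurable [set w | Y w < u].
Proof.
by move=> mY; rewrite -[X in measurable X]setTI; exact: measurable_fun_ltr.
Qed.

(** The distribution function may have flat pieces, so no inverse is used: [cdfr_surj] gives some
    preimage of each level of the open interval. The level [u] itself gives the upper bound, the
    levels [v < u] the lower one. *)
Lemma cdfr_uniform (Y : {RV P >-> R}) (u : R) : continuous (cdfr Y) ->
  0 <= u -> u <= 1 -> P [set w | cdfr Y (Y w) < u] = u%:E.
Proof.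
move=> cY u0 u1; have mU := measurable_rv_lt u (measurable_cdfr_comp cY).
have lb v : 0 < v -> v < u -> (v%:E <= P [set w | (cdfr Y (Y w) < u)%R])%E.
  move=> v0 vu; have [y Fy] := cdfr_surj cY v0 (lt_le_trans vu u1).
  rewrite -Fy EFin_cdfr le_measure ?inE//; first exact: measurable_rv_le.
  by move=> w /= Yy; apply: le_lt_trans vu; rewrite -Fy cdfr_nd.
have fP : P [set w | cdfr Y (Y w) < u] \is a fin_num by exact: fin_num_measure.
apply/eqP; rewrite eq_le; apply/andP; split.
  have [u00|u0'] := eqVneq u 0.
    rewrite u00 [X in P X](_ : _ = set0) ?measure0//.
    by apply/seteqP; split => // w /=; rewrite ltNge cdfr_ge0.
  have [u11|u1'] := eqVneq u 1; first by apply: (le_trans (probability_le1 P mU)); rewrite u11.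
  have [y Fy] : exists y, cdfr Y y = u.
    by apply: cdfr_surj => //; rewrite lt_neqAle ?u1' 1?eq_sym ?u0'.
  rewrite -[leRHS]/(u%:E) -{2}Fy EFin_cdfr le_measure ?inE//.
    exact: measurable_rv_le.
  move=> w /= FYu; rewrite leNgt; apply/negP => yY.
  by have := cdfr_nd Y (ltW yY); rewrite Fy leNgt FYu.
rewrite -(fineK fP) lee_fin.
apply/ler_addgt0Pl => e e0.
have [ue|ue] := leP u e.
  by apply: (le_trans ue); rewrite lerDl fine_ge0.
have v0 : 0 < u - e by rewrite subr_gt0.
have vu : u - e < u by rewrite ltrBlDr ltrDl.
by have := lb _ v0 vu; rewrite -(fineK fP) lee_fin lerBlDl.
Qed.

End probability_integral_transform.

(** * Dyadic chaining for the empirical distribution function *)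

Section dyadic_chaining.
Context {R : realType}.
Variables (N : nat) (u : nat -> R).
Implicit Types (l k j q : nat).

Definition dyadic l k : R := k%:R / 2 ^+ l.

Definition dyadic_count l k : R := \sum_(j <- iota 0 N) (u j < dyadic l k)%R%:R.

Definition dyadic_dev l k : R := dyadic_count l k - N%:R * dyadic l k.

Definition dyadic_incr l k : R :=
  \sum_(j <- iota 0 N) ((dyadic l k <= u j < dyadic l k.+1)%R%:R - (2 ^+ l)^-1).

Lemma dyadic_double l k : dyadic l.+1 k.*2 = dyadic l k.
Proof.
rewrite /dyadic -muln2 natrM exprS.
by field; rewrite expf_neq0.
Qed.

Lemma dyadic_incrE l k : dyadic_dev l k.+1 = dyadic_dev l k + dyadic_incr l k.
Proof.
have dk : dyadic l k <= dyadic l k.+1.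
  by rewrite /dyadic ler_wpM2r ?invr_ge0 ?exprn_ge0// ler_nat.
rewrite /dyadic_dev /dyadic_incr big_split/= sumrN big_const_seq.
rewrite count_predT size_iota iter_addr_0.
have -> : dyadic_count l k.+1 = dyadic_count l k +
    \sum_(j <- iota 0 N) (dyadic l k <= u j < dyadic l k.+1)%R%:R.
  rewrite /dyadic_count -big_split/=; apply: eq_bigr => j _.
  have [ujk|kuj] := ltP (u j) (dyadic l k).
    by rewrite (lt_le_trans ujk dk) addr0.
  by rewrite add0r.
have -> : dyadic l k.+1 = dyadic l k + (2 ^+ l)^-1.
  by rewrite /dyadic -natr1 mulrDl mul1r.
rewrite -mulr_natl; ring.
Qed.

Variables (V : R) (Lm : nat).
Hypothesis u0 : forall j, 0 <= u j.
Hypothesis V0 : 0 <= V.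
Hypothesis incrV : forall l k, (l <= Lm)%N -> (k < 2 ^ l)%N ->
  `|dyadic_incr l k| <= V * (9 / 10) ^+ l.

(** An even index already occurs at the coarser level, and an odd one is a single cell past an even
    one: each level contributes at most one increment. *)
Lemma dyadic_dev_bound l k : (l <= Lm)%N -> (k <= 2 ^ l)%N ->
  `|dyadic_dev l k| <= 10 * V.
Proof.
have dev0 l' : dyadic_dev l' 0 = 0.
  rewrite /dyadic_dev /dyadic_count /dyadic mul0r mulr0 subr0 big1// => j _.
  by rewrite ltNge u0.
(* [10 * (1 - (9 / 10) ^+ l.+1)] is the partial sum of the geometric series of ratio 9/10 up to
   level [l]. *)
move=> lL kl; apply: (@le_trans _ _ (10 * V * (1 - (9 / 10) ^+ l.+1))); last first.
  by rewrite ler_piMr ?mulr_ge0// gerBl exprn_ge0// divr_ge0.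
elim: l k lL kl => [|l IH] k lL.
  rewrite expn0 leq_eqVlt ltnS leqn0 => /orP[/eqP->|/eqP->].
    rewrite dyadic_incrE dev0 add0r; apply: (le_trans (incrV _ _)) => //.
    by rewrite expr0 expr1 mulr1; have := V0; lra.
  rewrite dev0 normr0 mulr_ge0 ?mulr_ge0// expr1; lra.
have V9 : 0 <= V * (9 / 10) ^+ l.+1 by rewrite mulr_ge0// exprn_ge0// divr_ge0.
rewrite expnS mul2n => kl; have := odd_double_half k.
case: (odd k) => /= [kE|kE]; rewrite -{}kE in kl *.
  have kl' : (k./2 < 2 ^ l)%N by rewrite -ltn_double; exact: kl.
  rewrite add1n dyadic_incrE; apply: (le_trans (ler_normD _ _)).
  have -> : dyadic_dev l.+1 k./2.*2 = dyadic_dev l k./2.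
    rewrite /dyadic_dev /dyadic_count dyadic_double; congr (_ - _).
  apply: (le_trans (lerD (IH _ (ltnW lL) (ltnW kl')) (incrV lL _))).
    by rewrite expnS mul2n ltn_double.
  rewrite (exprS _ l.+1); lra.
rewrite add0n leq_double in kl *.
have -> : dyadic_dev l.+1 k./2.*2 = dyadic_dev l k./2.
  rewrite /dyadic_dev /dyadic_count dyadic_double; congr (_ - _).
apply: (le_trans (IH _ (ltnW lL) kl)); rewrite (exprS _ l.+1); lra.
Qed.

End dyadic_chaining.

Section empirical_distribution.
Context {R : realType}.
Variables (N L : nat) (x : nat -> R) (F : R -> R) (D : R).
Hypothesis Fnd : forall y z, y <= z -> F y <= F z.
Hypothesis F01 : forall y, F y \in `[0, 1]%R.
Hypothesis D0 : 0 <= D.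
Hypothesis devD : forall k, (k <= 2 ^ L)%N -> `|dyadic_dev N (F \o x) L k| <= D.

Let F0 y : 0 <= F y. Proof. by have := F01 y; rewrite in_itv/= => /andP[]. Qed.
Let F1 y : F y <= 1. Proof. by have := F01 y; rewrite in_itv/= => /andP[]. Qed.
Let pL : 0 < 2 ^+ L :> R. Proof. by rewrite exprn_gt0. Qed.

Let sum_le (A B : nat -> bool) : (forall j, A j -> B j) ->
  \sum_(j <- iota 0 N) (A j)%:R <= \sum_(j <- iota 0 N) (B j)%:R :> R.
Proof.
move=> AB; apply: ler_sum => j _; rewrite ler_nat.
by case: (A j) (AB j) => // ->.
Qed.

(** [F y] is rounded up to the next dyadic point, which costs [N / 2 ^+ L]. Rounding past 1 happens
    only if [F y = 1], where the trivial bound [N] suffices. *)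
Lemma empirical_le y : \sum_(j <- iota 0 N) (x j <= y)%R%:R <=
  N%:R * F y + D + N%:R / 2 ^+ L.
Proof.
have Fy0 : 0 <= F y * 2 ^+ L by rewrite mulr_ge0// ltW.
have /andP[t1 t2] := truncn_itv Fy0.
set k := (Num.truncn (F y * 2 ^+ L)).+1.
have [kL|Lk] := leqP k (2 ^ L).
  apply: (@le_trans _ _ (dyadic_count N (F \o x) L k)).
    apply: sum_le => j xy; rewrite (le_lt_trans (Fnd xy))//.
    by rewrite /dyadic ltr_pdivlMr.
  have := devD kL; rewrite ler_norml /dyadic_dev => /andP[_].
  rewrite lerBlDr => /le_trans; apply; rewrite addrC -!addrA.
  have -> : N%:R * F y + (D + N%:R / 2 ^+ L) = N%:R * (F y + 1 / 2 ^+ L) + D by ring.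
  rewrite lerD2r; apply: ler_wpM2l => //.
  rewrite /dyadic /k -natr1 mulrDl lerD2r ler_pdivrMr//.
have Fy1 : F y = 1.
  apply/eqP; rewrite eq_le F1/=.
  rewrite -(ler_pM2r pL) mul1r; apply: le_trans t1.
  have Lk' : (2 ^ L <= Num.truncn (F y * 2 ^+ L))%N := Lk.
  by move: Lk'; rewrite -(ler_nat R) natrX.
have NL : 0 <= N%:R / 2 ^+ L :> R by rewrite divr_ge0// ltW.
rewrite Fy1 mulr1 -addrA; apply: (@le_trans _ _ N%:R); last by rewrite lerDl addr_ge0.
apply: (@le_trans _ _ (\sum_(j <- iota 0 N) 1)).
  by apply: ler_sum => j _; rewrite lern1 leq_b1.
by rewrite big_const_seq count_predT size_iota iter_addr_0.
Qed.

Lemma empirical_ge y : N%:R * F y - D - N%:R / 2 ^+ L <=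
  \sum_(j <- iota 0 N) (x j <= y)%R%:R.
Proof.
have Fy0 : 0 <= F y * 2 ^+ L by rewrite mulr_ge0// ltW.
have /andP[t1 t2] := truncn_itv Fy0.
set k := Num.truncn (F y * 2 ^+ L) in t1 t2.
have kL : (k <= 2 ^ L)%N.
  rewrite -(ler_nat R) natrX; apply: (le_trans t1).
  by rewrite -[leRHS]mul1r ler_pM2r.
apply: (@le_trans _ _ (dyadic_count N (F \o x) L k)); last first.
  apply: sum_le => j; rewrite /dyadic ltr_pdivlMr//= => h.
  rewrite leNgt; apply/negP => yx.
  have := lt_le_trans h t1; rewrite ltr_pM2r// ltNge Fnd//; exact: ltW.
have := devD kL; rewrite ler_norml /dyadic_dev => /andP[+ _].
rewrite lerBrDr => /(le_trans _); apply.
have -> : N%:R * F y - D - N%:R / 2 ^+ L = - D + N%:R * (F y - 1 / 2 ^+ L) by ring.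
rewrite lerD2l; apply: ler_wpM2l => //.
rewrite lerBlDr /dyadic -mulrDl natr1 ler_pdivlMr// ltW//.
Qed.

End empirical_distribution.

Section chaining_moment.
Context {R : realType}.
Variables (q Lm N : nat).
Hypothesis q2 : (1 < q)%N.

(* Increments at level l have variance at most N / 2^l. The ratio 9/10 makes both
   the chain, \sum_l (9/10)^l, and, for q >= 2, the sum over l of the 2^l moments
   of order 2q, 2^l (2^l)^-q (9/10)^(-2ql), converge geometrically. *)
Definition chain_sum (u : nat -> R) : R :=
  \sum_(l < Lm.+1) \sum_(k < 2 ^ l)
    (dyadic_incr N u l k / (9 / 10) ^+ l) ^+ (2 * q).

(** A norm of order [2 * q] of the rescaled increments instead of their maximum: it dominates each
    of them, and its power of order [2 * q] is a sum, whose expectation is bounded term by term. *)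
Definition chain_sup (u : nat -> R) : R := chain_sum u `^ (2 * q)%:R^-1.

Let term_ge0 (a : R) : 0 <= a ^+ (2 * q).
Proof. by rewrite exprM exprn_ge0// sqr_ge0. Qed.

Lemma chain_sum_ge0 u : 0 <= chain_sum u.
Proof. by apply: sumr_ge0 => l _; apply: sumr_ge0. Qed.

Lemma chain_sup_ge0 u : 0 <= chain_sup u.
Proof. exact: powR_ge0. Qed.

Lemma chain_supX u : chain_sup u ^+ (2 * q) = chain_sum u.
Proof.
rewrite -powR_mulrn ?chain_sup_ge0// /chain_sup -powRrM mulVf ?powRr1 ?chain_sum_ge0//.
by rewrite pnatr_eq0 muln_eq0 negb_or/= -lt0n ltnW.
Qed.

Lemma dyadic_incr_chain_sup u (l k : nat) : (l <= Lm)%N -> (k < 2 ^ l)%N ->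
  `|dyadic_incr N u l k| <= chain_sup u * (9 / 10) ^+ l.
Proof.
move=> lL kl; have p0 : 0 < (9 / 10) ^+ l :> R by rewrite exprn_gt0// divr_gt0.
rewrite -ler_pdivrMr//.
have -> : `|dyadic_incr N u l k| / (9 / 10) ^+ l = `|dyadic_incr N u l k / (9 / 10) ^+ l|.
  by rewrite normrM normfV (gtr0_norm p0).
have q20 : (0 < 2 * q)%N by rewrite muln_gt0/= ltnW.
rewrite -(ler_pXn2r q20) ?nnegrE ?chain_sup_ge0// chain_supX.
set a := dyadic_incr N u l k / _.
have -> : `|a| ^+ (2 * q) = a ^+ (2 * q) by rewrite !exprM real_normK// num_real.
have lL' : (l < Lm.+1)%N by [].
rewrite /chain_sum (bigD1 (Ordinal lL'))//= (bigD1 (Ordinal kl))//= -/a -addrA.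
by rewrite lerDl addr_ge0//; apply: sumr_ge0 => // i _; apply: sumr_ge0.
Qed.

Lemma measurable_dyadic_cell d (T : measurableType d) (f : T -> R) l k :
  measurable_fun setT f ->
  measurable [set t | dyadic l k <= f t < dyadic l k.+1].
Proof.
move=> mf; have -> : [set t | dyadic l k <= f t < dyadic l k.+1] =
    [set t | dyadic l k <= f t] `&` [set t | f t < dyadic l k.+1].
  by apply/seteqP; split => t /=; [move/andP|move=> []; move=> -> ->].
apply: measurableI; rewrite -[X in measurable X]setTI.
  exact: measurable_fun_ler.
exact: measurable_fun_ltr.
Qed.

Lemma dyadic_cell_indic (T : Type) (f : T -> R) l k t :
  (dyadic l k <= f t < dyadic l k.+1)%R%:R =
  \1_[set t | dyadic l k <= f t < dyadic l k.+1] t :> R.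
Proof.
by rewrite indicE; congr (nat_of_bool _)%:R; apply/idP/idP; rewrite inE.
Qed.

Lemma measurable_dyadic_incr d (T : measurableType d) (v : nat -> T -> R) l k :
  (forall j, measurable_fun setT (v j)) ->
  measurable_fun setT (fun t => dyadic_incr N (fun j => v j t) l k).
Proof.
move=> mv; apply: measurable_sum => j; apply: measurable_funB => //.
rewrite (_ : (fun t => _) =
    (\1_[set t | dyadic l k <= v j t < dyadic l k.+1] : T -> R)).
  exact/measurable_indic/measurable_dyadic_cell.
by apply/funext => t; rewrite dyadic_cell_indic.
Qed.

Lemma measurable_chain_sup d (T : measurableType d) (v : nat -> T -> R) :
  (forall j, measurable_fun setT (v j)) ->
  measurable_fun setT (fun t => chain_sup (fun j => v j t)).
Proof.
move=> mv; apply: (measurableT_comp (measurable_powR _)).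
apply: measurable_sum => l; apply: measurable_sum => k.
apply: measurable_funX; apply: measurable_funM => //.
exact: measurable_dyadic_incr.
Qed.

(** 5 is the sum of the geometric series of ratio 4/5 that bounds the contributions of the
    levels. *)
Definition chain_constant : R := moment_constant R q * 5.

Lemma chain_sup_moment d (T : measurableType d) (P : probability T R)
    (v : nat -> T -> R) :
  (2 ^ Lm <= N)%N ->
  (forall j, measurable_fun setT (v j)) ->
  (forall l k s, (k < 2 ^ l)%N -> uniq s ->
    P (\big[setI/setT]_(j <- s) [set t | dyadic l k <= v j t < dyadic l k.+1]) =
    (((2 ^+ l)^-1) ^+ size s)%:E) ->
  (\int[P]_t (chain_sup (fun j => v j t) ^+ (2 * q))%:E <=
   (chain_constant * N%:R ^+ q)%:E)%E.
Proof.
move=> LN mv vP.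
have mset l k j : measurable [set t | dyadic l k <= v j t < dyadic l k.+1].
  exact: measurable_dyadic_cell.
have incrE l k t : dyadic_incr N (fun j => v j t) l k = \sum_(j <- iota 0 N)
    (\1_[set t | dyadic l k <= v j t < dyadic l k.+1] t - (2 ^+ l)^-1).
  by apply: eq_bigr => j _; rewrite dyadic_cell_indic.
have M0 : 0 <= moment_constant R q.
  by rewrite /moment_constant !mulr_ge0 ?exprn_ge0.
have term l k : (l <= Lm)%N -> (k < 2 ^ l)%N ->
    (\int[P]_t ((dyadic_incr N (fun j => v j t) l k / (9 / 10) ^+ l) ^+ (2 * q))%:E <=
     (moment_constant R q * N%:R ^+ q * (((81 / 50) ^+ q)^-1) ^+ l)%:E)%E.
  move=> lL kl; have p2 : 0 < 2 ^+ l :> R by rewrite exprn_gt0.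
  have h := @even_moment _ _ _ P (fun j => [set t | dyadic l k <= v j t < dyadic l k.+1])
    (2 ^+ l)^-1 (mset l k) (fun s us => vP l k s kl us) (iota 0 N) q (iota_uniq _ _).
  have p0 : 0 <= (2 ^+ l : R)^-1 by rewrite invr_ge0 ltW.
  have p1 : (2 ^+ l : R)^-1 <= 1 by rewrite invf_le1// exprn_ege1// ler1n.
  (* [2 ^ Lm <= N] leaves at least one expected point per cell, as [even_moment] asks. *)
  have Np : 1 <= N%:R * (2 ^+ l : R)^-1.
    by rewrite ler_pdivlMr// mul1r -(natrX R 2 l) ler_nat (leq_trans _ LN) ?leq_exp2l.
  rewrite size_iota in h; have {h} := h p0 p1 Np.
  set c : R := ((9 / 10) ^+ l)^-1 ^+ (2 * q) => h.
  have c0 : 0 <= c by exact: term_ge0.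
  have mI : measurable_fun setT (fun t => (dyadic_incr N (fun j => v j t) l k ^+ (2 * q))%:E).
    by apply/measurable_EFinP; apply: measurable_funX; exact: measurable_dyadic_incr.
  under eq_integral do rewrite exprMn mulrC EFinM.
  rewrite ge0_integralZl ?lee_fin//; last by move=> t _; rewrite lee_fin term_ge0.
  under eq_integral do rewrite incrE.
  apply: (@le_trans _ _ (c%:E * (moment_constant R q * (N%:R / 2 ^+ l) ^+ q)%:E)%E).
    by apply: lee_wpmul2l; rewrite ?lee_fin.
  have cE : c * (2 ^- l) ^+ q = ((81 / 50) ^+ q)^-1 ^+ l.
    rewrite /c !exprVn -!exprM (mulnC 2 q) mulnA (exprM _ (l * q) 2).
    rewrite -invfM -exprM (mulnC (l * q)%N 2) (exprM _ 2) -exprMn (mulnC q l).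
    by congr ((_ ^+ _)^-1); lra.
  rewrite -EFinM lee_fin le_eqVlt; apply/orP; left; apply/eqP.
  by rewrite (exprMn q N%:R) -cE; ring.
(* Level [l] has [2 ^ l] cells, each contributing [(81 / 50) ^- (q * l)], where 81/50 is
   [2 * (9 / 10) ^ 2]; [1 < q] makes the total decay. *)
have ratio : 2 / (81 / 50) ^+ q <= 4 / 5 :> R.
  rewrite ler_pdivrMr ?exprn_gt0//; apply: (@le_trans _ _ (4 / 5 * (81 / 50) ^+ 2)).
    lra.
  by rewrite ler_wpM2l// ler_weXn2l//; lra.
have mterm l k : measurable_fun setT (fun t =>
    ((dyadic_incr N (fun j => v j t) l k / (9 / 10) ^+ l) ^+ (2 * q))%:E).
  apply/measurable_EFinP; apply: measurable_funX; apply: measurable_funM => //.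
  exact: measurable_dyadic_incr.
under eq_integral do rewrite chain_supX /chain_sum -sumEFin.
rewrite ge0_integral_sum//; first last.
- by move=> l t _; rewrite lee_fin sumr_ge0.
- move=> l; apply/measurable_EFinP; apply: measurable_sum => k.
  exact/measurable_EFinP/mterm.
set M := moment_constant R q in M0 term *.
have M1 : 0 <= M * N%:R ^+ q by rewrite mulr_ge0// exprn_ge0.
apply: (@le_trans _ _ (\sum_(l < Lm.+1) (M * N%:R ^+ q * (4 / 5) ^+ l)%:E)%E).
  apply: lee_sum => l _; under eq_integral do rewrite -sumEFin.
  rewrite ge0_integral_sum//; last by move=> k t _; rewrite lee_fin.
  apply: (@le_trans _ _ (\sum_(k < 2 ^ l)
      (M * N%:R ^+ q * (((81 / 50) ^+ q)^-1) ^+ l)%:E)%E).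
    by apply: lee_sum => k _; exact: term (ltn_ord l) (ltn_ord k).
  set a := M * _ ^+ _ in M1 *; rewrite sumEFin sumr_const card_ord lee_fin.
  rewrite -[leLHS]mulr_natr natrX -mulrA ler_wpM2l//.
  rewrite -exprMn lerXn2r ?nnegrE ?mulr_ge0 ?invr_ge0 ?exprn_ge0//.
  by rewrite mulrC.
rewrite sumEFin lee_fin -mulr_sumr mulrAC.
apply: ler_wpM2r; first exact: exprn_ge0.
rewrite /chain_constant -/M; apply: ler_wpM2l => //.
have geo : forall n, \sum_(l < n) (4 / 5 : R) ^+ l = 5 * (1 - (4 / 5) ^+ n).
  elim=> [|n IH]; first by rewrite big_ord0 expr0 subrr mulr0.
  by rewrite big_ord_recr/= IH exprS; lra.
rewrite geo ler_piMr// gerBl exprn_ge0// divr_ge0.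
Qed.

End chaining_moment.

(** * Fluctuations of the nonlinear particles *)

Section empirical_fluctuation.
Context d (Omega : measurableType d) (R : realType) (P : probability Omega R).
Local Notation RT := (measurableTypeR R).
Variables (m : probability R R) (X0 : nat -> {RV P >-> R}).
Variables (W : nat -> R -> {RV P >-> R}).
Hypothesis inputs : initial_and_noise m X0 W.
Variables (sigma L B : R) (lam : R -> R).
Hypotheses (sigma0 : 0 < sigma) (L0 : 0 < L) (B0 : 0 < B).
Hypothesis lam_lip : forall x y, `|lam x - lam y| <= L * `|x - y|.
Hypothesis lam_bnd : forall x, `|lam x| <= B.
Variable X : nat -> R -> {RV P >-> R}.
Hypothesis mX : forall i, mckean_process X0 W sigma lam i (X i).
Variable q : nat.
Hypothesis q2 : (1 < q)%N.

(** Each particle is inserted into its own distribution function, whence uniformity and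
    independence; [mckean_cdf_unique] identifies these functions only in [fluctuation_empirical]. *)
Let U s w j := path_cdf (X j) s (X j (Num.max 0 s) w).

(** The finest level [l] with at most [N] cells: fine enough for a rounding error [N / 2 ^ l <= 2],
    coarse enough for one expected particle per cell. *)
Definition fluctuation N s w := chain_sup q (trunc_log 2 N) N (U s w).

Lemma fluctuation_ge0 N s w : 0 <= fluctuation N s w.
Proof. exact: chain_sup_ge0. Qed.

Lemma measurable_fluctuation N :
  measurable_fun setT (fun z : RT * Omega => fluctuation N z.1 z.2).
Proof.
apply: (@measurable_chain_sup _ _ _ _ _ _ (fun j (z : RT * Omega) => U z.1 z.2 j)).
by move=> j; apply: measurable_path_cdf_comp; exact: mckean_cont (mX j).
Qed.

Let continuous_cdf j s : 0 < s -> continuous (cdfr (X j s)).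
Proof.
move=> s0; have [c c0 lip] := mckean_cdf_lipschitz inputs sigma0 L0 B0 lam_lip lam_bnd s0.
have k0 : 0 < c / Num.sqrt s by rewrite divr_gt0// sqrtr_gt0.
move=> x; apply/cvgrPdist_lt => e e0; apply/nbhs_ballP.
exists (e / (c / Num.sqrt s)) => /= [|y xy]; first exact: divr_gt0.
have := lip _ _ (mX j) s x y s0 (lexx _).
rewrite /path_cdf (max_r (ltW s0)) => /le_lt_trans; apply.
by rewrite mulrC -ltr_pdivlMr.
Qed.

Lemma dyadic_cell_law s l k (J : seq nat) : 0 < s -> (k < 2 ^ l)%N -> uniq J ->
  P (\big[setI/setT]_(j <- J) [set w | dyadic l k <= U s w j < dyadic l k.+1]) =
  ((2 ^- l) ^+ size J)%:E.
Proof.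
move=> s0 kl uJ; have p2 : 0 < 2 ^+ l :> R by rewrite exprn_gt0.
have UE w j : U s w j = cdfr (X j s) (X j s w) by rewrite /U /path_cdf (max_r (ltW s0)).
pose A j := [set y | dyadic l k <= cdfr (X j s) y < dyadic l k.+1].
have mF j : measurable_fun setT (cdfr (X j s)).
  by apply: continuous_measurable_fun; exact: continuous_cdf.
have mA j : measurable (A j) by exact: measurable_dyadic_cell.
have := mckean_mutual_indep inputs mX (ltW s0) mA uJ.
have -> : \big[setI/setT]_(j <- J) (X j s @^-1` A j) =
    \big[setI/setT]_(j <- J) [set w | dyadic l k <= U s w j < dyadic l k.+1].
  by apply: eq_bigr => j _; apply/seteqP; split => w /=; rewrite UE.
move=> ->.
have d01 i : (i <= 2 ^ l)%N -> 0 <= dyadic l i :> R /\ dyadic l i <= 1 :> R.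
  move=> il; split; first by rewrite divr_ge0// ltW.
  by rewrite /dyadic ler_pdivrMr// mul1r -(natrX R 2 l) ler_nat.
have PA j : P (X j s @^-1` A j) = (2 ^- l)%:E.
  have mU := measurable_cdfr_comp (continuous_cdf (j := j) s0).
  have [a0 a1] := d01 k (ltnW kl); have [b0 b1] := d01 k.+1 kl.
  have := cdfr_uniform (continuous_cdf (j := j) s0) b0 b1.
  have -> : [set w | cdfr (X j s) (X j s w) < dyadic l k.+1] =
    [set w | cdfr (X j s) (X j s w) < dyadic l k] `|` X j s @^-1` A j.
    apply/seteqP; split => w /=.
      by move=> h; have [|h'] := ltP (cdfr (X j s) (X j s w)) (dyadic l k);
        [left|right; rewrite /A/= h' h].
    move=> [h|]; last by rewrite /A/= => /andP[].
    apply: (lt_le_trans h); rewrite /dyadic ler_pM2r ?invr_gt0//.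
    by rewrite ler_nat.
  rewrite measureU; first last.
  - apply/seteqP; split => // w /= [h]; rewrite /A/= => /andP[].
    by rewrite leNgt h.
  - by rewrite -[X in measurable X]setTI; exact: measurable_funP.
  - exact: (measurable_rv_lt _ mU).
  rewrite [X in (X + _)%E](_ : _ = (dyadic l k)%:E); last first.
    exact: (cdfr_uniform (continuous_cdf (j := j) s0) a0 a1).
  have fA : P (X j s @^-1` A j) \is a fin_num.
    by apply: fin_num_measure; rewrite -[X in measurable X]setTI; exact: measurable_funP.
  set p := (X in (_ + X)%E); have fp : p \is a fin_num by exact: fA.
  rewrite -(fineK fp) -EFinD => -[h]; rewrite -[LHS]/p -(fineK fp); congr (_%:E).
  by move: h; rewrite /dyadic -[k.+1%:R]natr1 mulrDl mul1r => /addrI.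
under eq_bigr do rewrite PA.
by rewrite prodEFin big_const_seq count_predT iter_mulr_1.
Qed.

Lemma fluctuation_moment N s : (0 < N)%N -> 0 < s ->
  (\int[P]_w (fluctuation N s w ^+ (2 * q))%:E <=
   (chain_constant (R := R) q * N%:R ^+ q)%:E)%E.
Proof.
move=> N0 s0; apply: (chain_sup_moment q2 (v := fun j w => U s w j)).
- exact: trunc_logP.
- move=> j; have := measurable_path_cdf_comp (mckean_cont (mX j)) (mckean_cont (mX j)).
  exact: measurable_fun_pair2.
- by move=> l k J kl uJ; exact: dyadic_cell_law.
Qed.

Lemma fluctuation_empirical i N s w y : (0 < N)%N -> 0 < s ->
  `|\sum_(j < N) (X j s w <= y)%R%:R - N%:R * path_cdf (X i) s y| <=
  10 * fluctuation N s w + 2.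
Proof.
move=> N0 s0; set F := path_cdf (X i) s; pose l := trunc_log 2 N.
have V0 := fluctuation_ge0 N s w.
have UE j : U s w j = F (X j s w).
  rewrite /U (max_r (ltW s0)).
  exact: (mckean_cdf_unique inputs sigma0 L0 B0 lam_lip lam_bnd).
have devD k : (k <= 2 ^ l)%N -> `|dyadic_dev N (F \o (fun j => X j s w)) l k| <=
    10 * fluctuation N s w.
  move=> kl; apply: (@dyadic_dev_bound _ _ _ _ l) => //.
    by move=> j; exact: cdfr_ge0.
  move=> l' k' ll' kl'.
  have := @dyadic_incr_chain_sup _ q l N q2 (U s w) l' k' ll' kl'.
  by rewrite /dyadic_incr; under eq_bigr do rewrite UE.
have D0 : 0 <= 10 * fluctuation N s w by rewrite mulr_ge0.
have Fnd a c : a <= c -> F a <= F c by exact: cdfr_nd.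
have le := @empirical_le _ N l (fun j => X j s w) F _ Fnd (@cdfr_in01 _ _ _ _ _) D0 devD y.
have ge := @empirical_ge _ N l (fun j => X j s w) F _ Fnd (@cdfr_in01 _ _ _ _ _) devD y.
have NL : N%:R / 2 ^+ l <= 2 :> R.
  rewrite ler_pdivrMr ?exprn_gt0// -exprS -natrX ler_nat ltnW//.
  exact: trunc_log_ltn.
have sumE (G : nat -> R) : \sum_(j <- iota 0 N) G j = \sum_(j < N) G j.
  by rewrite -(big_mkord xpredT G) /index_iota subn0.
move: le ge; rewrite sumE.
by rewrite ler_norml; lra.
Qed.

End empirical_fluctuation.

(** * Comparison with the particle systems *)

Section particle_comparison.
Context {R : realType}.
Notation mu := (@lebesgue_measure R).
Variables (N : nat) (x z : 'I_N -> R -> R) (F : R -> R -> R) (lam : R -> R).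
Variables (b : nat -> R) (Z : R -> R) (L c e K T : R).
Let rank i s := (\sum_(j < N) (z j s <= z i s)%R)%N.
Let g i s := lam (F s (x i s)) - b (rank i s).
Hypotheses (L0 : 0 < L) (c0 : 0 < c) (e0 : 0 <= e) (T0 : 0 < T).
Hypothesis lam_lip : forall u v, `|lam u - lam v| <= L * `|u - v|.
Hypothesis b_lam : forall k, (0 < k <= N)%N -> `|b k - lam (k%:R / N%:R)| <= e.
Hypothesis F_lip : forall s u v, 0 < s -> s <= T ->
  `|F s u - F s v| <= c / Num.sqrt s * `|u - v|.
Hypothesis F_empirical : forall s y, 0 < s -> s <= T ->
  `|\sum_(j < N) (x j s <= y)%R%:R - N%:R * F s y| <= N%:R * Z s.
Hypotheses (mg : forall i, measurable_fun setT (g i)).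
Hypothesis g_bnd : forall i s, `|g i s| <= K.
Hypotheses (mZ : measurable_fun setT Z) (Z0 : forall s, 0 <= Z s).
Hypothesis eqn : forall i t, 0 <= t -> t <= T ->
  x i t - z i t = \int[mu]_(s in `]0, t]) g i s.

(** Makes the feedback [L * (2 * c) * (2 / k)] equal to 1/2: [2 * c] comes from the shift of the
    threshold in the rank, [2 / k] from [integral_sqrt_kernel]. *)
Let k := 8 * (L * c).
Let k0 : 0 < k. Proof. by rewrite !mulr_gt0. Qed.

(** If all particles are displaced by at most [D], then [z j <= z i] implies [x j <= x i + 2 * D],
    and [x j <= x i - 2 * D] implies [z j <= z i]. The rank thus lies between two values of the
    empirical distribution function of [x], which is close to [N * F]. *)
Let drift_close M i s : 0 < s -> s <= T -> 0 <= M ->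
  (forall j, `|x j s - z j s| <= M * expR (k * Num.sqrt s)) ->
  `|g i s| <= L * (Z s + 2 * c * M * sqrt_kernel k s) + e.
Proof.
move=> s0 sT M0 xz; set D := M * expR _ in xz.
have N0 : (0 < N)%N by exact: leq_ltn_trans (ltn_ord i).
have NR : 0 < N%:R :> R by rewrite ltr0n.
have D0 : 0 <= D by rewrite mulr_ge0 ?expR_ge0.
have rankE : (rank i s)%:R = \sum_(j < N) (z j s <= z i s)%R%:R :> R.
  by rewrite /rank natr_sum.
have rank0 : (0 < rank i s <= N)%N.
  apply/andP; split; first by rewrite /rank (bigD1 i)//= lexx.
  rewrite /rank -[leqRHS]card_ord -sum1_card; apply: leq_sum => j _.
  exact: leq_b1.
have near u v : `|u - v| <= D -> v <= u + D /\ u <= v + D.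
  by rewrite ler_norml; lra.
have up : (rank i s)%:R <= N%:R * F s (x i s + 2 * D) + N%:R * Z s.
  rewrite rankE; apply: (@le_trans _ _ (\sum_(j < N) (x j s <= x i s + 2 * D)%R%:R)).
    apply: ler_sum => j _; rewrite ler_nat.
    have [zz|//] := leP (z j s) (z i s).
    have [a1 a2] := near _ _ (xz i); have [a3 a4] := near _ _ (xz j).
    by have -> : x j s <= x i s + 2 * D by lra.
  by have := F_empirical (x i s + 2 * D) s0 sT; rewrite ler_norml; lra.
have lo : N%:R * F s (x i s - 2 * D) - N%:R * Z s <= (rank i s)%:R.
  rewrite rankE; apply: (@le_trans _ _ (\sum_(j < N) (x j s <= x i s - 2 * D)%R%:R)).
    by have := F_empirical (x i s - 2 * D) s0 sT; rewrite ler_norml; lra.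
  apply: ler_sum => j _; rewrite ler_nat.
  have [zz|//] := leP (x j s) (x i s - 2 * D).
  have [a1 a2] := near _ _ (xz i); have [a3 a4] := near _ _ (xz j).
  by have -> : z j s <= z i s by lra.
have cs : c / Num.sqrt s * (2 * D) = 2 * c * M * sqrt_kernel k s.
  by rewrite /D /sqrt_kernel; ring.
have d1 : `|x i s + 2 * D - x i s| = 2 * D.
  by rewrite addrAC subrr add0r ger0_norm ?mulr_ge0.
have d2 : `|x i s - 2 * D - x i s| = 2 * D.
  by rewrite addrAC subrr add0r normrN ger0_norm ?mulr_ge0.
have F1 : F s (x i s + 2 * D) <= F s (x i s) + 2 * c * M * sqrt_kernel k s.
  have := F_lip (x i s + 2 * D) (x i s) s0 sT.
  rewrite d1 cs.
  by rewrite ler_norml; lra.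
have F2 : F s (x i s) - 2 * c * M * sqrt_kernel k s <= F s (x i s - 2 * D).
  have := F_lip (x i s - 2 * D) (x i s) s0 sT.
  rewrite d2 cs.
  by rewrite ler_norml; lra.
have rk : `|F s (x i s) - (rank i s)%:R / N%:R| <= Z s + 2 * c * M * sqrt_kernel k s.
  have u1 : (rank i s)%:R / N%:R <= F s (x i s + 2 * D) + Z s.
    by rewrite ler_pdivrMr// mulrC mulrDr.
  have u2 : F s (x i s - 2 * D) - Z s <= (rank i s)%:R / N%:R.
    by rewrite ler_pdivlMr// mulrC mulrBr.
  by rewrite ler_norml; lra.
have -> : g i s = (lam (F s (x i s)) - lam ((rank i s)%:R / N%:R)) -
    (b (rank i s) - lam ((rank i s)%:R / N%:R)) by rewrite /g; ring.
apply: (le_trans (ler_normB _ _)); apply: lerD; last exact: b_lam.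
by apply: (le_trans (lam_lip _ _)); rewrite ler_pM2l.
Qed.

Let integral_pos t : 0 <= t -> t <= T ->
  (\int[mu]_(s in `]0%R, t]) (Z s)%:E <= \int[mu]_(s in `]0%R, T]) (Z s)%:E)%E.
Proof.
move=> t0 tT; apply: ge0_subset_integral => //=.
- by apply/measurable_EFinP; exact: measurable_funTS.
- by move=> s _; rewrite lee_fin.
- by move=> s /=; rewrite !in_itv/= => /andP[-> /le_trans->].
Qed.

Lemma particle_distance i t : 0 <= t -> t <= T ->
  (`|x i t - z i t|%:E <= (2 * expR (k * Num.sqrt T))%:E *
    (L%:E * \int[mu]_(s in `]0%R, T]) (Z s)%:E + (e * T)%:E))%E.
Proof.
move=> t0 tT; set IZ := (\int[mu]_(s in _) _)%E.
have IZ0 : (0 <= IZ)%E by apply: integral_ge0 => s _; rewrite lee_fin.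
have p0 : 0 < 2 * expR (k * Num.sqrt T) by rewrite mulr_gt0 ?expR_gt0.
(* [Z] is not assumed integrable; if its integral is infinite, so is the right side. *)
have [IZoo|] := eqVneq IZ +oo%E.
  by rewrite IZoo gt0_muley ?lte_fin// addye ?gt0_muley ?lte_fin ?leey.
rewrite -ltey => IZoo; have fIZ : IZ \is a fin_num by rewrite ge0_fin_numE.
pose J := fine IZ; have JE : IZ = J%:E by rewrite /J fineK.
have J0 : 0 <= J by rewrite -lee_fin -JE.
have eT : 0 <= e * T by rewrite mulr_ge0// ltW.
pose A := L * J + e * T.
have A0 : 0 <= A by rewrite addr_ge0// mulr_ge0// ltW.
(* One supremum over all particles and times at once, since each rank involves every particle. *)
pose I := ('I_N * {s : R | 0 <= s <= T})%type.
pose f (u : I) := `|x u.1 (sval u.2) - z u.1 (sval u.2)| / expR (k * Num.sqrt (sval u.2)).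
have H : forall u, f u <= 2 * A.
  apply: (@halving_bound _ _ f A (K * T) A0).
    move=> [j [s sI]]; have /andP[s0 sT] := sI; rewrite /f/= ler_pdivrMr ?expR_gt0//.
    have K0 : 0 <= K by exact: le_trans (normr_ge0 _) (g_bnd j 0).
    apply: (@le_trans _ _ (K * T)); last first.
      rewrite ler_peMr ?mulr_ge0 ?(ltW T0)// -expR0 ler_expR.
      by rewrite mulr_ge0 ?sqrtr_ge0// ltW.
    rewrite eqn//; apply: (le_trans (le_norm_Rintegral_cst s0 (mg j) (g_bnd j))).
    by rewrite subr0 ler_wpM2l.
  move=> M M0 fM [j [s sI]]; have /andP[s0 sT] := sI; rewrite /f/= ler_pdivrMr ?expR_gt0//.
  have close : forall j u, 0 < u -> u <= T ->
      `|x j u - z j u| <= M * expR (k * Num.sqrt u).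
    move=> j' u u0 uT; rewrite -ler_pdivrMr ?expR_gt0//.
    have hu : 0 <= u <= T by rewrite uT ltW.
    exact: (fM (j', exist _ u hu)).
  rewrite eqn// -lee_fin.
  pose a := L * (2 * c * M).
  have a0 : 0 <= a by rewrite !mulr_ge0// ltW.
  pose h u := (L%:E * (Z u)%:E + a%:E * (sqrt_kernel k u)%:E + e%:E)%E.
  have mk := measurable_sqrt_kernel k.
  have mh : measurable_fun setT h.
    have : measurable_fun setT (fun u => L * Z u + a * sqrt_kernel k u + e).
      apply: measurable_funD => //; apply: measurable_funD.
        exact: measurable_funM.
      exact: measurable_funM.
    by move=> /measurable_EFinP.
  apply: (le_trans (le_norm_Rintegral (mg j) (g_bnd j) mh _)).
    move=> u u0 us; have uT := le_trans us sT.
    have := drift_close j u0 uT M0 (fun j' => close j' u u0 uT).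
    by rewrite /h -!EFinM -!EFinD lee_fin /a; lra.
  have mitv : measurable (`]0, s]%classic : set (measurableTypeR R)) by exact: measurable_itv.
  have mLZ (S : set (measurableTypeR R)) : measurable_fun S (fun u => L%:E * (Z u)%:E)%E.
    by apply/measurable_EFinP/measurable_funTS/measurable_funM.
  have mak (S : set (measurableTypeR R)) :
      measurable_fun S (fun u => a%:E * (sqrt_kernel k u)%:E)%E.
    by apply/measurable_EFinP/measurable_funTS/measurable_funM.
  have LZ0 u : (0 <= L%:E * (Z u)%:E)%E by rewrite -EFinM lee_fin mulr_ge0// ltW.
  have ak0 u : (0 <= a%:E * (sqrt_kernel k u)%:E)%E.
    by rewrite -EFinM lee_fin mulr_ge0 ?sqrt_kernel_ge0.
  rewrite /h ge0_integralD//=; first last.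
  - exact: emeasurable_funD.
  - by move=> u _; exact: adde_ge0.
  rewrite ge0_integralD//=.
  rewrite ge0_integralZl//=; first last.
  - by rewrite lee_fin ltW.
  - by move=> u _; rewrite lee_fin.
  - by apply/measurable_EFinP; apply: measurable_funTS.
  rewrite ge0_integralZl//=; first last.
  - by move=> u _; rewrite lee_fin sqrt_kernel_ge0.
  - by apply/measurable_EFinP; apply: measurable_funTS.
  have := integral_ocitv_cst e s0; rewrite /cst => ->.
  have i1 := integral_sqrt_kernel k0 (lexx _) s0.
  have i2 := integral_pos s0 sT; rewrite -/IZ JE in i2.
  have E1 : 1 <= expR (k * Num.sqrt s).
    by rewrite -expR0 ler_expR mulr_ge0 ?sqrtr_ge0// ltW.
  set E := expR (k * Num.sqrt s) in i1 E1 *.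
  apply: (@le_trans _ _ ((L * J) + a * (2 / k * (E - 1)) + e * T)%:E).
    rewrite !EFinD !EFinM; apply: leeD; first apply: leeD.
    + by apply: lee_wpmul2l => //; rewrite lee_fin ltW.
    + apply: lee_wpmul2l => //; apply: (le_trans i1).
      by rewrite sqrtr0 mulr0 expR0.
    + by rewrite -EFinM lee_fin subr0 ler_wpM2l.
  rewrite lee_fin.
  have -> : a * (2 / k * (E - 1)) = M / 2 * (E - 1).
    by rewrite /a /k; field; rewrite !gt_eqF.
  have AE : A <= A * E by rewrite ler_peMr.
  by rewrite /A in AE *; lra.
have ht : 0 <= t <= T by rewrite t0.
have := H (i, exist _ t ht); rewrite /f/= ler_pdivrMr ?expR_gt0// => h.
rewrite JE; change ((`|x i t - z i t|)%:E <= (2 * expR (k * Num.sqrt T) * A)%:E)%E.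
rewrite lee_fin; apply: (le_trans h); rewrite mulrAC.
by rewrite ler_wpM2r// ler_pM2l// ler_expR ler_pM2l// ler_wsqrtr.
Qed.

End particle_comparison.

(** * Power bounds for time integrals *)

Section integral_bounds.
Context {R : realType}.
Notation mu := (@lebesgue_measure R).
Local Notation RT := (measurableTypeR R).

(** Trades [y] for its power at a free scale [c]; [power_le_integral] picks the scale, in place of
    the Hoelder inequality. *)
Lemma le_tangent_power (y c : R) p : 0 <= y -> 0 < c -> y <= c + y ^+ p.+1 / c ^+ p.
Proof.
move=> y0 c0; have [yc|cy] := leP y c.
  by rewrite (le_trans yc)// lerDl divr_ge0 ?exprn_ge0// ltW.
apply: (@le_trans _ _ (y ^+ p.+1 / c ^+ p)); last by rewrite lerDr ltW.
by rewrite ler_pdivlMr ?exprn_gt0// exprS ler_wpM2l// lerXn2r// ?nnegrE ltW.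
Qed.

(* Jensen-type bound; it also covers the case where the integrals are infinite. *)
Lemma power_le_integral (D A a T : R) (V : RT -> R) p : 0 <= D -> 0 <= A ->
  0 < a -> 0 < T -> measurable_fun setT V -> (forall s, 0 <= V s) ->
  (D%:E <= A%:E + a%:E * \int[mu]_(s in `]0%R, T]) (V s)%:E)%E ->
  ((D ^+ p.+1)%:E <= (2 ^+ p.+1 * A ^+ p.+1)%:E + ((4 * a) ^+ p.+1 * T ^+ p)%:E *
    \int[mu]_(s in `]0%R, T]) (V s ^+ p.+1)%:E)%E.
Proof.
move=> D0 A0 a0 T0 mV V0 DAV.
set J := (\int[mu]_(s in _) (V s ^+ p.+1)%:E)%E.
have J0 : (0 <= J)%E by apply: integral_ge0 => s _; rewrite lee_fin exprn_ge0.
have k0 : 0 < (4 * a) ^+ p.+1 * T ^+ p.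
  by rewrite mulr_gt0 ?exprn_gt0// mulr_gt0.
have A0' : 0 <= 2 ^+ p.+1 * A ^+ p.+1 by rewrite mulr_ge0 ?exprn_ge0.
have [DA|AD] := leP D (2 * A).
  apply: (@le_trans _ _ (2 ^+ p.+1 * A ^+ p.+1)%:E).
    by rewrite lee_fin -exprMn lerXn2r ?nnegrE// mulr_ge0.
  by rewrite leeDl// mule_ge0// lee_fin ltW.
have D1 : 0 < D by apply: le_lt_trans AD; rewrite mulr_ge0.
(* With this scale the constant part of the integral contributes [D / 4]; as [A < D / 2], at least
   [D / 4] is left to the integral of the power. *)
pose c := D / (4 * a * T).
have c0 : 0 < c by rewrite divr_gt0// !mulr_gt0.
have mVp (S : set RT) : measurable_fun S (fun s => (V s ^+ p.+1)%:E).
  by apply/measurable_EFinP/measurable_funTS/measurable_funX.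
have IV : (\int[mu]_(s in `]0%R, T]) (V s)%:E <= (c * T)%:E + (c ^- p)%:E * J)%E.
  apply: (@le_trans _ _ (\int[mu]_(s in `]0%R, T])
      (cst c%:E s + (c ^- p)%:E * (V s ^+ p.+1)%:E))%E).
    apply: ge0_le_integral => //=.
    - by move=> s _; rewrite lee_fin.
    - by apply/measurable_EFinP/measurable_funTS.
    - apply: emeasurable_funD; first exact: measurable_cst.
      by apply/measurable_EFinP/measurable_funTS/measurable_funM => //; exact: measurable_funX.
    - by move=> s _; rewrite -EFinM -EFinD lee_fin mulrC le_tangent_power.
  rewrite ge0_integralD//=; first last.
  - by apply/measurable_EFinP/measurable_funTS/measurable_funM => //; exact: measurable_funX.
  - by move=> s _; rewrite -EFinM lee_fin mulr_ge0 ?invr_ge0 ?exprn_ge0// ltW.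
  - by move=> s _; rewrite lee_fin ltW.
  have := integral_ocitv_cst c (ltW T0); rewrite /cst => ->; rewrite subr0.
  rewrite ge0_integralZl//=; first by move=> s _; rewrite lee_fin exprn_ge0.
  by rewrite lee_fin invr_ge0 exprn_ge0// ltW.
have [Joo|] := eqVneq J +oo%E; first by rewrite Joo gt0_muley ?lte_fin// addey ?leey.
rewrite -ltey => Joo; have fJ : J \is a fin_num by rewrite ge0_fin_numE.
move: IV DAV J0; rewrite -(fineK fJ); set j := fine J => IV DAV; rewrite lee_fin => j0.
have : (D%:E <= A%:E + a%:E * ((c * T)%:E + (c ^- p)%:E * j%:E))%E.
  by apply: (le_trans DAV); rewrite leeD2l// lee_wpmul2l// lee_fin ltW.
change ((D%:E <= (A + a * (c * T + c ^- p * j))%:E)%E ->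
  (D ^+ p.+1)%:E <= (2 ^+ p.+1 * A ^+ p.+1 + (4 * a) ^+ p.+1 * T ^+ p * j)%:E)%E.
rewrite !lee_fin.
have -> : a * (c * T + c ^- p * j) = D / 4 + a * j / c ^+ p.
  have -> : D / 4 = a * (c * T) by rewrite /c; field; rewrite !gt_eqF.
  by ring.
move=> H.
have h1 : D / 4 <= a * j / c ^+ p by lra.
move: h1; rewrite ler_pdivlMr ?exprn_gt0// => h1.
apply: (@le_trans _ _ ((4 * a) ^+ p.+1 * T ^+ p * j)); last by rewrite lerDr.
have -> : D ^+ p.+1 = (D / 4 * c ^+ p) * (4 * (4 * a * T) ^+ p).
  have cD : D = c * (4 * a * T) by rewrite divfK// gt_eqF// !mulr_gt0.
  by rewrite exprS {2}cD exprMn; field.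
apply: (le_trans (ler_wpM2r _ h1)).
  by rewrite mulr_ge0// exprn_ge0// !mulr_ge0// ltW.
by rewrite le_eqVlt; apply/orP; left; apply/eqP; rewrite exprS !exprMn; ring.
Qed.

Lemma powR_le_add1 (rho y : R) n : 0 <= rho -> 0 <= y -> rho <= n%:R ->
  y `^ rho <= 1 + y ^+ n.
Proof.
move=> rho0 y0 rn; have [y1|y1] := leP y 1.
  apply: (@le_trans _ _ (1 `^ rho)); first by rewrite ge0_ler_powR ?nnegrE.
  by rewrite powR1 lerDl exprn_ge0.
apply: (@le_trans _ _ (y ^+ n)); last by rewrite lerDr.
by rewrite -powR_mulrn// ler_powR// ltW.
Qed.

End integral_bounds.

Import HBNNSimple.

(** [f] is not assumed measurable: it will be built from [sup_dist], a supremum over uncountably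
    many times. The integral of [f] is a supremum over simple functions below [f], each of which is
    almost everywhere below [g]. *)
Lemma ae_le_integral d (T : measurableType d) (R : realType)
    (P : {measure set T -> \bar R}) (f g : T -> \bar R) :
  (forall x, 0 <= f x)%E -> (forall x, 0 <= g x)%E -> measurable_fun setT g ->
  {ae P, forall x, (f x <= g x)%E} -> (\int[P]_x f x <= \int[P]_x g x)%E.
Proof.
move=> f0 g0 mg fg; rewrite (ge0_integralTE _ f0).
apply: ge_ereal_sup => _ [h /= hf <-].
rewrite -integralT_nnsfun; apply: ae_ge0_le_integral => //.
- by move=> x _; rewrite lee_fin.
- by apply/measurable_EFinP.
- by apply: filterS fg => x fgx _; exact: le_trans (hf x) fgx.
Qed.

(** * Moments of the distance to the particle systems *)

Section particle_moments.
Context d (Omega : measurableType d) (R : realType) (P : probability Omega R).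
Notation mu := (@lebesgue_measure R).
Local Notation RT := (measurableTypeR R).
Variables (m : probability R R) (X0 : nat -> {RV P >-> R}).
Variables (W : nat -> R -> {RV P >-> R}).
Hypothesis inputs : initial_and_noise m X0 W.
Variables (sigma L B : R) (lam : R -> R).
Hypotheses (sigma0 : 0 < sigma) (L0 : 0 < L) (B0 : 0 < B).
Hypothesis lam_lip : forall x y, `|lam x - lam y| <= L * `|x - y|.
Hypothesis lam_bnd : forall x, `|lam x| <= B.
Variable X : nat -> R -> {RV P >-> R}.
Hypothesis mX : forall i, mckean_process X0 W sigma lam i (X i).

Lemma rank_at_bounds N (Y : 'I_N -> R -> {RV P >-> R}) s w i :
  (0 < rank_at Y s w i <= N)%N.
Proof.
apply/andP; split; first by rewrite /rank_at (bigD1 i)//= lexx.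
rewrite /rank_at -[leqRHS]card_ord -sum1_card; apply: leq_sum => j _.
exact: leq_b1.
Qed.

Lemma measurable_rank_at N (Y : 'I_N -> R -> {RV P >-> R}) (b : nat -> R) w i :
  (forall j, continuous_paths (Y j)) ->
  measurable_fun setT (fun s : RT => b (rank_at Y (Num.max 0 s) w i)).
Proof.
move=> cY.
have mr : measurable_fun setT (fun s : RT => (rank_at Y (Num.max 0 s) w i)%:R : R).
  rewrite (_ : (fun s => _) = (fun s : RT =>
      \sum_(j < N) (Y j (Num.max 0 s) w <= Y i (Num.max 0 s) w)%R%:R)); last first.
    by apply/funext => s; rewrite /rank_at natr_sum.
  apply: measurable_sum => j.
  rewrite (_ : (fun s => _) = (\1_[set s : RT |
      Y j (Num.max 0 s) w <= Y i (Num.max 0 s) w] : RT -> R)); last first.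
    apply/funext => s; rewrite indicE; congr (nat_of_bool _)%:R.
    by apply/idP/idP; rewrite inE.
  apply: measurable_indic; rewrite -[X in measurable X]setTI.
  have mp k : measurable_fun setT (fun s : RT => Y k (Num.max 0 s) w).
    exact: (measurable_fun_pair1 w (measurable_process (cY k))).
  exact: (measurable_fun_ler (mp j) (mp i)).
move=> _ A mA; rewrite setTI.
have -> : (fun s : RT => b (rank_at Y (Num.max 0 s) w i)) @^-1` A =
    \bigcup_(k in [set k | A (b k)])
      [set s : RT | (rank_at Y (Num.max 0 s) w i)%:R = k%:R :> R].
  apply/seteqP; split => s /=.
    by move=> h; exists (rank_at Y (Num.max 0 s) w i).
  by move=> [k /= Ak /eqP]; rewrite eqr_nat => /eqP ->.
apply: bigcup_measurable => k _; rewrite -[X in measurable X]setTI.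
exact: (mr measurableT [set k%:R]).
Qed.

(** The deterministic estimate is applied path by path, outside a null set common to all particles
    and times, with the distribution function of particle 0, which all the others share. *)
Lemma particle_path_distance (T c E : R) N q (b : nat -> R)
    (Y : 'I_N -> R -> {RV P >-> R}) :
  (1 < q)%N -> (0 < N)%N -> 0 < T -> 0 < c -> 0 <= E ->
  (forall t x y, 0 < t -> t <= T ->
    `|path_cdf (X 0) t x - path_cdf (X 0) t y| <= c / Num.sqrt t * `|x - y|) ->
  (forall k, (0 < k <= N)%N -> `|b k - lam (k%:R / N%:R)| <= E / N%:R) ->
  (forall i, continuous_paths (Y i)) ->
  (forall i : 'I_N, {ae P, forall w, forall t, 0 <= t ->
    Y i t w = X0 i w + sigma * W i t w +
      \int[mu]_(s in `[0, t]) b (rank_at Y s w i)}) ->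
  {ae P, forall w, forall (i : 'I_N) t, 0 <= t -> t <= T ->
    (`|X i t w - Y i t w|%:E <= (2 * expR (8 * (L * c) * Num.sqrt T))%:E *
      (L%:E * \int[mu]_(s in `]0%R, T]) ((10 * fluctuation X q N s w + 2) / N%:R)%:E +
       (E / N%:R * T)%:E))%E}.
Proof.
move=> q2 N0 T0 c0 E0 lip b_lam cY eqY.
have NR : 0 < N%:R :> R by rewrite ltr0n.
have aeX : {ae P, forall w, forall n, forall t, 0 <= t -> X n t w =
    X0 n w + sigma * W n t w + \int[mu]_(s in `[0, t]) mckean_drift lam (X n) (X n) s w}.
  by apply/ae_foralln => n; exact: (mckean_eq (mX n)).
have aeY : {ae P, forall w, forall (i : 'I_N) t, 0 <= t ->
    Y i t w = X0 i w + sigma * W i t w +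
      \int[mu]_(s in `[0, t]) b (rank_at Y s w i)}.
  exact: filter_forall.
have mb (i : 'I_N) w : measurable_fun setT
    (fun s : RT => b (rank_at Y (Num.max 0 s) w i)) by exact: measurable_rank_at.
have b_bnd (i : 'I_N) s w : `|b (rank_at Y s w i)| <= E / N%:R + B.
  have := b_lam _ (rank_at_bounds Y s w i); set r := (rank_at _ _ _ _).
  move=> h; rewrite -[b r](subrK (lam (r%:R / N%:R))).
  by apply: (le_trans (ler_normD _ _)); exact: lerD.
have ml n w : measurable_fun setT (fun s : RT => mckean_drift lam (X 0) (X n) s w).
  by apply: (measurable_mckean_drift L0 lam_lip); exact: (mckean_cont (mX _)).
have mln n w : measurable_fun setT (fun s : RT => mckean_drift lam (X n) (X n) s w).
  by apply: (measurable_mckean_drift L0 lam_lip); exact: (mckean_cont (mX _)).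
apply: filterS2 aeX aeY => w Xw Yw i t t0 tT.
have := @particle_distance R N (fun j s => X j (Num.max 0 s) w)
  (fun j s => Y j (Num.max 0 s) w) (path_cdf (X 0)) lam b
  (fun s => (10 * fluctuation X q N s w + 2) / N%:R) L c (E / N%:R)
  (B + (E / N%:R + B)) T L0 c0.
move=> H; rewrite -{1 2}(max_r t0); apply: H => //.
- by rewrite divr_ge0// ltW.
- move=> s y s0 sT; have := fluctuation_empirical inputs sigma0 L0 B0 lam_lip lam_bnd
    mX q2 0 w y N0 s0.
  by rewrite (max_r (ltW s0)) [N%:R * (_ / _)]mulrC divfK// gt_eqF.
- by move=> j; apply: measurable_funB; [exact: ml|exact: mb].
- move=> j s; apply: (le_trans (ler_normB _ _)); apply: lerD => //.
  exact: (b_bnd j (Num.max 0 s) w).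
- apply: measurable_funM => //; apply: measurable_funD => //; apply: measurable_funM => //.
  exact: (measurable_fun_pair1 w (measurable_fluctuation mX q N)).
- by move=> s; rewrite divr_ge0// addr_ge0// mulr_ge0// fluctuation_ge0.
move=> j u u0 uT; rewrite (max_r u0) Xw// Yw//.
rewrite opprD addrACA subrr add0r.
have -> : \int[mu]_(s in `[0, u]) b (rank_at Y s w j) =
    \int[mu]_(s in `[0, u]) b (rank_at Y (Num.max 0 s) w j).
  by apply: eq_Rintegral => s; rewrite inE/= in_itv/= => /andP[s0 _]; rewrite max_r.
rewrite (Rintegral_ocitv0 _ (mb j w) (fun s => b_bnd j _ w)).
rewrite (Rintegral_ocitv0 _ (mln j w) (fun s => lam_bnd _)).
rewrite -RintegralB//.
- apply: eq_Rintegral => s; rewrite inE/= in_itv/= => /andP[s0 _].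
  rewrite /mckean_drift; congr (lam _ - _).
  exact: (mckean_cdf_unique inputs sigma0 L0 B0 lam_lip lam_bnd).
- exact: (bounded_integrable_itv _ _ _ _ (mln j w) (fun s => lam_bnd _)).
- exact: (bounded_integrable_itv _ _ _ _ (mb j w) (fun s => b_bnd j _ w)).
Qed.

Let time_integral (T : R) q N w : \bar R :=
  (\int[mu]_(s in `]0%R, T]) (fluctuation X q N s w ^+ (2 * q))%:E)%E.

(** The time window becomes an indicator, so that Tonelli applies on the whole product space. *)
Let time_density (T : R) q N (z : RT * Omega) : \bar R :=
  (fluctuation X q N z.1 z.2 ^+ (2 * q) * \1_(`]0, T]%classic : set RT) z.1)%:E.

Let measurable_time_density (T : R) q N : measurable_fun setT (time_density T q N).
Proof.
apply/measurable_EFinP; apply: measurable_funM.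
  by apply: measurable_funX; exact: measurable_fluctuation.
have mI : measurable_fun setT (\1_(`]0, T]%classic : set RT) : RT -> R).
  by apply: measurable_indic; exact: measurable_itv.
exact: (measurableT_comp mI measurable_fst).
Qed.

Let time_density_ge0 (T : R) q N z : (0 <= time_density T q N z)%E.
Proof.
by rewrite lee_fin mulr_ge0 ?indicE// exprn_ge0// fluctuation_ge0.
Qed.

Let time_integralE (T : R) q N w : time_integral T q N w =
  (\int[mu]_s time_density T q N (s, w))%E.
Proof.
rewrite /time_integral integral_mkcond; apply: eq_integral => s _.
rewrite patchE /time_density/= indicE.
by case: ifPn => h; rewrite ?mulr1 ?mulr0.
Qed.

Lemma measurable_time_integral T q N : measurable_fun setT (time_integral T q N).
Proof.
rewrite (_ : time_integral T q N = fubini_G mu (time_density T q N)); last first.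
  by apply/funext => w; rewrite time_integralE.
exact: measurable_fun_fubini_tonelli_G.
Qed.

Lemma time_integral_moment T q N : (1 < q)%N -> (0 < N)%N -> 0 < T ->
  (\int[P]_w time_integral T q N w <=
   (chain_constant (R := R) q * N%:R ^+ q * T)%:E)%E.
Proof.
move=> q2 N0 T0.
under eq_integral do rewrite time_integralE.
rewrite -(@fubini_tonelli _ _ _ _ _ mu P (time_density T q N))//.
set c := chain_constant q * _.
rewrite [leLHS](_ : _ = \int[mu]_(s in `]0%R, T])
    \int[P]_w (fluctuation X q N s w ^+ (2 * q))%:E)%E; last first.
  rewrite [RHS]integral_mkcond; apply: eq_integral => s _.
  rewrite patchE /time_density/= indicE; case: ifPn => h.
    by under eq_integral do rewrite mulr1.
  by under eq_integral do rewrite mulr0; rewrite integral0.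
have := integral_ocitv_cst c (ltW T0); rewrite subr0 => <-.
apply: ge0_le_integral => //=.
- by move=> s _; apply: integral_ge0 => w _; rewrite lee_fin exprn_ge0// fluctuation_ge0.
- pose f (z : RT * Omega) := (fluctuation X q N z.1 z.2 ^+ (2 * q))%:E.
  have mf : measurable_fun setT f.
    by apply/measurable_EFinP/measurable_funX; exact: measurable_fluctuation.
  have f0 z : (0 <= f z)%E by rewrite lee_fin exprn_ge0// fluctuation_ge0.
  have := @measurable_fun_fubini_tonelli_F _ _ _ _ _ P f mf f0.
  by rewrite /fubini_F => mF; exact: (measurable_funTS mF).
- move=> s; rewrite in_itv/= => /andP[s0 _].
  exact: (fluctuation_moment inputs sigma0 L0 B0 lam_lip lam_bnd mX q2 N0 s0).
Qed.

(** [E / N] measures how far the drift [b] is from sampling [lam] at [k / N], so one statement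
    covers both systems. A measurable majorant [G] stands in for [sup_dist], whose measurability is
    not established. *)
Lemma particle_sup_moment (rho T E : R) : 0 < rho -> 0 < T -> 0 <= E ->
  exists2 C : R, 0 <= C & forall N (b : nat -> R) (Y : 'I_N -> R -> {RV P >-> R}),
  (forall k, (0 < k <= N)%N -> `|b k - lam (k%:R / N%:R)| <= E / N%:R) ->
  (forall i, continuous_paths (Y i)) ->
  (forall i : 'I_N, {ae P, forall w, forall t, 0 <= t ->
    Y i t w = X0 i w + sigma * W i t w +
      \int[mu]_(s in `[0, t]) b (rank_at Y s w i)}) ->
  forall i : 'I_N, exists G : Omega -> \bar R, [/\ measurable_fun setT G,
    (forall w, 0 <= G w)%E,
    {ae P, forall w, (sup_dist rho T (X i) (Y i) w <= G w)%E} &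
    (\int[P]_w G w <= (C * N%:R `^ (- (rho / 2)))%:E)%E].
Proof.
move=> rho0 T0 E0.
have [c c0 lip] := mckean_cdf_lipschitz inputs sigma0 L0 B0 lam_lip lam_bnd T0.
(* [1 < q] is for the chaining, [rho <= 2 * q] for passing from moments of order [2 * q] to order
   [rho]. *)
pose q := (Num.truncn rho).+2; have q2 : (1 < q)%N by [].
pose p := (2 * q).-1; have pE : p.+1 = (2 * q)%N by rewrite prednK.
have rho_q : rho <= (2 * q)%:R.
  apply: (le_trans (ltW (truncnS_gt rho))); rewrite ler_nat.
  by rewrite mul2n -addnn (leq_trans _ (leq_addr _ _)).
pose K := 2 * expR (8 * (L * c) * Num.sqrt T).
have K0 : 0 < K by rewrite mulr_gt0// expR_gt0.
(* The rounding term 2 of [fluctuation_empirical] and the error [E] go into [A1], its factor 10 into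
   [a1]; both get divided by [N] later. *)
pose A1 := K * (2 * L * T + E * T); pose a1 := K * L * 10.
have A10 : 0 <= A1 by rewrite mulr_ge0 ?(ltW K0)// addr_ge0 ?mulr_ge0// ltW.
have a10 : 0 < a1 by rewrite mulr_gt0// mulr_gt0.
pose C1 := 1 + 2 ^+ (2 * q) * A1 ^+ (2 * q).
pose C2 := (4 * a1) ^+ (2 * q) * T ^+ p.
have C10 : 0 <= C1 by rewrite addr_ge0// mulr_ge0 ?exprn_ge0.
have C20 : 0 <= C2 by rewrite mulr_ge0 ?exprn_ge0// ?mulr_ge0// ltW.
have cc0 : 0 <= chain_constant (R := R) q.
  by rewrite /chain_constant mulr_ge0// /moment_constant mulr_ge0 ?exprn_ge0// mulr_ge0.
exists (C1 + C2 * (chain_constant q * T)).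
  by rewrite addr_ge0// mulr_ge0// mulr_ge0// ltW.
move=> N b Y bE cY eqY i.
have N0 : (0 < N)%N by exact: leq_ltn_trans (ltn_ord i).
have NR : 0 < N%:R :> R by rewrite ltr0n.
have N1 : 1 <= N%:R :> R by rewrite ler1n.
set h := N%:R `^ _; have h0 : 0 < h by exact: powR_gt0.
pose J w := time_integral T q N w.
have J0 w : (0 <= J w)%E.
  by apply: integral_ge0 => s _; rewrite lee_fin exprn_ge0// fluctuation_ge0.
have mJ : measurable_fun setT J by exact: measurable_time_integral.
pose G w := (h%:E * (C1%:E + (C2 / N%:R ^+ q)%:E * J w))%E.
have C2N : 0 <= C2 / N%:R ^+ q by rewrite divr_ge0// exprn_ge0.
have G0 w : (0 <= C1%:E + (C2 / N%:R ^+ q)%:E * J w)%E.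
  by rewrite adde_ge0 ?lee_fin// mule_ge0// lee_fin.
have mG1 : measurable_fun setT (fun w => (C2 / N%:R ^+ q)%:E * J w)%E.
  by apply: emeasurable_funM => //; exact: measurable_cst.
have mG : measurable_fun setT (fun w => C1%:E + (C2 / N%:R ^+ q)%:E * J w)%E.
  by apply: emeasurable_funD => //; exact: measurable_cst.
exists G; split.
- by apply: emeasurable_funM => //; exact: measurable_cst.
- by move=> w; rewrite mule_ge0// lee_fin ltW.
- have := particle_path_distance q2 N0 T0 c0 E0 (fun t x y => lip 0 _ (mX 0) t x y) bE cY eqY.
  apply: filterS => w H; apply: ge_ereal_sup => _ [t /= + <-].
  rewrite in_itv/= => /andP[t0 tT].
  have {H} := H i t t0 tT; set y := `|_| => H.
  have y0 : 0 <= y by exact: normr_ge0.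
  pose V s := fluctuation X q N s w.
  have V0 s : 0 <= V s by exact: fluctuation_ge0.
  have mV : measurable_fun setT V.
    exact: (measurable_fun_pair1 w (measurable_fluctuation mX q N)).
  set IZ := (\int[mu]_(s in _) _)%E in H.
  pose IV := (\int[mu]_(s in `]0%R, T]) (V s)%:E)%E.
  have IV0 : (0 <= IV)%E by apply: integral_ge0 => s _; rewrite lee_fin.
  have IZE : IZ = ((10 / N%:R)%:E * IV + (2 / N%:R * T)%:E)%E.
    have mitv : measurable (`]0, T]%classic : set RT) by exact: measurable_itv.
    rewrite /IZ; under eq_integral do rewrite mulrDl mulrAC EFinD EFinM.
    rewrite ge0_integralD//=; first last.
    + apply/measurable_EFinP/measurable_funTS/measurable_funM => //.
    + by move=> s _; rewrite -EFinM lee_fin; apply: mulr_ge0 (V0 s).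
    rewrite ge0_integralZl//=; first last.
    + by move=> s _; rewrite lee_fin V0.
    + by apply/measurable_EFinP/measurable_funTS.
    by have := integral_ocitv_cst (2 / N%:R) (ltW T0); rewrite subr0 /cst => ->.
  have H' : (y%:E <= (A1 / N%:R)%:E + (a1 / N%:R)%:E * IV)%E.
    apply: (le_trans H); rewrite IZE.
    have [->|] := eqVneq IV +oo%E.
      by rewrite [X in (_ <= _ + X)%E]gt0_muley ?lte_fin ?divr_gt0// addey ?leey.
    rewrite -ltey => IVoo; have fIV : IV \is a fin_num by rewrite ge0_fin_numE.
    rewrite -(fineK fIV); set v := fine IV.
    change ((K * (L * (10 / N%:R * v + 2 / N%:R * T) + E / N%:R * T))%:E <=
      (A1 / N%:R + a1 / N%:R * v)%:E)%E.
    by rewrite lee_fin /A1 /a1 le_eqVlt; apply/orP; left; apply/eqP; ring.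
  have AN0 : 0 <= A1 / N%:R by rewrite divr_ge0// ltW.
  have aN0 : 0 < a1 / N%:R by rewrite divr_gt0.
  have := power_le_integral p y0 AN0 aN0 T0 mV V0 H'; rewrite pE => {}H.
  move: H; rewrite -/(time_integral T q N w) -/(J w) /G.
  have [->|] := eqVneq (J w) +oo%E.
    have C2N' : 0 < C2 / N%:R ^+ q by rewrite divr_gt0 ?exprn_gt0// mulr_gt0 ?exprn_gt0// mulr_gt0.
    by move=> _; rewrite gt0_muley ?lte_fin// addey// gt0_muley ?lte_fin ?leey.
  rewrite -ltey => Joo; have fJ : J w \is a fin_num by rewrite ge0_fin_numE.
  have := J0 w; rewrite -(fineK fJ) lee_fin; set j := fine (J w) => j0.
  change (((y ^+ (2 * q))%:E <= (2 ^+ (2 * q) * (A1 / N%:R) ^+ (2 * q) +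
      (4 * (a1 / N%:R)) ^+ (2 * q) * T ^+ p * j)%:E)%E ->
    ((y `^ rho)%:E <= (h * (C1 + C2 / N%:R ^+ q * j))%:E)%E).
  rewrite !lee_fin => H.
  (* The distance [y] is of order [1 / sqrt N]: after rescaling by [r], its power [rho] is at most 1
     plus its power [2 * q]. Of the resulting [N ^- (2 * q)] in the majorant, [r ^+ (2 * q)] leaves
     [N ^- q], which the fluctuation moment cancels. *)
  pose r : R := Num.sqrt N%:R; have r0 : 0 <= r by exact: sqrtr_ge0.
  have rN : r ^+ (2 * q) = N%:R ^+ q by rewrite exprM sqr_sqrtr// ltW.
  have rh : h * r `^ rho = 1.
    rewrite /r -powR12_sqrt ?(ltW NR)// -powRrM /h mulrC -powRD.
      by rewrite (mulrC rho) subrr powRr0.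
    by rewrite [X in ~~ X](gt_eqF NR) implybT.
  have -> : y `^ rho = h * (r * y) `^ rho by rewrite powRM// mulrA rh mul1r.
  rewrite ler_pM2l//; apply: (le_trans (powR_le_add1 _ (mulr_ge0 r0 y0) rho_q)).
    exact: ltW.
  rewrite /C1 -addrA lerD2l exprMn rN.
  have Nq : N%:R ^+ q != 0 :> R by rewrite expf_neq0// gt_eqF.
  have Nq0 : 0 < N%:R ^+ q :> R by rewrite exprn_gt0.
  have N2q : N%:R ^+ (2 * q) = N%:R ^+ q * N%:R ^+ q :> R by rewrite -exprD mul2n addnn.
  apply: (le_trans (ler_wpM2l (ltW Nq0) H)); rewrite mulrDr; apply: lerD; last first.
    rewrite [4 * (a1 / _)]mulrA expr_div_n N2q /C2.
    by rewrite le_eqVlt; apply/orP; left; apply/eqP; field.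
  rewrite mulrCA ler_wpM2l ?exprn_ge0// expr_div_n N2q.
  have -> : N%:R ^+ q * (A1 ^+ (2 * q) / (N%:R ^+ q * N%:R ^+ q)) = A1 ^+ (2 * q) / N%:R ^+ q.
    by field.
  by rewrite ler_pdivrMr// ler_peMr ?exprn_ge0// exprn_ege1.
- rewrite /G ge0_integralZl//; last by rewrite lee_fin ltW.
  rewrite ge0_integralD//; first last.
  + by move=> w _; rewrite mule_ge0// lee_fin.
  rewrite integral_cst// [X in (C1%:E * X)%E](_ : _ = 1%E); last exact: probability_setT.
  rewrite mule1 ge0_integralZl//.
  have := time_integral_moment q2 N0 T0 => JT.
  apply: (@le_trans _ _ (h%:E * (C1%:E + (C2 / N%:R ^+ q)%:E *
      (chain_constant q * N%:R ^+ q * T)%:E))%E).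
    apply: lee_wpmul2l; first by rewrite lee_fin ltW.
    by apply: leeD2l; apply: lee_wpmul2l; rewrite ?lee_fin.
  change ((h * (C1 + C2 / N%:R ^+ q * (chain_constant q * N%:R ^+ q * T)))%:E <=
    ((C1 + C2 * (chain_constant q * T)) * h)%:E)%E.
  rewrite lee_fin mulrC ler_pM2r// lerD2l.
  have Nq : N%:R ^+ q != 0 :> R by rewrite expf_neq0// gt_eqF.
  by rewrite le_eqVlt; apply/orP; left; apply/eqP; field.
Qed.

End particle_moments.

(** * The drift on the unit interval *)

Section unit_interval_drift.
Context {R : realType}.

(** [lam] is controlled on [[0, 1]] only; composing it with this 1-Lipschitz projection extends it
    to a bounded Lipschitz function on the line. *)
Definition clamp (x : R) : R := Num.max 0 (Num.min 1 x).

Lemma clamp_in01 x : clamp x \in `[0, 1]%R.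
Proof. by rewrite in_itv/= /clamp le_max lexx/= ge_max ler01 ge_min lexx. Qed.

Lemma clamp_id x : x \in `[0, 1]%R -> clamp x = x.
Proof. by rewrite in_itv/= => /andP[x0 x1]; rewrite /clamp min_r// max_r. Qed.

Lemma clamp_dist x y : `|clamp x - clamp y| <= `|x - y|.
Proof.
have H u v : u <= v -> clamp v - clamp u <= v - u /\ clamp u <= clamp v.
  rewrite /clamp => uv; rewrite !maxEle !minEle.
  by do 4 case: ifPn; rewrite -?ltNge; split; lra.
wlog xy : x y / x <= y.
  move=> W; have [/W//|/ltW/W] := leP x y.
  by rewrite distrC [leRHS]distrC.
have [h1 h2] := H _ _ xy.
by rewrite distrC ger0_norm ?subr_ge0// distrC ger0_norm ?subr_ge0.
Qed.

Variables (Lam lam : R -> R) (L : R).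
Hypothesis LamC1 : C1_unit_interval Lam lam.
Hypothesis lam_lip : forall x y, x \in `[0, 1]%R -> y \in `[0, 1]%R ->
  `|lam x - lam y| <= L * `|x - y|.

Let quotient_near x e : x \in `[0, 1]%R -> 0 < e -> exists2 r, 0 < r &
  forall y, y \in `[0, 1]%R -> y != x -> `|x - y| < r ->
  `|lam x - (Lam y - Lam x) / (y - x)| < e.
Proof.
move=> x01 e0; have /cvgrPdist_lt /(_ _ e0) := LamC1.1 _ x01.
move=> /nbhs_ballP[r /= r0 H]; exists r => // y y01 yx xy.
exact: (H y).
Qed.

Let is_derive_Lam (x : R) : 0 < x -> x < 1 -> is_derive x 1 Lam (lam x).
Proof.
move=> x0 x1; have x01 : x \in `[0, 1]%R by rewrite in_itv/= !ltW.
have H : h^-1 *: (Lam (h *: 1 + x) - Lam x) @[h --> 0^'] --> lam x.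
  apply/cvgrPdist_lt => e e0; have [r r0 Hr] := quotient_near x01 e0.
  have d0 : 0 < Num.min r (Num.min x (1 - x)) by rewrite !lt_min r0 x0 subr_gt0.
  apply/nbhs_ballP; exists (Num.min r (Num.min x (1 - x))) => //= h.
  rewrite /ball/= sub0r normrN !lt_min => /andP[hr /andP[hx hx1]] h0.
  have := Hr (h + x); rewrite addrK opprD addrCA subrr addr0 normrN.
  rewrite /GRing.scale/= mulr1 [h^-1 * _]mulrC; apply => //.
    by rewrite in_itv/=; move: hx hx1; rewrite !ltr_norml; lra.
  by rewrite -subr_eq0 addrK.
split; first by apply/cvg_ex; exists (lam x).
exact: cvg_lim H.
Qed.

(** Near [x] the difference quotients are bounded by [|lam x| + 1]; this covers the end points too,
    where the derivative is one-sided. *)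
Let continuous_Lam a b : 0 <= a -> b <= 1 -> {within `[a, b], continuous Lam}.
Proof.
move=> a0 b1; apply/subspace_continuousP => x; rewrite /= in_itv/= => /andP[ax xb].
have x01 : x \in `[0, 1]%R by rewrite in_itv/=; lra.
have [r r0 Hr] := quotient_near x01 ltr01.
apply/cvgrPdist_lt => e e0.
have k0 : 0 < `|lam x| + 1 by rewrite ltr_wpDl.
apply/nbhs_ballP; exists (Num.min r (e / (`|lam x| + 1))) => /=.
  by rewrite lt_min r0 divr_gt0.
move=> y; rewrite /ball/= lt_min => /andP[xyr xye]; rewrite in_itv/= => /andP[ay yb].
have [->|yx] := eqVneq y x; first by rewrite subrr normr0.
have y01 : y \in `[0, 1]%R by rewrite in_itv/=; lra.
have h := Hr y y01 yx xyr.
have q1 : `|(Lam y - Lam x) / (y - x)| <= `|lam x| + 1.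
  have -> : (Lam y - Lam x) / (y - x) = lam x - (lam x - (Lam y - Lam x) / (y - x)).
    by rewrite subKr.
  by apply: (le_trans (ler_normB _ _)); rewrite lerD2l ltW.
have yx0 : y - x != 0 by rewrite subr_eq0.
have -> : Lam x - Lam y = (Lam y - Lam x) / (y - x) * (x - y).
  by field.
rewrite normrM; apply: (le_lt_trans (ler_wpM2r _ q1)) => //.
by rewrite mulrC -ltr_pdivlMr.
Qed.

(** By the mean value theorem, [lambdaN Lam N k] is the value of [lam] at a point within [1 / N] of
    [k / N]. *)
Lemma lambdaN_close N k : (0 < k <= N)%N ->
  `|lambdaN Lam N k - lam (k%:R / N%:R)| <= L / N%:R.
Proof.
move=> /andP[k0 kN]; have N0 : (0 < N)%N by exact: leq_trans kN.
have NR : 0 < N%:R :> R by rewrite ltr0n.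
have kR : 1 <= k%:R :> R by rewrite ler1n.
have kNR : k%:R <= N%:R :> R by rewrite ler_nat.
pose a : R := (k%:R - 1) / N%:R; pose b : R := k%:R / N%:R.
have ab : a < b by rewrite ltr_pM2r ?invr_gt0// ltrBlDr ltrDl.
have a0 : 0 <= a by rewrite divr_ge0 ?subr_ge0// ltW.
have b1 : b <= 1 by rewrite ler_pdivrMr// mul1r.
have ba : b - a = N%:R^-1 by rewrite /a /b -mulrBl opprB addrC subrK mul1r.
have [|c] := @MVT R Lam lam a b ab _ (continuous_Lam a0 b1).
  move=> x; rewrite in_itv/= => /andP[ax xb].
  by apply: is_derive_Lam; [exact: le_lt_trans ax|exact: lt_le_trans b1].
rewrite in_itv/= => /andP[ac cb] E.
have -> : lambdaN Lam N k = lam c.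
  by rewrite /lambdaN -/a -/b E ba mulrC mulfVK// gt_eqF.
have c01 : c \in `[0, 1]%R by rewrite in_itv/=; lra.
have b01 : b \in `[0, 1]%R by rewrite in_itv/=; lra.
have L0 : 0 <= L.
  have := lam_lip c01 b01 => /(le_trans (normr_ge0 _)).
  by rewrite pmulr_lge0// normr_gt0 subr_eq0 lt_eqF.
apply: (le_trans (lam_lip c01 b01)); rewrite ler_wpM2l// -ba.
by rewrite distrC gtr0_norm ?subr_gt0//; lra.
Qed.

End unit_interval_drift.

Theorem theorem2p1 (R : realType) (d : measure_display)
    (Omega : measurableType d) (P : probability Omega R)
    (sigma : R) (Lam lam : R -> R) (m : probability R R)
    (X0 : nat -> {RV P >-> R}) (W : nat -> R -> {RV P >-> R})
    (X : nat -> R -> {RV P >-> R})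
    (XN XNb : forall N : nat, 'I_N -> R -> {RV P >-> R}) :
  0 < sigma ->
  C1_unit_interval Lam lam ->
  initial_and_noise m X0 W ->
  (forall i, mckean_strong_solution sigma lam X0 W i (X i)) ->
  (forall N, (0 < N)%N ->
     particle_strong_solution sigma (lambdaN Lam N) X0 W (XN N)) ->
  (forall N, (0 < N)%N ->
     particle_strong_solution sigma (fun k => lam (k%:R / N%:R)) X0 W (XNb N)) ->
  [lipschitz lam x | x in `[0, 1]] ->
  forall rho T : R, 0 < rho -> 0 < T ->
  exists C : R, forall N : nat, (0 < N)%N ->
    (\big[maxe/-oo]_(i < N)
       \int[P]_w (sup_dist rho T (X i) (XN N i) w +
                  sup_dist rho T (X i) (XNb N i) w)
     <= (C * N%:R `^ (- (rho / 2)))%:E)%E.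
Proof.
move=> sigma0 LamC1 inputs solX solXN solXNb [r [_ lipr]] rho T rho0 T0.
have [L L0 lamL] : exists2 L : R, 0 < L & forall x y, x \in `[0, 1]%R ->
    y \in `[0, 1]%R -> `|lam x - lam y| <= L * `|x - y|.
  (* The Lipschitz hypothesis holds for all constants beyond [r]; this one is moreover positive. *)
  have rM : r < Num.max 0 r + 1 by rewrite ltr_pwDr// le_max lexx orbT.
  exists (Num.max 0 r + 1); first by rewrite ltr_wpDl// le_max lexx.
  by move=> x y x01 y01; exact: (lipr _ rM (x, y)).
pose lamc x := lam (clamp x).
have lam_lip x y : `|lamc x - lamc y| <= L * `|x - y|.
  apply: (le_trans (lamL _ _ (clamp_in01 x) (clamp_in01 y))).
  by rewrite ler_wpM2l ?(ltW L0)// clamp_dist.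
pose B := `|lam 0| + L; have B0 : 0 < B by rewrite ltr_wpDl.
have lam_bnd x : `|lamc x| <= B.
  rewrite /B -lerBlDl; apply: (le_trans (lerB_dist _ _)).
  have i0 : (0 : R) \in `[0, 1]%R by rewrite in_itv/= lexx ler01.
  apply: (le_trans (lamL _ _ (clamp_in01 x) i0)); rewrite subr0 ler_piMr ?(ltW L0)//.
  by have := clamp_in01 x; rewrite in_itv/= => /andP[? ?]; rewrite ger0_norm.
have mX i : mckean_process X0 W sigma lamc i (X i).
  have [cX aX eX] := solX i; split => //; apply: filterS eX => w Xw t t0.
  rewrite Xw//; congr (_ + _); apply: eq_Rintegral => s.
  rewrite inE/= in_itv/= => /andP[s0 _].
  rewrite /mckean_drift /lamc clamp_id ?cdfr_in01//.
  by rewrite /path_cdf (max_r s0).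
have rank01 N k : (0 < k <= N)%N -> (k%:R / N%:R : R) \in `[0, 1]%R.
  move=> /andP[k0 kN]; have NR : 0 < N%:R :> R by rewrite ltr0n (leq_trans k0).
  by rewrite in_itv/= divr_ge0 ?ler_pdivrMr ?mul1r ?ler_nat// ltW.
have bN N k : (0 < k <= N)%N ->
    `|lambdaN Lam N k - lamc (k%:R / N%:R)| <= L / N%:R.
  by move=> kN; rewrite /lamc clamp_id ?rank01//; exact: lambdaN_close.
(* The second system samples [lam] exactly at [k / N], so its discretization error is 0. *)
have bNb N k : (0 < k <= N)%N ->
    `|lam (k%:R / N%:R) - lamc (k%:R / N%:R)| <= 0 / N%:R.
  by move=> kN; rewrite /lamc clamp_id ?rank01// subrr normr0 mul0r.
have [C1 C10 H1] := particle_sup_moment inputs sigma0 L0 B0 lam_lip lam_bnd mX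
  rho0 T0 (ltW L0).
have [C2 C20 H2] := particle_sup_moment inputs sigma0 L0 B0 lam_lip lam_bnd mX
  rho0 T0 (lexx 0).
exists (C1 + C2) => N N0.
have [cN _ eN] := solXN N N0; have [cNb _ eNb] := solXNb N N0.
have sup_ge0 (Y Z : R -> Omega -> R) w : (0 <= sup_dist rho T Y Z w)%E.
  apply: (@le_trans _ _ (`|Y 0 w - Z 0 w| `^ rho)%:E); first by rewrite lee_fin powR_ge0.
  by apply: ereal_sup_ubound; exists 0 => //=; rewrite in_itv/= lexx ltW.
(* The bound is uniform in [i], so it passes to the maximum, whose starting value is [-oo]. *)
elim/big_ind: _ => [|x y Hx Hy|i _]; first exact: leNye.
  by rewrite ge_max Hx.
have [G1 [mG1 G10 sG1 IG1]] := H1 _ _ _ (bN N) cN eN i.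
have [G2 [mG2 G20 sG2 IG2]] := H2 _ _ _ (bNb N) cNb eNb i.
apply: (@le_trans _ _ (\int[P]_w (G1 w + G2 w))%E).
  apply: ae_le_integral.
  - by move=> w; rewrite adde_ge0.
  - by move=> w; rewrite adde_ge0.
  - exact: emeasurable_funD.
  - by apply: filterS2 sG1 sG2 => w; exact: leeD.
rewrite ge0_integralD// mulrDl EFinD; exact: leeD.
Qed.
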